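(* Let $T:(X_0,X_1)\to(Y_0,Y_1)$ be an operator between couples of complex Banach spaces. If $T:[X_0,X_1]_{\theta_*}\to[Y_0,Y_1]_{\theta_*}$ is invertible for some $\theta_*\in(0,1)$, then $T:(X_0,X_1)_{\theta_*,q}\to(Y_0,Y_1)_{\theta_*,q}$ is invertible for every $q\in[1,\infty]$.
   Context: An operator $T:\vec X\to\vec Y$ is a linear map $X_0+X_1\to Y_0+Y_1$ bounded $X_j\to Y_j$. $[\vec X]_\theta$ is Calderón's (lower) complex interpolation space: $\{f(\theta):f\in\mathcal F(\vec X)\}$ with the quotient norm, where $\mathcal F(\vec X)$ consists of bounded continuous $f:\{0\le\mathrm{Re}\,z\le1\}\to X_0+X_1$ analytic in the open strip with $t\mapsto f(j+it)$ bounded continuous into $X_j$, normed by $\max_j\sup_t\|f(j+it)\|_{X_j}$. $(X_0,X_1)_{\theta,q}$ is the real interpolation space with norm $\big(\int_0^\infty(t^{-\theta}K(t,x;\vec X))^q\,dt/t\big)^{1/q}$ (sup for $q=\infty$), $K(t,x;\vec X)=\inf\{\|x_0\|_{X_0}+t\|x_1\|_{X_1}:x=x_0+x_1\}$. *)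

(* Defs.v *)
From mathcomp Require Import all_boot all_order all_algebra.
From mathcomp Require Import all_classical all_reals all_analysis.
From mathcomp.real_closed Require Import complex.
Set Implicit Arguments. Unset Strict Implicit. Unset Printing Implicit Defensive.
Import Order.TTheory GRing.Theory Num.Theory.
Local Open Scope classical_set_scope.
Local Open Scope ring_scope.

Section Interpolation.
Context {R : realType}.
Local Notation C := (R[i]).

Definition cabs (z : C) : R :=
  Num.sqrt (complex.Re z ^+ 2 + complex.Im z ^+ 2).

Section OneSpace.
Context {V : lmodType C}.

(* An extended norm on the ambient space V: the Banach space X is
   { x | N x < +oo } with norm N. *)
Definition is_enorm (N : V -> \bar R) : Prop :=
  [/\ forall x, (0 <= N x)%E,
      N 0 = 0%E,
      forall x, N x = 0%E -> x = 0,
      forall x y, (N (x + y)%R <= N x + N y)%E &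
      forall (a : C) x, a != 0 -> N (a *: x) = ((cabs a)%:E * N x)%E].

Definition ecomplete (N : V -> \bar R) : Prop :=
  forall u : nat -> V, (forall k, (N (u k) < +oo)%E) ->
    (forall e : R, 0 < e -> exists M : nat, forall k l : nat,
        (M <= k)%N -> (M <= l)%N -> (N (u k - u l)%R < e%:E)%E) ->
    exists x : V, (N x < +oo)%E /\
      forall e : R, 0 < e -> exists M : nat, forall k : nat,
        (M <= k)%N -> (N (u k - x)%R < e%:E)%E.

Definition Kfun (N0 N1 : V -> \bar R) (t : R) (x : V) : \bar R :=
  ereal_inf [set z | exists x0 x1 : V,
               x0 + x1 = x /\ z = (N0 x0 + t%:E * N1 x1)%E].

(* (N0, N1) is a compatible couple of complex Banach spaces (X0, X1) whose
   ambient space V is exactly X0 + X1, and K(1,.) is a norm on X0 + X1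
   (Hausdorff condition). *)
Definition is_couple (N0 N1 : V -> \bar R) : Prop :=
  [/\ is_enorm N0 /\ is_enorm N1, ecomplete N0 /\ ecomplete N1,
      (forall v : V, exists x0 x1 : V,
          [/\ v = x0 + x1, (N0 x0 < +oo)%E & (N1 x1 < +oo)%E]) &
      (forall v : V, Kfun N0 N1 1 v = 0%E -> v = 0)].

Definition admissible (N0 N1 : V -> \bar R) (f : C -> V) : Prop :=
  let S := Kfun N0 N1 1 in
  [/\
      (exists M : R, forall z : C, 0 <= complex.Re z <= 1 ->
          (S (f z) <= M%:E)%E),
      (forall z : C, 0 <= complex.Re z <= 1 -> forall e : R, 0 < e ->
          exists d : R, 0 < d /\ forall w : C, 0 <= complex.Re w <= 1 ->
            cabs (w - z) < d -> (S (f w - f z)%R < e%:E)%E),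
      (forall z : C, 0 < complex.Re z < 1 -> exists f' : V,
          forall e : R, 0 < e -> exists d : R, 0 < d /\
            forall h : C, h != 0 -> cabs h < d ->
              (S (h^-1 *: (f (z + h) - f z) - f')%R < e%:E)%E) &
      (forall j : bool, let N := if j then N1 else N0 in
         (exists M : R, forall t : R,
             (N (f (Complex (j%:R) t)) <= M%:E)%E) /\
         (forall t : R, forall e : R, 0 < e -> exists d : R, 0 < d /\
             forall s : R, `|s - t| < d ->
               (N (f (Complex (j%:R) s) - f (Complex (j%:R) t))%R < e%:E)%E))].

Definition Fnorm (N0 N1 : V -> \bar R) (f : C -> V) : \bar R :=
  maxe (ereal_sup [set N0 (f (Complex 0 t)) | t in [set: R]])
       (ereal_sup [set N1 (f (Complex 1 t)) | t in [set: R]]).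

(* norm of the complex interpolation space [X0,X1]_theta (+oo outside it) *)
Definition cinterp (N0 N1 : V -> \bar R) (theta : R) (x : V) : \bar R :=
  ereal_inf [set Fnorm N0 N1 f |
             f in [set f | admissible N0 N1 f /\ f (Complex theta 0) = x]].

(* norm of the real interpolation space (X0,X1)_{theta,q} (+oo outside it) *)
Definition rinterp (N0 N1 : V -> \bar R) (theta : R) (q : \bar R) (x : V)
    : \bar R :=
  match q with
  | +oo%E => ereal_sup [set ((t `^ (- theta))%R%:E * Kfun N0 N1 t x)%E
                        | t in `]0, +oo[%classic]
  | r%:E => poweR (\int[@lebesgue_measure R]_(t in `]0, +oo[%classic)
                 (poweR ((t `^ (- theta))%R%:E * Kfun N0 N1 t x)%E r
                   * (t^-1)%R%:E)%E) (r^-1)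
  | -oo%E => +oo%E
  end.

End OneSpace.

Section Maps.
Context {V W : lmodType C}.

Definition bounded_between (NX : V -> \bar R) (NY : W -> \bar R)
    (T : V -> W) : Prop :=
  exists c : R, forall x : V, (NX x < +oo)%E ->
    (NY (T x) <= c%:E * NX x)%E.

Definition invertible_between (NX : V -> \bar R) (NY : W -> \bar R)
    (T : V -> W) : Prop :=
  [/\ forall x : V, (NX x < +oo)%E -> (NY (T x) < +oo)%E,
      bounded_between NX NY T,
      forall y : W, (NY y < +oo)%E -> exists x : V, (NX x < +oo)%E /\ T x = y &
      exists c : R, forall x : V, (NX x < +oo)%E ->
        (NX x <= c%:E * NY (T x))%E].

End Maps.
End Interpolation.

(* Main.v *)
From HB Require Import structures.
Require Import Defs.
From mathcomp Require Import all_boot all_order all_algebra.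
From mathcomp Require Import all_classical all_reals all_analysis.
From mathcomp.real_closed Require Import complex.
From mathcomp Require Import measurable_realfun.
From mathcomp Require Import ring lra.
Set Implicit Arguments. Unset Strict Implicit. Unset Printing Implicit Defensive.
Import Order.TTheory GRing.Theory Num.Theory.
Import numFieldNormedType.Exports.
Local Open Scope classical_set_scope.
Local Open Scope ring_scope.

(** Invertibility at [theta] propagates, with bounds, to the points
    [theta +- e].  Given [y] in [Y0] and [Y1], let [g z = s ^ (z - theta) y].
    Solve [T f = g] at the point [theta] with [f] in the Calderon space, divide
    the error [g - T f] by [z - theta], which stays in the Calderon space, and
    repeat.  This gives [T (P_n z) = g z - (z - theta)^n g_n z] with
    [g_n = O(B^n)] and [K(t, P_n z) = O(t^(Re z))] near [theta].  Let
    [T x = y].  On the line [Re z = theta], translation along the line and the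
    lower bound for [T] show that [P_n z - s^(z - theta) x] is of size
    [O(e^(-n))], and the maximum principle with the weight
    [exp (n (r - z + theta)^2)] carries the smallness to [theta +- r/2], where
    only the bound for [P_n] remains in the limit:
      [K(t, x) <= C J(s, y) (t/s)^theta min(t/s, s/t)^e].
    An element [y] of the real interpolation space is a sum of pieces [y_k]
    with [J(e^k t, y_k) <= C K(e^k t, y)]; inverting [T] on the pieces gives a
    preimage [x] for which [t^(-theta) K(t, x)] is dominated by the sum of the
    dilates of [t^(-theta) K(t, y)] by [e^k] with weights [e^(-e |k|)], and the
    measure [dt/t] is invariant under dilations. *)

(** The difference [P_n z - s^(z - theta) x] is small only on the line [Re z = theta], where the
    hypothesis on [T] applies; near that line there is only a bound uniform in [n]. The weight
    settles the conflict on the rectangle [0 <= x <= r], [|y| <= r] in [z - theta = x + i y], and on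
    its mirror image: its modulus [e^(n ((r - x)^2 - y^2))] is at most [e^n] on [x = 0], where the
    factor [e^(-n)] absorbs it, at most [1] on the three other sides, and [e^(n r^2 / 4)] at the
    point [r / 2], so the difference is [O(e^(-n r^2 / 4))] there. The rate [e^(-n)] comes from a
    disc so small that [|z - theta| B <= 1 / e]. For the real method the inversion is done once, in
    the space with [q = oo], which contains all the others; [q] enters only in the final
    integration. Uniqueness has to be proved there anew, since injectivity is given on the complex
    space alone. Vector-valued functions are never integrated: norming functionals reduce them to
    scalar ones, and the scalar maximum principle rests on primitives along the sides of
    rectangles. *)

Section LinearCombinations.
Context {K : nzRingType} {V : lmodType K}.

(** Syntax for reflection: [ring] and [field] act on scalars, so vector identities are reified over
    a list of atoms and compared atom by atom. *)
Inductive lincomb :=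
  | LVar of nat | LZero | LAdd of lincomb & lincomb | LOpp of lincomb
  | LScale of K & lincomb.

Fixpoint lcdenote (env : seq V) (e : lincomb) : V :=
  match e with
  | LVar i => nth 0 env i
  | LZero => 0
  | LAdd e1 e2 => lcdenote env e1 + lcdenote env e2
  | LOpp e1 => - lcdenote env e1
  | LScale a e1 => a *: lcdenote env e1
  end.

(** The test is [eqn] rather than [==] so that the [cbn] call of [lincomb_goal] evaluates it on
    numerals. *)
Fixpoint lccoef (e : lincomb) (i : nat) : K :=
  match e with
  | LVar j => if eqn i j then 1 else 0
  | LZero => 0
  | LAdd e1 e2 => lccoef e1 i + lccoef e2 i
  | LOpp e1 => - lccoef e1 i
  | LScale a e1 => a * lccoef e1 i
  end.

(** A recursive conjunction instead of a quantifier: after [cbn], [repeat split] leaves one scalar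
    goal per atom. *)
Fixpoint lceq (n : nat) (e1 e2 : lincomb) : Prop :=
  if n is n'.+1 then lccoef e1 n' = lccoef e2 n' /\ lceq n' e1 e2 else True.

Lemma lcdenoteE env e :
  lcdenote env e = \sum_(i < size env) lccoef e i *: nth 0 env i.
Proof.
elim: e => /= [j||e1 -> e2 ->|e1 ->|a e1 ->].
- have [jn|nj] := ltnP j (size env); last first.
    rewrite nth_default// big1// => i _; rewrite eqnE.
    case: eqP => [ij|]; last by rewrite scale0r.
    by move: (ltn_ord i); rewrite ij ltnNge nj.
  rewrite (bigD1 (Ordinal jn))//= big1.
    by rewrite eqnE eqxx scale1r addr0.
  move=> i; rewrite -val_eqE/= => /negbTE ij.
  by rewrite eqnE ij scale0r.
- by rewrite big1// => i _; rewrite scale0r.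
- by rewrite -big_split/=; apply: eq_bigr => i _; rewrite scalerDl.
- by rewrite -sumrN; apply: eq_bigr => i _; rewrite scaleNr.
- by rewrite scaler_sumr; apply: eq_bigr => i _; rewrite scalerA.
Qed.

Lemma lincomb_eq env e1 e2 : lceq (size env) e1 e2 ->
  lcdenote env e1 = lcdenote env e2.
Proof.
move=> H; rewrite !lcdenoteE; apply: eq_bigr => i _; congr (_ *: _).
elim: (size env) i H => [[]//|n IH] i /= [Hn H].
have := ltn_ord i; rewrite ltnS leq_eqVlt => /orP[/eqP -> //|lt].
exact: (IH (Ordinal lt)).
Qed.

End LinearCombinations.

Ltac lc_index v env :=
  lazymatch env with
  | v :: _ => constr:(0%N)
  | _ :: ?env' => let n := lc_index v env' in constr:(S n)
  end.

Ltac lc_mem v env :=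
  lazymatch env with
  | nil => constr:(false)
  | v :: _ => constr:(true)
  | _ :: ?env' => lc_mem v env'
  end.

Ltac lc_env t env :=
  lazymatch t with
  | @GRing.add _ ?x ?y => let e := lc_env x env in lc_env y e
  | @GRing.opp _ ?x => lc_env x env
  | @GRing.scale _ _ _ ?x => lc_env x env
  | @GRing.zero _ => env
  | _ => let b := lc_mem t env in
         lazymatch b with true => env | false => constr:(t :: env) end
  end.

Ltac lc_reify K t env :=
  lazymatch t with
  | @GRing.add _ ?x ?y =>
      let a := lc_reify K x env in let b := lc_reify K y env in
      constr:(@LAdd K a b)
  | @GRing.opp _ ?x => let a := lc_reify K x env in constr:(@LOpp K a)
  | @GRing.scale _ _ ?c ?x =>
      let a := lc_reify K x env in constr:(@LScale K c a)
  | @GRing.zero _ => constr:(@LZero K)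
  | _ => let n := lc_index t env in constr:(@LVar K n)
  end.

(* Reduces an identity between linear combinations of vectors to the identities
   of its coefficients, which are then within the reach of [ring] and [field]. *)
Ltac lincomb_goal K V :=
  lazymatch goal with
  | |- ?l = ?r =>
    let env0 := lc_env l (@nil V) in
    let env := lc_env r env0 in
    let e1 := lc_reify K l env in
    let e2 := lc_reify K r env in
    change (@lcdenote K V env e1 = @lcdenote K V env e2);
    apply: lincomb_eq; cbn [lceq lccoef size eqn];
    repeat split
  end.

Notation cRe := complex.Re.
Notation cIm := complex.Im.

(** * Seminorm-valued calculus in one complex variable *)

Section ComplexModulus.
Context {R : realType}.
Local Notation C := R[i].
Implicit Types z w : C.

Lemma cabsE z : cabs z = ComplexField.Normc.normc z.
Proof. by case: z. Qed.

Lemma cabs_ge0 z : 0 <= cabs z.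
Proof. exact: sqrtr_ge0. Qed.

Lemma cabs0 : cabs (0 : C) = 0.
Proof. by rewrite cabsE ComplexField.Normc.normc0. Qed.

Lemma cabs1 : cabs (1 : C) = 1.
Proof. by rewrite cabsE ComplexField.Normc.normc1. Qed.

Lemma cabsM z w : cabs (z * w) = cabs z * cabs w.
Proof. by rewrite !cabsE ComplexField.Normc.normcM. Qed.

Lemma cabsV z : cabs z^-1 = (cabs z)^-1.
Proof. by rewrite !cabsE ComplexField.Normc.normcV. Qed.

Lemma cabsX z n : cabs (z ^+ n) = cabs z ^+ n.
Proof. by elim: n => [|n IH]; rewrite ?expr0 ?cabs1// !exprS cabsM IH. Qed.

Lemma cabsD z w : cabs (z + w) <= cabs z + cabs w.
Proof. by rewrite !cabsE; exact: le_normcD. Qed.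

Lemma cabsN z : cabs (- z) = cabs z.
Proof. by rewrite !cabsE normcN. Qed.

Lemma cabs_eq0 z : (cabs z == 0) = (z == 0).
Proof.
apply/eqP/eqP => [|->]; last exact: cabs0.
by rewrite cabsE; apply: ComplexField.Normc.eq0_normc.
Qed.

Lemma cabs_gt0 z : (0 < cabs z) = (z != 0).
Proof. by rewrite lt_def cabs_ge0 andbT cabs_eq0. Qed.

Lemma cabs_real (x : R) : cabs (Complex x 0) = `|x|.
Proof. by rewrite /cabs/= expr0n/= addr0 sqrtr_sqr. Qed.

Lemma cabs_imag (x : R) : cabs (Complex 0 x) = `|x|.
Proof. by rewrite /cabs/= expr0n/= add0r sqrtr_sqr. Qed.

Lemma cReD z w : cRe (z + w) = cRe z + cRe w.
Proof. by case: z; case: w. Qed.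
Lemma cImD z w : cIm (z + w) = cIm z + cIm w.
Proof. by case: z; case: w. Qed.
Lemma cReN z : cRe (- z) = - cRe z.
Proof. by case: z. Qed.
Lemma cImN z : cIm (- z) = - cIm z.
Proof. by case: z. Qed.
Lemma cReB z w : cRe (z - w) = cRe z - cRe w.
Proof. by rewrite cReD cReN. Qed.
Lemma cImB z w : cIm (z - w) = cIm z - cIm w.
Proof. by rewrite cImD cImN. Qed.
Lemma cReM z w : cRe (z * w) =
  cRe z * cRe w - cIm z * cIm w.
Proof. by case: z; case: w. Qed.
Lemma cImM z w : cIm (z * w) =
  cRe z * cIm w + cIm z * cRe w.
Proof. by case: z; case: w. Qed.

Lemma complex_eta z : z = Complex (cRe z) (cIm z).
Proof. by case: z. Qed.

Lemma sqr_cabs z : cabs z ^+ 2 = cRe z ^+ 2 + cIm z ^+ 2.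
Proof. by rewrite sqr_sqrtr// addr_ge0 ?sqr_ge0. Qed.

Lemma Re_le_cabs z : `|cRe z| <= cabs z.
Proof.
rewrite -(ler_pXn2r (n := 2)) ?nnegrE ?cabs_ge0//.
by rewrite real_normK ?num_real// sqr_cabs lerDl sqr_ge0.
Qed.

Lemma Im_le_cabs z : `|cIm z| <= cabs z.
Proof.
rewrite -(ler_pXn2r (n := 2)) ?nnegrE ?cabs_ge0//.
by rewrite real_normK ?num_real// sqr_cabs lerDr sqr_ge0.
Qed.

Lemma cabs_le_ReIm z : cabs z <= `|cRe z| + `|cIm z|.
Proof.
have -> : z = Complex (cRe z) 0 + Complex 0 (cIm z).
  by case: z => a b; congr Complex; rewrite /= ?addr0 ?add0r.
apply: le_trans (cabsD _ _) _.
by rewrite cabs_real cabs_imag !cReD !cImD/= !addr0 !add0r.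
Qed.

Lemma cabsB z w : cabs (z - w) = cabs (w - z).
Proof. by rewrite -cabsN opprB. Qed.

Lemma cabs_triB z w : cabs z - cabs w <= cabs (z - w).
Proof. by rewrite lerBlDr; apply: le_trans (cabsD _ _); rewrite subrK. Qed.

End ComplexModulus.

Section Seminorm.
Context {R : realType} {V : lmodType R[i]}.
Local Notation C := R[i].

Definition seminorm (p : V -> R) : Prop :=
  (forall x y, p (x + y) <= p x + p y) /\
  (forall (a : C) x, p (a *: x) = cabs a * p x).

Context (p : V -> R) (hp : seminorm p).

Lemma snD x y : p (x + y) <= p x + p y. Proof. by case: hp. Qed.
Lemma snZ (a : C) x : p (a *: x) = cabs a * p x. Proof. by case: hp. Qed.
Lemma sn0 : p 0 = 0.
Proof. by rewrite -(scale0r (0 : V)) snZ cabs0 mul0r. Qed.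
Lemma snN x : p (- x) = p x.
Proof. by rewrite -scaleN1r snZ cabsN cabs1 mul1r. Qed.
Lemma snBC x y : p (x - y) = p (y - x).
Proof. by rewrite -snN opprB. Qed.
Lemma sn_ge0 x : 0 <= p x.
Proof.
have := snD x (- x); rewrite subrr sn0 snN -mulr2n.
by rewrite pmulrn_lge0.
Qed.
Lemma snB x y : p (x - y) <= p x + p y.
Proof. by rewrite -(snN y) snD. Qed.
Lemma sn_tri z x y : p (x - y) <= p (x - z) + p (z - y).
Proof. by apply: le_trans (snD _ _); rewrite addrA subrK. Qed.
Lemma sn_triB x y : p x - p y <= p (x - y).
Proof. by rewrite lerBlDr; apply: le_trans (snD _ _); rewrite subrK. Qed.

End Seminorm.

Section Calculus.
Context {R : realType} {V : lmodType R[i]}.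
Local Notation C := R[i].

(** Relative to a seminorm and not to a topology, because one function is later measured in every
    [K(t, .)]; scalars are the case [p = cabs]. The multiplied form of the remainder admits
    [h = 0]. *)
Definition vdiff (p : V -> R) (f : C -> V) (z : C) : Prop :=
  exists f' : V, forall e : R, 0 < e -> exists d : R, 0 < d /\
    forall h : C, cabs h < d -> p (f (z + h) - f z - h *: f') <= e * cabs h.

Definition vcont (p : V -> R) (D : C -> Prop) (f : C -> V) (z : C) : Prop :=
  forall e : R, 0 < e -> exists d : R, 0 < d /\
    forall w : C, D w -> cabs (w - z) < d -> p (f w - f z) < e.

Context (p : V -> R) (hp : seminorm p).

Lemma vcontS (D D' : C -> Prop) f z :
  (forall w, D' w -> D w) -> vcont p D f z -> vcont p D' f z.
Proof.
move=> DD cf e /cf[d [d0 H]]; exists d; split => // w /DD; exact: H.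
Qed.

Lemma vcont_bound D f z : vcont p D f z -> exists d : R, 0 < d /\
  forall w, D w -> cabs (w - z) < d -> p (f w) <= p (f z) + 1.
Proof.
move=> /(_ 1 ltr01)[d [d0 H]]; exists d; split => // w Dw /(H w Dw) /ltW wz.
by rewrite -lerBlDl; apply: le_trans wz; exact: sn_triB.
Qed.

Lemma vdiff_cont D f z : vdiff p f z -> vcont p D f z.
Proof.
move=> [f' /(_ 1 ltr01)[d [d0 H]]] e e0.
have K0 : 0 < 1 + p f' by rewrite ltr_pwDl// sn_ge0.
exists (Num.min d (e / (1 + p f'))); split; first by rewrite lt_min d0 divr_gt0.
move=> w _; rewrite lt_min => /andP[wd].
rewrite ltr_pdivlMr// => we; apply: le_lt_trans we.
have := H _ wd; rewrite subrKC => Hw.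
have -> : f w - f z = (f w - f z - (w - z) *: f') + (w - z) *: f' by rewrite subrK.
rewrite mul1r in Hw; apply: le_trans (snD hp _ _) _.
by rewrite (snZ hp) mulrDr mulr1 lerD2r.
Qed.

Lemma vdiff_eq (f g : C -> V) z r : 0 < r ->
  (forall w, cabs (w - z) < r -> f w = g w) -> vdiff p f z -> vdiff p g z.
Proof.
move=> r0 fg [f' H]; exists f' => e /H[d [d0 Hd]].
exists (Num.min d r); split; first by rewrite lt_min d0.
move=> h; rewrite lt_min => /andP[hd hr]; rewrite -!fg ?Hd//.
  by rewrite subrr cabs0.
by rewrite addrAC subrr add0r.
Qed.

Lemma vdiffD f g z : vdiff p f z -> vdiff p g z -> vdiff p (fun w => f w + g w) z.
Proof.
move=> [f' F] [g' G]; exists (f' + g') => e e0.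
have e2 : 0 < e / 2 by rewrite divr_gt0.
have [d1 [d10 F1]] := F _ e2; have [d2 [d20 G1]] := G _ e2.
exists (Num.min d1 d2); split; first by rewrite lt_min d10.
move=> h; rewrite lt_min => /andP[/F1 F2 /G1 G2].
have -> : f (z + h) + g (z + h) - (f z + g z) - h *: (f' + g') =
  (f (z + h) - f z - h *: f') + (g (z + h) - g z - h *: g').
  by lincomb_goal (R[i]) V; ring.
by apply: le_trans (snD hp _ _) _; lra.
Qed.

Lemma vdiffB f g z : vdiff p f z -> vdiff p g z -> vdiff p (fun w => f w - g w) z.
Proof.
move=> df [g' G]; apply: vdiffD df _; exists (- g') => e /G[d [d0 Hd]].
exists d; split => // h /Hd; rewrite -(snN hp).
by congr (p _ <= _); lincomb_goal (R[i]) V; ring.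
Qed.

Lemma vdiff_cst (c : V) z : vdiff p (fun=> c) z.
Proof.
exists 0 => e e0; exists 1; split => // h _.
by rewrite subrr scaler0 subrr (sn0 hp) mulr_ge0 ?cabs_ge0// ltW.
Qed.

End Calculus.

Lemma seminorm_cabs (R : realType) : @seminorm R (R[i]^o) cabs.
Proof. by split; [exact: cabsD | move=> a x; exact: cabsM]. Qed.

Notation cdiff f z := (vdiff (V := _^o) cabs f z).
Notation ccont D f z := (vcont (V := _^o) cabs D f z).

Section ScalarCalculus.
Context {R : realType} {V : lmodType R[i]}.
Local Notation C := R[i].
Context (p : V -> R) (hp : seminorm p).
Local Notation hc := (seminorm_cabs R).

Lemma vdiffZ (a : C -> C) f z : cdiff a z -> vdiff p f z ->
  vdiff p (fun w => a w *: f w) z.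
Proof.
move=> da df; have ca := vdiff_cont hc (fun=> True) da.
move: (da) (df) => [a' A] [f' F].
exists (a' *: f z + a z *: f') => e e0.
(* The remainder splits into three products, each given a third of [e]; the [+ 1] keeps the divisors
   positive and, in [K1], covers the variation of [a] near [z]. *)
set K1 := cabs (a z) + 1; have K10 : 0 < K1 by rewrite ltr_wpDl ?cabs_ge0.
set K2 := p (f z) + 1; have K20 : 0 < K2 by rewrite ltr_wpDl ?sn_ge0.
set K3 := p f' + 1; have K30 : 0 < K3 by rewrite ltr_wpDl ?sn_ge0.
have e1 : 0 < e / 3 / K1 by rewrite !divr_gt0.
have e2 : 0 < e / 3 / K2 by rewrite !divr_gt0.
have e3 : 0 < e / 3 / K3 by rewrite !divr_gt0.
have [d1 [d10 H1]] := F _ e1; have [d2 [d20 H2]] := A _ e2.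
have [d3 [d30 H3]] := ca _ e3; have [d4 [d40 H4]] := vcont_bound hc ca.
exists (Num.min (Num.min d1 d2) (Num.min d3 d4)); split; first by rewrite !lt_min d10 d20 d30.
move=> h; rewrite !lt_min => /andP[/andP[/H1 {}H1 /H2 {}H2] /andP[h3 h4]].
have zhz : z + h - z = h by rewrite addrAC subrr add0r.
have {}H3 := ltW (H3 (z + h) I (eq_ind_r (fun y => cabs y < d3) h3 zhz)).
have {}H4 := H4 (z + h) I (eq_ind_r (fun y => cabs y < d4) h4 zhz).
have -> : a (z + h) *: f (z + h) - a z *: f z - h *: (a' *: f z + a z *: f') =
  a (z + h) *: (f (z + h) - f z - h *: f') + (a (z + h) - a z - h * a') *: f z
  + (a (z + h) - a z) *: (h *: f').
  by lincomb_goal (R[i]) V; ring.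
apply: le_trans (snD hp _ _) _; apply: le_trans (lerD (snD hp _ _) (lexx _)) _.
rewrite !(snZ hp).
have h0 := cabs_ge0 h.
have -> : e * cabs h = K1 * (e / 3 / K1 * cabs h) + e / 3 / K2 * cabs h * K2
  + e / 3 / K3 * (cabs h * K3).
  by field; rewrite !gt_eqF.
apply: lerD; [apply: lerD|].
- by apply: ler_pM => //; rewrite ?cabs_ge0 ?(sn_ge0 hp).
- by apply: ler_pM => //; rewrite ?cabs_ge0 ?(sn_ge0 hp) ?lerDl.
- apply: ler_pM => //; rewrite ?cabs_ge0 ?mulr_ge0 ?(sn_ge0 hp)//.
  by rewrite ler_wpM2l// lerDl.
Qed.

Lemma vcontZ (D : C -> Prop) (a : C -> C) f z : ccont D a z -> vcont p D f z ->
  vcont p D (fun w => a w *: f w) z.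
Proof.
move=> ca cf e e0.
set K1 := cabs (a z) + 1; have K10 : 0 < K1 by rewrite ltr_wpDl ?cabs_ge0.
set K2 := p (f z) + 1; have K20 : 0 < K2 by rewrite ltr_wpDl ?sn_ge0.
have e1 : 0 < e / 2 / K1 by rewrite !divr_gt0.
have e2 : 0 < e / 2 / K2 by rewrite !divr_gt0.
have [d1 [d10 H1]] := cf _ e1; have [d2 [d20 H2]] := ca _ e2.
have [d4 [d40 H4]] := vcont_bound hc ca.
exists (Num.min (Num.min d1 d2) d4); split; first by rewrite !lt_min d10 d20.
move=> w Dw; rewrite !lt_min => /andP[/andP[/(H1 _ Dw) {}H1 /(H2 _ Dw) {}H2] /(H4 _ Dw) {}H4].
have -> : a w *: f w - a z *: f z = a w *: (f w - f z) + (a w - a z) *: f z.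
  by rewrite scalerBr scalerBl addrA subrK.
apply: le_lt_trans (snD hp _ _) _; rewrite !(snZ hp).
have -> : e = K1 * (e / 2 / K1) + e / 2 / K2 * K2.
  by field; rewrite !gt_eqF.
apply: ler_ltD.
- by apply: ler_pM => //; rewrite ?cabs_ge0 ?(sn_ge0 hp)// ltW.
- apply: le_lt_trans (_ : cabs (a w - a z) * K2 < _).
    by rewrite ler_wpM2l ?cabs_ge0// lerDl.
  by rewrite ltr_pM2r.
Qed.

Lemma vcontD (D : C -> Prop) f g z : vcont p D f z -> vcont p D g z ->
  vcont p D (fun w => f w + g w) z.
Proof.
move=> F G e e0; have e2 : 0 < e / 2 by rewrite divr_gt0.
have [d1 [d10 F1]] := F _ e2; have [d2 [d20 G1]] := G _ e2.
exists (Num.min d1 d2); split; first by rewrite lt_min d10.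
move=> w Dw; rewrite lt_min => /andP[/(F1 _ Dw) F2 /(G1 _ Dw) G2].
rewrite opprD addrACA; apply: le_lt_trans (snD hp _ _) _; lra.
Qed.

Lemma vcont_cst (D : C -> Prop) (c : V) z : vcont p D (fun=> c) z.
Proof. by move=> e e0; exists 1; split => // w _ _; rewrite subrr (sn0 hp). Qed.

Lemma cdiff_id (z : C) : cdiff (fun w : C => w) z.
Proof.
exists 1 => e e0; exists 1; split => // h _.
have -> : z + h - z - h *: (1 : C^o) = 0 by rewrite /GRing.scale/=; ring.
rewrite cabs0.
by rewrite mulr_ge0 ?cabs_ge0 ?ltW.
Qed.

Lemma cdiff_cst (c z : C) : cdiff (fun=> c) z.
Proof. exact: (vdiff_cst hc). Qed.

Lemma cdiff_inv (a z : C) : z != a -> cdiff (fun w : C => (w - a)^-1) z.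
Proof.
move=> za; exists (- ((z - a) ^- 2)) => e e0.
have k0 : 0 < cabs (z - a) by rewrite cabs_gt0 subr_eq0.
set k := cabs (z - a) in k0 *.
(* The remainder is [h^2 / ((z + h - a) (z - a)^2)]; [|h| < k / 2] gives [|z + h - a| >= k / 2],
   hence the bound [2 |h|^2 / k^3]. *)
exists (Num.min (k / 2) (e * k ^+ 3 / 2)); split.
  by rewrite lt_min !divr_gt0// mulr_gt0 ?exprn_gt0.
move=> h; rewrite lt_min => /andP[hk he].
have n1 : z - a != 0 by rewrite subr_eq0.
have kh : k / 2 <= cabs (z + h - a).
  have := cabs_triB (z - a) (- h); rewrite opprK cabsN addrAC -/k; lra.
have n2 : z + h - a != 0.
  by rewrite -cabs_gt0; apply: lt_le_trans kh; rewrite divr_gt0.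
have -> : (z + h - a)^-1 - (z - a)^-1 - h *: (- (z - a) ^- 2 : C^o) =
  h * h * ((z + h - a)^-1 * (z - a) ^- 2).
  by rewrite /GRing.scale/=; field; rewrite n1 n2.
rewrite !cabsM !cabsV !cabsX -/k.
have inv : (cabs (z + h - a))^-1 <= 2 / k.
  by rewrite -[leRHS]invrK invf_div lef_pV2 ?posrE ?divr_gt0 ?cabs_gt0.
have -> : e * cabs h = cabs h * (e * k ^+ 3 / 2) * (2 / k * k ^- 2).
  by field; rewrite gt_eqF.
apply: ler_pM.
- by rewrite mulr_ge0 ?cabs_ge0.
- by rewrite mulr_ge0 ?invr_ge0 ?exprn_ge0 ?cabs_ge0 ?ltW.
- by rewrite ler_wpM2l ?cabs_ge0 ?ltW.
- by rewrite ler_wpM2r // invr_ge0 exprn_ge0 ?ltW.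
Qed.

End ScalarCalculus.

(** * Green's identity and the maximum principle *)

Section RealPreliminaries.
Context {R : realType}.

Lemma eq_ler (x y : R) : x = y -> x <= y.
Proof. by move->. Qed.

Lemma lt_half_pow (x e : R) : 0 < e -> exists n, x / 2 ^+ n < e.
Proof.
move=> e0; have [n nx] : exists n : nat, x / e < n%:R.
  by exists (Num.truncn (x / e)).+1; exact: truncnS_gt.
exists n; rewrite ltr_pdivrMr ?exprn_gt0// -ltr_pdivrMl// mulrC.
apply: lt_le_trans nx _; rewrite -natrX ler_nat ltnW//; exact: ltn_expl.
Qed.

(** Bisection: if [P] fails on a rectangle, it fails on one of its quarters, and the failing
    rectangles shrink to a point around which [P] holds. Used for Green's identity and for uniform
    continuity. *)
Lemma cousin_rect (P : R -> R -> R -> R -> Prop) (a b c d : R) :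
  a <= b -> c <= d ->
  (forall a b c d, let m := (a + b) / 2 in let n := (c + d) / 2 in
    P a m c n -> P m b c n -> P a m n d -> P m b n d -> P a b c d) ->
  (forall x y, a <= x <= b -> c <= y <= d -> exists2 e, 0 < e &
    forall a' b' c' d', a <= a' -> a' <= x <= b' -> b' <= b ->
      c <= c' -> c' <= y <= d' -> d' <= d -> b' - a' < e -> d' - c' < e ->
      P a' b' c' d') ->
  P a b c d.
Proof.
move=> ab cd split4 loc; apply: contrapT => nP.
pose rect := ((R * R) * (R * R))%type.
pose Pr (r : rect) := P r.1.1 r.1.2 r.2.1 r.2.2.
pose half (i j : R * R) := j = (i.1, (i.1 + i.2) / 2) \/ j = ((i.1 + i.2) / 2, i.2).
have [nx nxP] : {nx : rect -> rect & forall r, ~ Pr r ->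
    [/\ ~ Pr (nx r), half r.1 (nx r).1 & half r.2 (nx r).2]}.
  apply: (@choice _ _ (fun r r' => ~ Pr r ->
    [/\ ~ Pr r', half r.1 r'.1 & half r.2 r'.2])) => -[[a1 b1] [c1 d1]].
  have [pr|npr] := pselect (Pr (a1, b1, (c1, d1))); first by exists (a1, b1, (c1, d1)).
  set m := (a1 + b1) / 2; set n := (c1 + d1) / 2.
  have [p1|] := pselect (Pr (a1, m, (c1, n))); last first.
    by exists (a1, m, (c1, n)) => _; split => //; left.
  have [p2|] := pselect (Pr (m, b1, (c1, n))); last first.
    by exists (m, b1, (c1, n)) => _; split => //; [right|left].
  have [p3|] := pselect (Pr (a1, m, (n, d1))); last first.
    by exists (a1, m, (n, d1)) => _; split => //; [left|right].
  have [p4|] := pselect (Pr (m, b1, (n, d1))); last first.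
    by exists (m, b1, (n, d1)) => _; split => //; right.
  by exfalso; apply: npr; exact: split4 p1 p2 p3 p4.
pose r n := iter n nx (a, b, (c, d)).
have nPr n : ~ Pr (r n) by elim: n => [//|n /nxP[]].
have h1 n : half (r n).1 (r n.+1).1 by have [_] := nxP _ (nPr n).
have h2 n : half (r n).2 (r n.+1).2 by have [_ _] := nxP _ (nPr n).
have nested (i : nat -> R * R) : (forall n, half (i n) (i n.+1)) ->
    (i 0%N).1 <= (i 0%N).2 ->
    exists x, forall n, [/\ (i 0%N).1 <= (i n).1, (i n).1 <= x <= (i n).2, (i n).2 <= (i 0%N).2
      & (i n).2 - (i n).1 = ((i 0%N).2 - (i 0%N).1) / 2 ^+ n].
  move=> hi i0.
  have len n : (i n).2 - (i n).1 = ((i 0%N).2 - (i 0%N).1) / 2 ^+ n.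
    elim: n => [|n IH]; first by rewrite expr0 divr1.
    rewrite exprSr invfM mulrA -IH.
    by case: (hi n) => ->/=; field.
  have le12 n : (i n).1 <= (i n).2.
    by rewrite -subr_ge0 len divr_ge0 ?exprn_ge0 ?subr_ge0.
  have incr n k : (i n).1 <= (i (n + k)%N).1 /\ (i (n + k)%N).2 <= (i n).2.
    elim: k => [|k [IH1 IH2]]; first by rewrite addn0.
    rewrite addnS; have := le12 (n + k)%N.
    by case: (hi (n + k)%N) => -> /= le; split; lra.
  have cross n k : (i n).1 <= (i k).2.
    have [nk|/ltnW kn] := leqP n k.
      have [H _] := incr n (k - n)%N; rewrite subnKC// in H.
      exact: le_trans H (le12 _).
    have [_ H] := incr k (n - k)%N; rewrite subnKC// in H.
    exact: le_trans (le12 _) H.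
  pose A := [set (i n).1 | n in setT]%classic.
  have supA : has_sup A.
    split; first by exists (i 0%N).1, 0%N.
    by exists (i 0%N).2 => _ [n _ <-].
  (* Every left endpoint is below every right endpoint ([cross]), so the supremum of the left ones
     lies in all the intervals. *)
  exists (sup A) => n; split.
  - by have [] := incr 0%N n; rewrite add0n.
  - apply/andP; split; first by apply: sup_upper_bound => //; exists n.
    by apply: ge_sup => [|_ [k _ <-]//]; exact: supA.1.
  - by have [] := incr 0%N n; rewrite add0n.
  - exact: len.
have [x Hx] := nested (fun n => (r n).1) h1 ab.
have [y Hy] := nested (fun n => (r n).2) h2 cd.
have [_ x0 _ _] := Hx 0%N; have [_ y0 _ _] := Hy 0%N.
have [e e0 He] := loc x y x0 y0.
have [n1 N1] := lt_half_pow (b - a) e0; have [n2 N2] := lt_half_pow (d - c) e0.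
pose n := maxn n1 n2.
have small (z : R) m : 0 <= z -> (m <= n)%N -> z / 2 ^+ n <= z / 2 ^+ m.
  move=> z0 mn; apply: ler_wpM2l => //; rewrite lef_pV2 ?posrE ?exprn_gt0//.
  by rewrite ler_eXn2l// (_ : 1 < 2 :> R)// ltr1n.
have [X1 X2 X3 X4] := Hx n; have [Y1 Y2 Y3 Y4] := Hy n.
apply: (nPr n); apply: He => //.
- rewrite X4; apply: le_lt_trans N1; apply: small; first by rewrite subr_ge0.
  exact: leq_maxl.
- rewrite Y4; apply: le_lt_trans N2; apply: small; first by rewrite subr_ge0.
  exact: leq_maxr.
Qed.

Lemma primitive_exists (f : R -> R) (a b : R) : continuous f ->
  exists F : R -> R, forall x : R, a <= x <= b -> is_derive x 1 F (f x).
Proof.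
move=> cf.
(* Starting at [a - 1] makes [a] an interior point, with a two-sided derivative. *)
exists (fun x => (\int[lebesgue_measure]_(t in `[a - 1, x]) (f t))%R) => x /andP[ax xb].
have [] := @continuous_FTC1_closed R f (a - 1) x (b + 1) _ _ _ (cf x).
- by rewrite (le_lt_trans xb)// ltrDl.
- apply: continuous_compact_integrable; first exact: segment_compact.
  exact: continuous_subspaceT.
- by rewrite (lt_le_trans _ ax)// ltrBlDr ltrDl.
by move=> H1 H2; apply: DeriveDef; [exact: H1|rewrite -derive1E; exact: H2].
Qed.

Lemma primitive_ge (F f : R -> R) (a b m : R) : a <= b ->
  (forall x : R, a <= x <= b -> is_derive x 1 F (f x)) ->
  (forall x, a <= x <= b -> m <= f x) -> m * (b - a) <= F b - F a.
Proof.
move=> ab dF fm.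
have [] := @MVT_segment R F f a b ab.
- by move=> x; rewrite in_itv/= => /andP[/ltW ax /ltW xb]; apply: dF; rewrite ax.
- apply: derivable_within_continuous => x; rewrite in_itv/= => xab.
  by have [] := dF _ xab.
move=> c; rewrite in_itv/= => cab ->.
by rewrite ler_wpM2r ?subr_ge0// fm.
Qed.

(** The mean value inequality is applied to [F - L] and [L - F], where [L] is the exact primitive of
    the affine function. It evaluates one side of a small rectangle. *)
Lemma primitive_near_affine (F f : R -> R) (a b al be e : R) : a <= b ->
  (forall x : R, a <= x <= b -> is_derive x 1 F (f x)) ->
  (forall x, a <= x <= b -> `|f x - (al + be * x)| <= e) ->
  `|F b - F a - (al * (b - a) + be * (b ^+ 2 - a ^+ 2) / 2)| <= e * (b - a).
Proof.
move=> ab dF fe.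
pose L x := al * x + be / 2 * x ^+ 2.
have dL (x : R) : is_derive x 1 L (al + be * x).
  rewrite /L; apply: is_derive_eq.
  by rewrite /GRing.scale/=; field.
have := @primitive_ge (fun x => F x - L x) (fun x => f x - (al + be * x)) a b (- e) ab.
have := @primitive_ge (fun x => L x - F x) (fun x => (al + be * x) - f x) a b (- e) ab.
move=> H1 H2.
have {}H1 : - e * (b - a) <= L b - F b - (L a - F a).
  apply: H1 => x xab; first by have := dF _ xab; have := dL x; exact: is_deriveB.
  by have := fe _ xab; rewrite ler_norml => /andP[? ?]; lra.
have {}H2 : - e * (b - a) <= F b - L b - (F a - L a).
  apply: H2 => x xab; first by have := dF _ xab; have := dL x => ? ?; exact: is_deriveB.
  by have := fe _ xab; rewrite ler_norml => /andP[? ?]; lra.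
move: H1 H2; rewrite /L ler_norml => H1 H2; apply/andP; split; lra.
Qed.

(* Green's identity for a closed form [P dx + Q dy] that is only assumed to be
   differentiable at every point: the circulation of the primitives around the
   rectangle is additive under bisection and second-order small at each point. *)
Lemma goursat_rect (P Q FP FQ : R -> R -> R) (a b c d : R) : a <= b -> c <= d ->
  (forall x y : R, a <= x <= b -> c <= y <= d -> is_derive x 1 (FP y) (P x y)) ->
  (forall x y : R, a <= x <= b -> c <= y <= d -> is_derive y 1 (FQ x) (Q x y)) ->
  (forall x y, a <= x <= b -> c <= y <= d -> exists p q r : R,
    forall e, 0 < e -> exists2 dl, 0 < dl &
    forall x' y', a <= x' <= b -> c <= y' <= d -> `|x' - x| < dl -> `|y' - y| < dl ->
    `|P x' y' - P x y - p * (x' - x) - q * (y' - y)| <= e * (`|x' - x| + `|y' - y|) /\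
    `|Q x' y' - Q x y - q * (x' - x) - r * (y' - y)| <= e * (`|x' - x| + `|y' - y|)) ->
  (FP c b - FP c a) + (FQ b d - FQ b c) - (FP d b - FP d a) - (FQ a d - FQ a c) = 0.
Proof.
move=> ab cd dFP dFQ diff.
pose Phi a b c d :=
  (FP c b - FP c a) + (FQ b d - FQ b c) - (FP d b - FP d a) - (FQ a d - FQ a c).
rewrite -/(Phi a b c d).
(* Quadratic in the half-perimeter: each of the four quarters has half of it, so their bounds add up
   to the same expression. *)
suff main e : 0 < e -> `|Phi a b c d| <= 2 * e * ((b - a) + (d - c)) ^+ 2.
  apply/eqP; rewrite -normr_le0; apply/ler_addgt0Pl => e e0; rewrite addr0.
  set s := (b - a) + (d - c) in main.
  have k0 : 0 < 2 * (s ^+ 2 + 1) by rewrite mulr_gt0// ltr_wpDl ?sqr_ge0.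
  apply: le_trans (main (e / (2 * (s ^+ 2 + 1))) _) _; first by rewrite divr_gt0.
  rewrite (_ : 2 * _ * _ = e * (2 * s ^+ 2) / (2 * (s ^+ 2 + 1))); last by ring.
  rewrite ler_pdivrMr//; apply: ler_wpM2l; first exact: ltW.
  by apply: ler_wpM2l => //; rewrite lerDl.
move=> e0.
pose inQ a' b' c' d' := [/\ a <= a', b' <= b, c <= c' & d' <= d].
(* Inclusion in the given rectangle is carried inside the property, because the bisection hypothesis
   of [cousin_rect] ranges over all rectangles. *)
suff : a <= a -> b <= b -> c <= c -> d <= d -> a <= b -> c <= d ->
    `|Phi a b c d| <= 2 * e * ((b - a) + (d - c)) ^+ 2 by apply.
apply: (@cousin_rect (fun a' b' c' d' => a <= a' -> b' <= b -> c <= c' -> d' <= d ->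
  a' <= b' -> c' <= d' ->
  `|Phi a' b' c' d'| <= 2 * e * ((b' - a') + (d' - c')) ^+ 2)) => //.
  move=> a1 b1 c1 d1 m n H1 H2 H3 H4 aa bb cc dd ab1 cd1.
  have am : a1 <= m by rewrite /m; lra.
  have mb : m <= b1 by rewrite /m; lra.
  have cn : c1 <= n by rewrite /n; lra.
  have nd : n <= d1 by rewrite /n; lra.
  have {}H1 := H1 aa (le_trans mb bb) cc (le_trans nd dd) am cn.
  have {}H2 := H2 (le_trans aa am) bb cc (le_trans nd dd) mb cn.
  have {}H3 := H3 aa (le_trans mb bb) (le_trans cc cn) dd am nd.
  have {}H4 := H4 (le_trans aa am) bb (le_trans cc cn) dd mb nd.
  have -> : Phi a1 b1 c1 d1 = Phi a1 m c1 n + Phi m b1 c1 n + Phi a1 m n d1 + Phi m b1 n d1.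
    by rewrite /Phi; ring.
  apply: le_trans (ler_normD _ _) _; apply: le_trans (lerD (ler_normD _ _) (lexx _)) _.
  apply: le_trans (lerD (lerD (ler_normD _ _) (lexx _)) (lexx _)) _.
  apply: le_trans (lerD (lerD (lerD H1 H2) H3) H4) _.
  by apply: eq_ler; rewrite /m /n; field.
move=> x y xab ycd; have [p [q [r /(_ e e0)[dl dl0 H]]]] := diff x y xab ycd.
exists dl => // a1 b1 c1 d1 aa /andP[ax xb] bb cc /andP[cy yd] dd wid hei _ _ _ _ ab1 cd1.
set s := (b1 - a1) + (d1 - c1).
have loc x' y' : a1 <= x' <= b1 -> c1 <= y' <= d1 ->
  `|P x' y' - P x y - p * (x' - x) - q * (y' - y)| <= e * s /\
  `|Q x' y' - Q x y - q * (x' - x) - r * (y' - y)| <= e * s.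
  move=> /andP[ax' xb'] /andP[cy' yd'].
  have nx : `|x' - x| <= b1 - a1 by rewrite ler_norml; apply/andP; split; lra.
  have ny : `|y' - y| <= d1 - c1 by rewrite ler_norml; apply/andP; split; lra.
  have [||||H1 H2] := H x' y'; rewrite ?(le_lt_trans nx) ?(le_lt_trans ny)//.
  - by rewrite (le_trans aa ax') (le_trans xb' bb).
  - by rewrite (le_trans cc cy') (le_trans yd' dd).
  have es : e * (`|x' - x| + `|y' - y|) <= e * s by rewrite ler_wpM2l ?(ltW e0)// lerD.
  by split; [exact: le_trans H1 es|exact: le_trans H2 es].
have hor y' : c1 <= y' <= d1 ->
  `|FP y' b1 - FP y' a1 - ((P x y - p * x + q * (y' - y)) * (b1 - a1)
     + p * (b1 ^+ 2 - a1 ^+ 2) / 2)| <= e * s * (b1 - a1).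
  move=> y'cd; have /andP[cy' yd'] := y'cd.
  apply: (@primitive_near_affine _ (P^~ y')) => // x' /andP[ax' xb'].
    by apply: dFP; [rewrite (le_trans aa ax') (le_trans xb' bb)|
                    rewrite (le_trans cc cy') (le_trans yd' dd)].
  have [] := loc x' y' _ y'cd; first by rewrite ax'.
  by move=> le1 _; apply: le_trans le1; apply: eq_ler; congr `| _ |; ring.
have ver x' : a1 <= x' <= b1 ->
  `|FQ x' d1 - FQ x' c1 - ((Q x y - r * y + q * (x' - x)) * (d1 - c1)
     + r * (d1 ^+ 2 - c1 ^+ 2) / 2)| <= e * s * (d1 - c1).
  move=> x'ab; have /andP[ax' xb'] := x'ab.
  apply: (@primitive_near_affine _ (Q x')) => // y' /andP[cy' yd'].
    by apply: dFQ; [rewrite (le_trans aa ax') (le_trans xb' bb)|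
                    rewrite (le_trans cc cy') (le_trans yd' dd)].
  have [] := loc x' y' x'ab; first by rewrite cy'.
  by move=> _ le1; apply: le_trans le1; apply: eq_ler; congr `| _ |; ring.
(* The affine parts cancel around the rectangle since [q] is both the [y]-slope of [P] and the
   [x]-slope of [Q]; only the four errors remain. *)
have := hor c1; have := hor d1; have := ver a1; have := ver b1.
rewrite !lexx ab1 cd1 => /(_ isT) V1 /(_ isT) V2 /(_ isT) V3 /(_ isT) V4.
rewrite /Phi (_ : 2 * e * s ^+ 2 = e * s * (b1 - a1) + e * s * (d1 - c1)
  + e * s * (b1 - a1) + e * s * (d1 - c1)); last by rewrite /s; ring.
move: V1 V2 V3 V4; set E1 := e * s * (b1 - a1); set E2 := e * s * (d1 - c1).
rewrite !ler_norml => /andP[? ?] /andP[? ?] /andP[? ?] /andP[? ?].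
by apply/andP; split; lra.
Qed.

End RealPreliminaries.

(** * Cauchy's theorem and the scalar maximum principle on closed rectangles *)

Section ScalarMaximumPrinciple.
Context {R : realType}.
Local Notation C := R[i].
Local Notation hc := (seminorm_cabs R).

Definition inrect (a b c d : R) (z : C) : Prop :=
  a <= cRe z <= b /\ c <= cIm z <= d.

Definition intrect (a b c d : R) (z : C) : Prop :=
  a < cRe z < b /\ c < cIm z < d.

Definition bdrect (a b c d : R) (z : C) : Prop :=
  inrect a b c d z /\ (cRe z = a \/ cRe z = b \/
                       cIm z = c \/ cIm z = d).

Lemma intrect_sub a b c d z : intrect a b c d z -> inrect a b c d z.
Proof.
by move=> [/andP[/ltW ? /ltW ?] /andP[/ltW ? /ltW ?]]; split; apply/andP.
Qed.

Lemma cdiffM (f g : C -> C) z : cdiff f z -> cdiff g z ->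
  cdiff (fun w => f w * g w) z.
Proof. by move=> df dg; exact: (vdiffZ hc). Qed.

Lemma ccontM D (f g : C -> C) z : ccont D f z -> ccont D g z ->
  ccont D (fun w => f w * g w) z.
Proof. by move=> df dg; exact: (vcontZ hc). Qed.

Lemma cdiffX (f : C -> C) n z : cdiff f z -> cdiff (fun w => f w ^+ n) z.
Proof.
move=> df; elim: n => [|n IH]; first exact: cdiff_cst.
apply: (vdiff_eq (r := 1) (f := fun w => f w * f w ^+ n)) => //.
  by move=> w _; rewrite exprS.
exact: cdiffM.
Qed.

Lemma ccontX D (f : C -> C) n z : ccont D f z -> ccont D (fun w => f w ^+ n) z.
Proof.
move=> df; elim: n => [|n IH]; first exact: (vcont_cst hc).
have := ccontM df IH; rewrite /vcont => H e /H[dl [dl0 Hd]].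
by exists dl; split => // w Dw /(Hd w Dw); rewrite !exprS.
Qed.

Lemma cdiffB_cst (f : C -> C) v z : cdiff f z -> cdiff (fun w => f w - v) z.
Proof. by move=> df; exact: (vdiffB hc df (cdiff_cst v z)). Qed.

Lemma cReV (z : C) : cRe (z^-1) =
  cRe z / (cRe z ^+ 2 + cIm z ^+ 2).
Proof. by case: z. Qed.

Lemma cImV (z : C) : cIm (z^-1) =
  - cIm z / (cRe z ^+ 2 + cIm z ^+ 2).
Proof. by case: z => a b; rewrite mulNr. Qed.

(** The retraction onto [[a, b]]; composing with it extends a function continuous on the segment to
    the whole line, where [primitive_exists] applies. *)
Let clamp (a b x : R) := if x < a then a else if b < x then b else x.

Let clamp_in a b x : a <= b -> a <= clamp a b x <= b.
Proof.
move=> ab; rewrite /clamp; case: (ltP x a) => xa; first by rewrite lexx.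
by case: (ltP b x) => bx; rewrite ?ab ?lexx// xa.
Qed.

Let clamp_id a b x : a <= x <= b -> clamp a b x = x.
Proof. by move=> /andP[ax xb]; rewrite /clamp !ltNge ax xb. Qed.

Let clamp_lip a b x y : a <= b -> `|clamp a b x - clamp a b y| <= `|x - y|.
Proof.
move=> ab; rewrite /clamp ler_norml.
have n1 := ler_norm (x - y); have n2 := ler_norm (y - x); rewrite distrC in n2.
case: (ltP x a) => h1; case: (ltP y a) => h2; rewrite ?subrr.
all: try (case: (ltP b x) => h3); try (case: (ltP b y) => h4).
all: by apply/andP; split; lra.
Qed.

Lemma line_primitive (g : R -> R) (a b : R) : a <= b ->
  (forall x, a <= x <= b -> forall e, 0 < e -> exists2 dl, 0 < dl &
    forall y, a <= y <= b -> `|y - x| < dl -> `|g y - g x| < e) ->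
  exists F : R -> R, forall x : R, a <= x <= b -> is_derive x 1 F (g x).
Proof.
move=> ab cg.
have [|F HF] := @primitive_exists R (g \o clamp a b) a b.
  move=> x; apply/cvgrPdist_lt => e e0.
  have [dl dl0 H] := cg _ (clamp_in x ab) e e0.
  near=> y; rewrite distrC; apply: H; first exact: clamp_in.
  apply: le_lt_trans (clamp_lip _ _ ab) _; rewrite distrC.
  by near: y; apply: cvgr_dist_lt.
by exists F => x xab; have := HF x xab; rewrite /= clamp_id.
Unshelve. all: by end_near. Qed.

(** The circulation is the imaginary part of the contour integral of [k dz], the form
    [Im k dx + Re k dy]. This half of Cauchy's theorem suffices later, because the imaginary part of
    [dz / (z - w)] is positive along the boundary. *)
Lemma cauchy_rect (k : C -> C) a b c d : a <= b -> c <= d ->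
  (forall z, inrect a b c d z -> cdiff k z) ->
  exists FP FQ : R -> R -> R,
  [/\ (forall x y : R, a <= x <= b -> c <= y <= d ->
         is_derive x 1 (FP y) (cIm (k (Complex x y)))),
      (forall x y : R, a <= x <= b -> c <= y <= d ->
         is_derive y 1 (FQ x) (cRe (k (Complex x y)))) &
  (FP c b - FP c a) + (FQ b d - FQ b c) - (FP d b - FP d a) - (FQ a d - FQ a c) = 0].
Proof.
move=> ab cd dk.
have hor y : exists F : R -> R, c <= y <= d -> forall x : R, a <= x <= b ->
    is_derive x 1 F (cIm (k (Complex x y))).
  have [ycd|nin] := pselect (c <= y <= d); last by exists (fun=> 0) => /nin.
  have [|F HF] := @line_primitive (fun x => cIm (k (Complex x y))) a b ab.
    move=> x xab e e0; have dkx : cdiff k (Complex x y) by apply: dk.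
    have [dl [dl0 H]] := vdiff_cont hc (fun=> True) dkx e0.
    exists dl => // x' x'ab xx.
    rewrite -cImB; apply: le_lt_trans (Im_le_cabs _) _; apply: H => //.
    by rewrite (_ : _ - _ = Complex (x' - x) 0) ?cabs_real//; congr Complex; rewrite /= subrr.
  by exists F => _.
have ver x : exists F : R -> R, a <= x <= b -> forall y : R, c <= y <= d ->
    is_derive y 1 F (cRe (k (Complex x y))).
  have [xab|nin] := pselect (a <= x <= b); last by exists (fun=> 0) => /nin.
  have [|F HF] := @line_primitive (fun y => cRe (k (Complex x y))) c d cd.
    move=> y ycd e e0; have dkx : cdiff k (Complex x y) by apply: dk.
    have [dl [dl0 H]] := vdiff_cont hc (fun=> True) dkx e0.
    exists dl => // y' y'ab yy.
    rewrite -cReB; apply: le_lt_trans (Re_le_cabs _) _; apply: H => //.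
    by rewrite (_ : _ - _ = Complex 0 (y' - y)) ?cabs_imag//; congr Complex; rewrite /= subrr.
  by exists F => _.
have [FP HP] := choice hor; have [FQ HQ] := choice ver.
exists FP, FQ; split; [by move=> x y xab ycd; apply: HP| by move=> x y xab ycd; apply: HQ|].
apply: (@goursat_rect R (fun x y => cIm (k (Complex x y)))
                        (fun x y => cRe (k (Complex x y)))) => //.
- by move=> x y xab ycd; apply: HP.
- by move=> x y xab ycd; apply: HQ.
move=> x y xab ycd; have [k' Hk] := dk (Complex x y) (conj xab ycd).
(* The slopes of [Im (k' h)] and [Re (k' h)]; that they share [Re k'] is a Cauchy-Riemann
   equation. *)
exists (cIm k'), (cRe k'), (- cIm k') => e e0.
have [dl [dl0 H]] := Hk e e0; exists (dl / 2); first by rewrite divr_gt0.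
move=> x' y' _ _ xx yy; set h : C := Complex (x' - x) (y' - y).
have hle : cabs h <= `|x' - x| + `|y' - y| by exact: cabs_le_ReIm.
have /H : cabs h < dl by apply: le_lt_trans hle _; lra.
rewrite (_ : Complex x y + h = Complex x' y'); last first.
  by rewrite /h; congr Complex; rewrite /= subrKC.
set E := (X in cabs X) => HE.
have {}HE : cabs E <= e * (`|x' - x| + `|y' - y|).
  by apply: le_trans HE _; rewrite ler_wpM2l ?(ltW e0).
split.
- apply: le_trans HE; apply: le_trans (Im_le_cabs _); apply: eq_ler; congr `| _ |.
  by rewrite /E -[h *: _]/(h * k') !cImB cImM/=; ring.
- apply: le_trans HE; apply: le_trans (Re_le_cabs _); apply: eq_ler; congr `| _ |.
  by rewrite /E -[h *: _]/(h * k') !cReB cReM/=; ring.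
Qed.

(** The square allows a proof from first-order information: if [u (w + h) - u w = h u' + rho], the
    quotient at [w + h] is [h u'^2 + (2 u' + rho / h) rho], and at [w] it is [0 / 0 = 0]. For the
    first power, differentiability at [w] would already be a removable singularity theorem. *)
Lemma cdiff_square_quotient (u : C -> C) w : cdiff u w ->
  cdiff (fun z => (u z - u w) ^+ 2 / (z - w)) w.
Proof.
move=> [u' Hu]; exists (u' ^+ 2) => e e0.
have K0 : 0 < 2 * cabs u' + 1 by rewrite ltr_wpDl ?mulr_ge0 ?cabs_ge0.
pose e1 := Num.min 1 (e / (2 * cabs u' + 1)).
have e10 : 0 < e1 by rewrite lt_min ltr01 divr_gt0.
have [dl [dl0 H]] := Hu e1 e10; exists dl; split => // h /H.
have -> : w + h - w = h by ring.
rewrite subrr expr0n/= mul0r subr0.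
have [->|h0] := eqVneq h 0; first by move=> _; rewrite invr0 mulr0 scale0r subr0 !cabs0 mulr0.
set rho := (X in cabs X); set D := u (w + h) - u w.
have -> : D = h * u' + rho by rewrite /rho /D -[h *: _]/(h * u'); ring.
move=> Hr.
have -> : (h * u' + rho) ^+ 2 / h - h *: (u' ^+ 2 : C^o) = (2%:R * u' + rho / h) * rho.
  by rewrite -[h *: _]/(h * u' ^+ 2); field.
have Hq : cabs (rho / h) <= 1.
  rewrite cabsM cabsV ler_pdivrMr ?cabs_gt0//; apply: le_trans Hr _.
  by rewrite ler_wpM2r ?cabs_ge0// /e1 ge_min lexx.
rewrite cabsM; apply: le_trans (_ : (2 * cabs u' + 1) * (e1 * cabs h) <= _).
  apply: ler_pM => //; rewrite ?cabs_ge0//; apply: le_trans (cabsD _ _) _.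
  apply: lerD => //; rewrite cabsM (_ : 2%:R = Complex 2 0 :> C).
    by rewrite cabs_real ger0_norm.
  by rewrite -[RHS]/(2%:C)%C rmorph_nat.
rewrite mulrA ler_wpM2r ?cabs_ge0// mulrC -ler_pdivlMr//.
by rewrite /e1 ge_min lexx orbT.
Qed.

(* Cauchy's formula for [(u - u w) ^ 2 / (z - w)]; the constant is removed by
   applying the bound to the powers of [u]. *)
Lemma crude_max (u : C -> C) a b c d w A v : intrect a b c d w ->
  (forall z, inrect a b c d z -> cdiff u z) ->
  (forall z, bdrect a b c d z -> cabs (u z) <= A) -> 0 <= A ->
  u w = Complex v 0 -> 0 <= v ->
  forall r D, 0 < r -> r <= cRe w - a -> r <= b - cRe w ->
    r <= cIm w - c -> r <= d - cIm w ->
    (b - a) + (d - c) <= D ->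
  v <= 3 * (D / r) ^+ 2 * A.
Proof.
move=> iw du bd A0 uw v0 r D r0 ra rb rc rd hD.
set x0 := cRe w in ra rb; set y0 := cIm w in rc rd.
have D0 : 0 < D by apply: lt_le_trans hD; lra.
have ab : a <= b by lra. have cd : c <= d by lra.
pose k z := (u z - u w) ^+ 2 / (z - w).
have dk z : inrect a b c d z -> cdiff k z.
  move=> zQ; have [->|zw] := eqVneq z w.
    by apply: cdiff_square_quotient; apply: du; exact: intrect_sub.
  apply: cdiffM; last exact: cdiff_inv.
  by apply: cdiffX; apply: cdiffB_cst; exact: du.
(* A lower bound for the integrand on each side: [v^2 / (z - w)] contributes at least [v^2 r / D^2],
   and the rest of [k] is at most [(A^2 + 2 A v) / r]. Since the circulation vanishes, [m <= 0]. *)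
pose m := v ^+ 2 * (r / D ^+ 2) - (A ^+ 2 + 2 * A * v) / r.
have kb z : bdrect a b c d z -> r <= cabs (z - w) /\
    cabs (k z - Complex (v ^+ 2) 0 / (z - w)) <= (A ^+ 2 + 2 * A * v) / r.
  move=> zb; have uz := bd z zb.
  have rz : r <= cabs (z - w).
    case: zb => _ [zz|[zz|[zz|zz]]].
    - by apply: le_trans (Re_le_cabs _); rewrite cReB zz distrC; apply: le_trans (ler_norm _).
    - by apply: le_trans (Re_le_cabs _); rewrite cReB zz; apply: le_trans (ler_norm _).
    - by apply: le_trans (Im_le_cabs _); rewrite cImB zz distrC; apply: le_trans (ler_norm _).
    - by apply: le_trans (Im_le_cabs _); rewrite cImB zz; apply: le_trans (ler_norm _).
  split => //.
  have -> : k z - Complex (v ^+ 2) 0 / (z - w) = (u z ^+ 2 - 2%:R * u z * u w) / (z - w).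
    have -> : Complex (v ^+ 2) 0 = u w ^+ 2.
      by rewrite uw expr2; congr Complex; rewrite /= ?mulr0 ?mul0r ?subr0 ?addr0 -?expr2.
    by rewrite /k; ring.
  rewrite cabsM cabsV; apply: ler_pM; rewrite ?cabs_ge0 ?invr_ge0 ?cabs_ge0//; last first.
    by rewrite lef_pV2// posrE//; exact: lt_le_trans rz.
  apply: le_trans (cabsD _ _) _; rewrite cabsN; apply: lerD.
    by rewrite cabsX ler_pXn2r ?nnegrE ?cabs_ge0.
  rewrite !cabsM uw cabs_real (ger0_norm v0) ler_wpM2r// ler_pM ?cabs_ge0//.
  rewrite (_ : 2%:R = Complex 2 0 :> C) ?cabs_real ?ger0_norm//.
  by rewrite -[RHS]/(2%:C)%C rmorph_nat.
have den z : inrect a b c d z -> cRe (z - w) ^+ 2 + cIm (z - w) ^+ 2 <= D ^+ 2.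
  move=> [/andP[z1 z2] /andP[z3 z4]]; rewrite -sqr_cabs.
  rewrite ler_pXn2r ?nnegrE ?cabs_ge0 ?(ltW D0)//.
  apply: le_trans (cabs_le_ReIm _) _; rewrite cReB cImB -/x0 -/y0.
  have n1 : `|cRe z - x0| <= b - a by rewrite ler_norml; apply/andP; split; lra.
  have n2 : `|cIm z - y0| <= d - c by rewrite ler_norml; apply/andP; split; lra.
  exact: le_trans (lerD n1 n2) hD.
have frac (s den' : R) : r <= s -> r ^+ 2 <= den' -> den' <= D ^+ 2 -> r / D ^+ 2 <= s / den'.
  move=> rs d1 d2; have d0 : 0 < den' by apply: lt_le_trans d1; rewrite exprn_gt0.
  apply: ler_pM => //; rewrite ?(ltW r0) ?invr_ge0 ?exprn_ge0 ?(ltW D0)//.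
  by rewrite lef_pV2 ?posrE ?exprn_gt0.
have re_scale (t : R) (z : C) : cRe (Complex t 0 * z) = t * cRe z.
  by rewrite cReM/= mul0r subr0.
have im_scale (t : R) (z : C) : cIm (Complex t 0 * z) = t * cIm z.
  by rewrite cImM/= mul0r addr0.
have dn z : bdrect a b c d z ->
    r ^+ 2 <= cRe (z - w) ^+ 2 + cIm (z - w) ^+ 2 <= D ^+ 2.
  move=> zb; apply/andP; split; last by apply: den; case: zb.
  by rewrite -sqr_cabs ler_pXn2r ?nnegrE ?cabs_ge0 ?(ltW r0)//; have [] := kb z zb.
have [FP [FQ [HP HQ H0]]] := cauchy_rect ab cd dk.
have v2 : 0 <= v ^+ 2 by rewrite exprn_ge0.
have S1 : m * (b - a) <= FP c b - FP c a.
  apply: (primitive_ge ab (f := fun x => cIm (k (Complex x c)))).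
    by move=> x xab; apply: HP => //; rewrite lexx.
  move=> x xab; have zb : bdrect a b c d (Complex x c).
    by split; [split; rewrite //= lexx|right; right; left].
  have /andP[q1 q2] := dn _ zb; have [_] := kb _ zb.
  move/(le_trans (Im_le_cabs _)); rewrite cImB im_scale cImV ler_norml => /andP[q3 _].
  suff : v ^+ 2 * (r / D ^+ 2) <= v ^+ 2 * (- cIm (Complex x c - w) /
    (cRe (Complex x c - w) ^+ 2 + cIm (Complex x c - w) ^+ 2)).
    by rewrite /m => ?; lra.
  by apply: ler_wpM2l => //; apply: frac => //; rewrite cImB opprB.
have S2 : m * (b - a) <= - FP d b - - FP d a.
  apply: (primitive_ge (F := fun x => - FP d x) ab (f := fun x => - cIm (k (Complex x d)))).
    by move=> x xab; apply: is_deriveN; apply: HP => //; rewrite cd lexx.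
  move=> x xab; have zb : bdrect a b c d (Complex x d).
    by split; [split; rewrite //= cd lexx|right; right; right].
  have /andP[q1 q2] := dn _ zb; have [_] := kb _ zb.
  move/(le_trans (Im_le_cabs _)); rewrite cImB im_scale cImV ler_norml => /andP[_ q3].
  suff : v ^+ 2 * (r / D ^+ 2) <= v ^+ 2 * (cIm (Complex x d - w) /
    (cRe (Complex x d - w) ^+ 2 + cIm (Complex x d - w) ^+ 2)).
    by rewrite mulNr in q3; rewrite /m => ?; lra.
  by apply: ler_wpM2l => //; apply: frac => //; rewrite cImB.
have S3 : m * (d - c) <= FQ b d - FQ b c.
  apply: (primitive_ge cd (f := fun y => cRe (k (Complex b y)))).
    by move=> y ycd; apply: HQ => //; rewrite ab lexx.
  move=> y ycd; have zb : bdrect a b c d (Complex b y).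
    by split; [split; rewrite //= ab lexx|right; left].
  have /andP[q1 q2] := dn _ zb; have [_] := kb _ zb.
  move/(le_trans (Re_le_cabs _)); rewrite cReB re_scale cReV ler_norml => /andP[q3 _].
  suff : v ^+ 2 * (r / D ^+ 2) <= v ^+ 2 * (cRe (Complex b y - w) /
    (cRe (Complex b y - w) ^+ 2 + cIm (Complex b y - w) ^+ 2)).
    by rewrite /m => ?; lra.
  by apply: ler_wpM2l => //; apply: frac => //; rewrite cReB.
have S4 : m * (d - c) <= - FQ a d - - FQ a c.
  apply: (primitive_ge (F := fun y => - FQ a y) cd (f := fun y => - cRe (k (Complex a y)))).
    by move=> y ycd; apply: is_deriveN; apply: HQ => //; rewrite ab lexx.
  move=> y ycd; have zb : bdrect a b c d (Complex a y).
    by split; [split; rewrite //= ab lexx|left].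
  have /andP[q1 q2] := dn _ zb; have [_] := kb _ zb.
  move/(le_trans (Re_le_cabs _)); rewrite cReB re_scale cReV ler_norml => /andP[_ q3].
  suff : v ^+ 2 * (r / D ^+ 2) <= v ^+ 2 * (- cRe (Complex a y - w) /
    (cRe (Complex a y - w) ^+ 2 + cIm (Complex a y - w) ^+ 2)).
    by rewrite mulNr in q3 *; rewrite /m => ?; lra.
  by apply: ler_wpM2l => //; apply: frac => //; rewrite cReB opprB.
have m0 : m <= 0.
  have : m * (2 * ((b - a) + (d - c))) <= 0.
    by clear -S1 S2 S3 S4 H0; lra.
  by rewrite pmulr_lle0//; lra.
have key : v ^+ 2 * (r / D) ^+ 2 <= A ^+ 2 + 2 * A * v.
  have -> : v ^+ 2 * (r / D) ^+ 2 = r * (v ^+ 2 * (r / D ^+ 2)).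
    by field; rewrite gt_eqF.
  by rewrite -ler_pdivlMl// [leRHS]mulrC -subr_le0.
have rD : 1 <= D / r by rewrite ler_pdivlMr// mul1r; lra.
have rD2 : 1 <= (D / r) ^+ 2 by rewrite exprn_ege1.
have [vA|Av] := lerP v A.
  by apply: le_trans vA _; apply: ler_peMl => //; clear -rD2; lra.
have vp : 0 < v by exact: le_lt_trans A0 Av.
have key2 : v ^+ 2 * (r / D) ^+ 2 <= 3 * A * v.
  apply: le_trans key _; rewrite (_ : 3 * A * v = A * v + 2 * A * v); last by ring.
  by rewrite lerD2r expr2; apply: ler_wpM2l => //; exact: ltW.
rewrite -(ler_pM2r vp) (_ : 3 * (D / r) ^+ 2 * A * v = (3 * A * v) * (D / r) ^+ 2); last by ring.
rewrite -expr2 -ler_pdivrMr ?exprn_gt0 ?divr_gt0//; apply: le_trans key2.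
by apply: eq_ler; field; rewrite !gt_eqF.
Qed.

(** If [A < v], Bernoulli's inequality makes [(v / A)^n] exceed [b / a]. Thus an estimate that holds
    for all powers loses its multiplicative constant. *)
Lemma pow_trick (a b v A : R) : 0 < a -> 0 <= A -> 0 <= v ->
  (forall n : nat, a * v ^+ n <= b * A ^+ n) -> v <= A.
Proof.
move=> a0 A0 v0 H; rewrite leNgt; apply/negP => Av.
have vp : 0 < v by exact: le_lt_trans A0 Av.
have [Az|An] := eqVneq A 0.
  by have := H 1%N; rewrite !expr1 Az mulr0 leNgt mulr_gt0.
have Ap : 0 < A by rewrite lt_def An.
pose q := v / A - 1.
have q0 : 0 < q by rewrite subr_gt0 ltr_pdivlMr// mul1r.
have bern n : 1 + n%:R * q <= (v / A) ^+ n.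
  elim: n => [|n IH]; first by rewrite mul0r addr0 expr0.
  rewrite exprS; apply: le_trans (_ : (1 + q) * (1 + n%:R * q) <= _); last first.
    by rewrite {1}/q subrKC ler_wpM2l ?divr_ge0.
  rewrite (_ : (1 + q) * _ = 1 + n.+1%:R * q + q * (n%:R * q)).
    by rewrite lerDl !mulr_ge0 ?(ltW q0).
  by rewrite -natr1; ring.
have {}H n : 1 + n%:R * q <= b / a.
  apply: le_trans (bern n) _; rewrite expr_div_n ler_pdivrMr ?exprn_gt0//.
  by rewrite mulrAC ler_pdivlMr// mulrC.
have := H (Num.truncn (b / a / q)).+1.
have := truncnS_gt (b / a / q); rewrite ltr_pdivrMr// => h1 h2.
by have := lt_le_trans h1 (le_trans _ h2); rewrite lerDr ler01 ltxx => /(_ isT).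
Qed.

Lemma max_principle_closed (u : C -> C) a b c d w A : intrect a b c d w ->
  (forall z, inrect a b c d z -> cdiff u z) -> 0 <= A ->
  (forall z, bdrect a b c d z -> cabs (u z) <= A) -> cabs (u w) <= A.
Proof.
move=> iw du A0 bd.
have [uw0|uw0] := eqVneq (u w) 0; first by rewrite uw0 cabs0.
have [/andP[w1 w2] /andP[w3 w4]] := iw.
pose r := Num.min (Num.min (cRe w - a) (b - cRe w))
                  (Num.min (cIm w - c) (d - cIm w)).
have r0 : 0 < r by rewrite !lt_min !subr_gt0 w1 w2 w3 w4.
set v := cabs (u w).
(* A rotation: [crude_max] wants a nonnegative real value at [w], and [(s u)^n] takes the value
   [v^n] there while the boundary bound becomes [A^n]. *)
pose s : C := Complex v 0 / u w.
have s1 : cabs s = 1.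
  by rewrite cabsM cabsV cabs_real ger0_norm ?cabs_ge0// divff// cabs_eq0.
apply: (pow_trick (a := 1) (b := 3 * ((b - a + (d - c)) / r) ^+ 2)) => //.
  exact: cabs_ge0.
move=> n; rewrite mul1r.
apply: (@crude_max (fun z => (s * u z) ^+ n) a b c d w) => //.
- move=> z zQ; apply: cdiffX; apply: cdiffM; [exact: cdiff_cst|exact: du].
- move=> z zb; rewrite cabsX cabsM s1 mul1r; apply: lerXn2r; rewrite ?nnegrE ?cabs_ge0//; exact: bd.
- by rewrite exprn_ge0.
- by rewrite /s divfK// -[Complex v 0]/(v%:C)%C -rmorphXn.
- by rewrite exprn_ge0 ?cabs_ge0.
- by rewrite /r !ge_min lexx.
- by rewrite /r !ge_min lexx !orbT.
- by rewrite /r !ge_min lexx !orbT.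
- by rewrite /r !ge_min lexx !orbT.
Qed.

End ScalarMaximumPrinciple.

(** * Maximum principle up to the boundary and across isolated bounded singularities *)

Section MaximumPrincipleRemovable.
Context {R : realType}.
Local Notation C := R[i].
Local Notation hc := (seminorm_cabs R).

Lemma ccont_uniform (u : C -> C) a b c d : a <= b -> c <= d ->
  (forall z, inrect a b c d z -> ccont (inrect a b c d) u z) ->
  forall eta, 0 < eta -> exists2 dl, 0 < dl & forall z z', inrect a b c d z ->
    inrect a b c d z' -> cabs (z' - z) < dl -> cabs (u z' - u z) < eta.
Proof.
move=> ab cd cu eta eta0.
suff [dl dl0 H] : exists2 dl, 0 < dl & forall z z', inrect a b c d z ->
    inrect a b c d z -> inrect a b c d z' -> cabs (z' - z) < dl -> cabs (u z' - u z) < eta.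
  by exists dl => // z z' zQ; exact: H.
(* Only [z] is confined to the subrectangle; [z'] ranges over the full one, so pairs separated by a
   cut cause no trouble. *)
apply: (@cousin_rect R (fun a1 b1 c1 d1 => exists2 dl, 0 < dl & forall z z',
    inrect a1 b1 c1 d1 z -> inrect a b c d z -> inrect a b c d z' ->
    cabs (z' - z) < dl -> cabs (u z' - u z) < eta)) => //.
  move=> a1 b1 c1 d1 m n [e1 e10 H1] [e2 e20 H2] [e3 e30 H3] [e4 e40 H4].
  exists (Num.min (Num.min e1 e2) (Num.min e3 e4)); first by rewrite !lt_min e10 e20 e30.
  move=> z z' [/andP[x1 x2] /andP[y1 y2]] zQ z'Q.
  rewrite !lt_min => /andP[/andP[h1 h2] /andP[h3 h4]].
  have [xm|mx] := leP (cRe z) m; have [yn|ny] := leP (cIm z) n.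
  - by apply: H1 => //; split; rewrite ?x1 ?y1.
  - by apply: H3 => //; split; rewrite ?x1 ?y2 ?xm ?(ltW ny).
  - by apply: H2 => //; split; rewrite ?x2 ?y1 ?(ltW mx).
  - by apply: H4 => //; split; rewrite ?x2 ?y2 ?(ltW mx) ?(ltW ny).
move=> x y xab ycd; set p0 : C := Complex x y.
have e2 : 0 < eta / 2 by rewrite divr_gt0.
have [dl [dl0 H]] := cu p0 (conj xab ycd) _ e2.
exists (dl / 4); first by rewrite divr_gt0.
move=> a1 b1 c1 d1 _ /andP[ax xb] _ _ /andP[cy yd] _ w1 w2.
exists (dl / 2); first by rewrite divr_gt0.
move=> z z' [/andP[z1 z2] /andP[z3 z4]] zQ z'Q zz'.
have zp : cabs (z - p0) < dl / 2.
  apply: le_lt_trans (cabs_le_ReIm _) _; rewrite cReB cImB /=.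
  have n1 : `|cRe z - x| <= b1 - a1.
    by clear -z1 z2 ax xb; rewrite ler_norml; apply/andP; split; lra.
  have n2 : `|cIm z - y| <= d1 - c1.
    by clear -z3 z4 cy yd; rewrite ler_norml; apply/andP; split; lra.
  by apply: le_lt_trans (lerD n1 n2) _; clear -w1 w2; lra.
have z'p : cabs (z' - p0) < dl.
  have -> : z' - p0 = (z' - z) + (z - p0) by rewrite addrA subrK.
  by apply: le_lt_trans (cabsD _ _) _; clear -zp zz'; lra.
have u1 := H z zQ (lt_trans zp _); have u2 := H z' z'Q z'p.
have {}u1 : cabs (u z - u p0) < eta / 2 by apply: u1; clear -dl0; lra.
have -> : u z' - u z = (u z' - u p0) - (u z - u p0) by ring.
by apply: le_lt_trans (cabsD _ _) _; rewrite cabsN; clear -u1 u2; lra.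
Qed.

(** Shrinking the rectangle by [s] puts its closure inside the domain of differentiability; uniform
    continuity limits the loss in the boundary bound to [eta]. *)
Lemma max_principle_cont (u : C -> C) a b c d w A : intrect a b c d w ->
  (forall z, intrect a b c d z -> cdiff u z) ->
  (forall z, inrect a b c d z -> ccont (inrect a b c d) u z) -> 0 <= A ->
  (forall z, bdrect a b c d z -> cabs (u z) <= A) -> cabs (u w) <= A.
Proof.
move=> iw du cu A0 bd; have [/andP[w1 w2] /andP[w3 w4]] := iw.
have ab : a <= b by clear -w1 w2; lra.
have cd : c <= d by clear -w3 w4; lra.
apply/ler_addgt0Pr => eta eta0.
have [dl dl0 H] := ccont_uniform ab cd cu eta0.
pose s := Num.min dl (Num.min (Num.min (cRe w - a) (b - cRe w))
                  (Num.min (cIm w - c) (d - cIm w))) / 2.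
have s2 : 0 < s * 2 by rewrite divfK// !lt_min dl0 !subr_gt0 w1 w2 w3 w4.
have : s * 2 <= dl /\ [/\ s * 2 <= cRe w - a, s * 2 <= b - cRe w,
     s * 2 <= cIm w - c & s * 2 <= d - cIm w].
  by rewrite divfK// !ge_min !lexx !orbT.
move=> [s1 [s3 s4 s5 s6]]; have s0 : 0 < s by clear -s2; lra.
have sub z : inrect (a + s) (b - s) (c + s) (d - s) z -> intrect a b c d z.
  by clear -s0 => -[/andP[? ?] /andP[? ?]]; split; apply/andP; split; lra.
apply: (@max_principle_closed R u (a + s) (b - s) (c + s) (d - s)).
- by clear -s0 s3 s4 s5 s6; split; apply/andP; split; lra.
- by move=> z /sub; exact: du.
- by apply: addr_ge0 => //; exact: ltW.
move=> z [zQ zb]; have zI := sub _ zQ; have zQ' := intrect_sub zI.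
have near z' : bdrect a b c d z' -> cabs (z' - z) = s -> cabs (u z) <= A + eta.
  move=> z'b zz'.
  have := H z' z (proj1 z'b) zQ'; rewrite cabsB zz' => /(_ _) uu.
  have {}uu : cabs (u z - u z') < eta by apply: uu; clear -s0 s1; lra.
  have := cabs_triB (u z) (u z'); have := bd _ z'b.
  by clear -uu => ? ?; lra.
have [zx zy] := zQ'.
have ns : `|s| = s by rewrite gtr0_norm.
case: zb => [zz|[zz|[zz|zz]]].
- apply: (near (Complex a (cIm z))).
    by split; [split => //=; rewrite lexx ab|left].
  rewrite (_ : _ - z = Complex (- s) 0) ?cabs_real ?normrN//.
  by rewrite [z in _ - z]complex_eta zz; congr Complex; rewrite /= ?subrr//; ring.
- apply: (near (Complex b (cIm z))).
    by split; [split => //=; rewrite lexx ab|right; left].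
  rewrite (_ : _ - z = Complex s 0) ?cabs_real ?normrN//.
  by rewrite [z in _ - z]complex_eta zz; congr Complex; rewrite /= ?subrr//; ring.
- apply: (near (Complex (cRe z) c)).
    by split; [split => //=; rewrite lexx cd|right; right; left].
  rewrite (_ : _ - z = Complex 0 (- s)) ?cabs_imag ?normrN//.
  by rewrite [z in _ - z]complex_eta zz; congr Complex; rewrite /= ?subrr//; ring.
- apply: (near (Complex (cRe z) d)).
    by split; [split => //=; rewrite lexx cd|right; right; right].
  rewrite (_ : _ - z = Complex 0 s) ?cabs_imag ?normrN//.
  by rewrite [z in _ - z]complex_eta zz; congr Complex; rewrite /= ?subrr//; ring.
Qed.

Lemma intrect_nbhs a b c d (w : C) : intrect a b c d w -> exists2 r, 0 < r &
  forall z, cabs (z - w) < r -> intrect a b c d z.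
Proof.
move=> [/andP[w1 w2] /andP[w3 w4]].
exists (Num.min (Num.min (cRe w - a) (b - cRe w))
                (Num.min (cIm w - c) (d - cIm w))).
  by rewrite !lt_min !subr_gt0 w1 w2 w3 w4.
move=> z; rewrite !lt_min => /andP[/andP[h1 h2] /andP[h3 h4]].
have := Re_le_cabs (z - w); have := Im_le_cabs (z - w).
rewrite cReB cImB !ler_norml => /andP[i1 i2] /andP[r1 r2].
by clear -h1 h2 h3 h4 i1 i2 r1 r2; split; apply/andP; split; lra.
Qed.

(** Induction on the exceptional points. As [u] is bounded near [e], the function [(z - e)^2 u^n] is
    differentiable at [e], with derivative [0], or continuous there if [e] lies on the boundary; it
    is at most [B^2 A^n] on the boundary, and [pow_trick] discards [B] and [|w - e|]. *)
Lemma max_principle_scalar (E : seq C) (u : C -> C) a b c d w A :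
  intrect a b c d w -> w \notin E ->
  (forall z, intrect a b c d z -> z \notin E -> cdiff u z) ->
  (forall z, inrect a b c d z -> z \notin E -> ccont (inrect a b c d) u z) ->
  (forall e, e \in E -> exists dl M : R, 0 < dl /\
    forall z, inrect a b c d z -> z != e -> cabs (z - e) < dl -> cabs (u z) <= M) ->
  0 <= A -> (forall z, bdrect a b c d z -> cabs (u z) <= A) -> cabs (u w) <= A.
Proof.
elim: E u A => [|e E IH] u A iw wE du cu bu A0 bd.
  by apply: max_principle_cont iw _ _ A0 bd => z zQ; [exact: du|exact: cu].
move: wE; rewrite inE negb_or => /andP[we wE].
pose B := `|a| + `|b| + `|c| + `|d| + cabs e.
have B0 : 0 <= B by rewrite /B !addr_ge0 ?cabs_ge0.
have Bb z : inrect a b c d z -> cabs (z - e) <= B.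
  move=> [/andP[z1 z2] /andP[z3 z4]]; apply: le_trans (cabsD _ _) _.
  rewrite cabsN lerD2r; apply: le_trans (cabs_le_ReIm _) _; rewrite -addrA.
  apply: lerD.
    rewrite ler_norml; have := ler_norm b; have := ler_norm (- a); rewrite normrN.
    have := normr_ge0 a; have := normr_ge0 b; clear -z1 z2 => *; apply/andP; split; lra.
  rewrite ler_norml; have := ler_norm d; have := ler_norm (- c); rewrite normrN.
  have := normr_ge0 c; have := normr_ge0 d; clear -z3 z4 => *; apply/andP; split; lra.
have e_bnd : exists dl M : R, [/\ 0 < dl, 0 <= M &
    forall z, inrect a b c d z -> cabs (z - e) < dl -> cabs (u z) <= M].
  have [|dl [M [dl0 HM]]] := bu e; first by rewrite inE eqxx.
  exists dl, (Num.max M (cabs (u e))); split => //; first by rewrite le_max cabs_ge0 orbT.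
  move=> z zQ ze; rewrite le_max; have [->|zne] := eqVneq z e; first by rewrite lexx orbT.
  by rewrite HM.
apply: (pow_trick (a := cabs (w - e) ^+ 2) (b := B ^+ 2)) => //.
- by rewrite exprn_gt0// cabs_gt0 subr_eq0.
- exact: cabs_ge0.
move=> n; rewrite -!cabsX -cabsM.
pose U z := (z - e) ^+ 2 * u z ^+ n; rewrite -/(U w).
have [dl [M [dl0 M0 HM]]] := e_bnd.
have Ue : U e = 0 by rewrite /U subrr expr0n/= mul0r.
have Usmall z : inrect a b c d z -> cabs (z - e) < dl ->
    cabs (U z) <= cabs (z - e) * (cabs (z - e) * M ^+ n).
  move=> zQ /(HM z zQ) uz; rewrite /U cabsM !cabsX expr2 -!mulrA.
  apply: ler_wpM2l; rewrite ?cabs_ge0//; apply: ler_wpM2l; rewrite ?cabs_ge0//.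
  by apply: lerXn2r; rewrite ?nnegrE ?cabs_ge0.
have Mn : 0 < M ^+ n + 1 by rewrite ltr_wpDl ?exprn_ge0.
have cab2 z : ccont (inrect a b c d) (fun z => (z - e) ^+ 2) z.
  by apply: (vdiff_cont hc); apply: cdiffX; apply: cdiffB_cst; exact: cdiff_id.
apply: IH => //.
- move=> z zI zE; have [zie|zne] := eqVneq z e; last first.
    apply: cdiffM.
      by apply: cdiffX; apply: cdiffB_cst; exact: cdiff_id.
    by apply: cdiffX; apply: du => //; rewrite inE negb_or zne.
  rewrite zie in zI *; exists 0 => ep ep0.
  have [r r0 Hr] := intrect_nbhs zI.
  exists (Num.min (Num.min dl r) (ep / (M ^+ n + 1))).
  split; first by rewrite !lt_min dl0 r0 divr_gt0.
  move=> h; rewrite !lt_min => /andP[/andP[h1 h2] h3].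
  have eh : e + h - e = h by rewrite addrAC subrr add0r.
  have ehQ : inrect a b c d (e + h) by apply: intrect_sub; apply: Hr; rewrite eh.
  have ehd : cabs (e + h - e) < dl by rewrite eh.
  rewrite Ue scaler0 !subr0; apply: le_trans (Usmall _ ehQ ehd) _; rewrite eh.
  rewrite mulrC ler_wpM2r ?cabs_ge0//.
  move: h3; rewrite ltr_pdivlMr// => /ltW; apply: le_trans.
  by rewrite ler_wpM2l ?cabs_ge0// lerDl.
- move=> z zQ zE; have [zie|zne] := eqVneq z e; last first.
    apply: ccontM => //; apply: ccontX; apply: cu => //.
    by rewrite inE negb_or zne.
  rewrite zie => ep ep0.
  exists (Num.min (Num.min dl 1) (ep / (M ^+ n + 1))).
  split; first by rewrite !lt_min dl0 ltr01 divr_gt0.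
  move=> z' z'Q; rewrite !lt_min => /andP[/andP[h1 h2] h3].
  rewrite Ue subr0; apply: le_lt_trans (Usmall _ z'Q h1) _.
  move: h3; rewrite ltr_pdivlMr//; apply: le_lt_trans.
  rewrite -[leRHS]mul1r; apply: ler_pM; rewrite ?cabs_ge0 ?mulr_ge0 ?exprn_ge0 ?cabs_ge0//.
    exact: ltW.
  by rewrite ler_wpM2l ?cabs_ge0// lerDl.
- move=> e' e'E; have [|dl' [M' [dl'0 HM']]] := bu e'; first by rewrite inE e'E orbT.
  exists dl', (B ^+ 2 * Num.max 0 M' ^+ n); split => // z zQ ze' zz.
  rewrite /U cabsM !cabsX; apply: ler_pM; rewrite ?exprn_ge0 ?cabs_ge0//.
    by apply: lerXn2r; rewrite ?nnegrE ?cabs_ge0//; exact: Bb.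
  apply: lerXn2r; rewrite ?nnegrE ?cabs_ge0// ?le_max ?lexx//.
  by rewrite (HM' _ zQ ze' zz) orbT.
- by rewrite mulr_ge0 ?exprn_ge0.
- move=> z zb; rewrite /U cabsM !cabsX; apply: ler_pM; rewrite ?exprn_ge0 ?cabs_ge0//.
    by apply: lerXn2r; rewrite ?nnegrE ?cabs_ge0//; apply: Bb; case: zb.
  by apply: lerXn2r; rewrite ?nnegrE ?cabs_ge0//; exact: bd.
Qed.

End MaximumPrincipleRemovable.

(** * Hahn-Banach by minimal sublinear functionals *)

Section HahnBanach.
Context {R : realType} {V : lmodType R[i]}.
Local Notation C := R[i].
Local Notation "t ** x" := (Complex t 0 *: x) (at level 40).

Let rs1 (x : V) : 1 ** x = x.
Proof. exact: scale1r. Qed.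
Let rsM (s t : R) (x : V) : s ** (t ** x) = (s * t) ** x.
Proof. by rewrite scalerA; congr (_ *: _); congr Complex; rewrite /= ?mulr0 ?mul0r ?subr0 ?addr0. Qed.
Let rsD (s t : R) (x : V) : (s + t) ** x = s ** x + t ** x.
Proof. by rewrite -scalerDl; congr (_ *: _); congr Complex; rewrite /= addr0. Qed.
Let rs0 (x : V) : 0 ** x = 0.
Proof. exact: scale0r. Qed.

(** Homogeneity is asked as an inequality, which passes to infima; equality follows by applying it
    to [t^-1] as well. *)
Definition sublinear (q : V -> R) : Prop :=
  (forall x y, q (x + y) <= q x + q y) /\
  (forall t x, 0 < t -> q (t ** x) <= t * q x).

Lemma sublinear0 q : sublinear q -> q 0 = 0.
Proof.
move=> [qD qZ]; apply/eqP; rewrite eq_le; apply/andP; split.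
  have h : 0 < (2^-1 : R) by rewrite invr_gt0.
  by have := qZ _ 0 h; rewrite scaler0 => ?; lra.
by have := qD 0 0; rewrite addr0 => ?; lra.
Qed.

Lemma sublinearN q x : sublinear q -> - q (- x) <= q x.
Proof.
by move=> hq; have [qD _] := hq; have := qD x (- x);
  rewrite subrr sublinear0// => ?; lra.
Qed.

Lemma sublinearZ q t x : sublinear q -> 0 < t -> q (t ** x) = t * q x.
Proof.
move=> [qD qZ] t0; apply/eqP; rewrite eq_le qZ//=.
have ti : 0 < t^-1 by rewrite invr_gt0.
have := qZ _ (t ** x) ti; rewrite rsM mulVf ?gt_eqF// rs1 => H.
by rewrite -ler_pdivlMl.
Qed.

Let shiftset (q : V -> R) (y v : V) : set R :=
  [set q (v + t ** y) - t * q y | t in [set t | 0 <= t]]%classic.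

(** It is sublinear, lies below [q] (take [t = 0]) and below [q (v + y) - q y] (take [t = 1]). A
    minimal [q] must coincide with it, which forces additivity. *)
Definition sublinear_shift q (y v : V) : R := inf (shiftset q y v).

Let shiftset_lb q y v : sublinear q -> has_inf (shiftset q y v).
Proof.
move=> hq; have [qD qZ] := hq; split; first by exists (q (v + 0 ** y) - 0 * q y), 0 => /=.
exists (- q (- v)) => _ [t /= t0 <-].
have [->|tn] := eqVneq t 0; first by rewrite rs0 mul0r addr0 subr0; exact: sublinearN.
have tp : 0 < t by rewrite lt_def tn.
have := qD (v + t ** y) (- v); rewrite addrAC subrr add0r sublinearZ// => ?.
by lra.
Qed.

Lemma sublinear_shift_le q y v t : sublinear q -> 0 <= t ->
  sublinear_shift q y v <= q (v + t ** y) - t * q y.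
Proof.
by move=> hq t0; apply: ge_inf; [exact: (shiftset_lb _ _ hq).2|exists t].
Qed.

Lemma sublinear_shiftP q y : sublinear q -> sublinear (sublinear_shift q y).
Proof.
move=> hq; have [qD qZ] := hq; split.
  move=> v w; rewrite -lerBlDr.
  apply: lb_le_inf; first exact: (shiftset_lb _ _ hq).1.
  move=> _ [s /= s0 <-]; rewrite lerBlDr -lerBlDl.
  apply: lb_le_inf; first exact: (shiftset_lb _ _ hq).1.
  move=> _ [t /= t0 <-]; rewrite lerBlDl.
  apply: le_trans (sublinear_shift_le _ _ hq (addr_ge0 s0 t0)) _.
  rewrite rsD addrACA; have := qD (v + s ** y) (w + t ** y) => ?; lra.
move=> l v l0; rewrite -ler_pdivrMl//.
apply: lb_le_inf; first exact: (shiftset_lb _ _ hq).1.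
move=> _ [t /= t0 <-]; rewrite ler_pdivrMl//.
have lt0 : 0 <= l * t by rewrite mulr_ge0// ltW.
apply: le_trans (sublinear_shift_le _ _ hq lt0) _.
rewrite -rsM -scalerDr mulrBr mulrA lerD2r; exact: qZ.
Qed.

(** Zorn's lemma for the reversed pointwise order. The infimum of a chain is finite because
    [- p (- x)] is a lower bound, and subadditive because the smaller of two members of the chain
    serves both arguments. *)
Lemma minimal_sublinear (p : V -> R) : sublinear p -> exists q : V -> R,
  [/\ sublinear q, forall x, q x <= p x &
      forall q', sublinear q' -> (forall x, q' x <= q x) -> forall x, q x <= q' x].
Proof.
move=> hp.
pose T := {q : V -> R | sublinear q /\ forall x, q x <= p x}.
pose t0 : T := exist _ p (conj hp (fun x => lexx (p x))).
pose le (q r : T) := `[< forall x, sval r x <= sval q x >].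
have [|||q qmax] := @ZL_preorder T t0 le.
- by move=> q; apply/asboolP.
- by move=> q r s /asboolP H1 /asboolP H2; apply/asboolP => x; exact: le_trans (H2 x) (H1 x).
- move=> A Atot.
  have [[q0 Aq0]|Ae] := pselect (exists q, A q); last first.
    by exists t0 => s As; exfalso; apply: Ae; exists s.
  pose S x := [set sval q x | q in A]%classic.
  have Sinf x : has_inf (S x).
    split; first by exists (sval q0 x), q0.
    exists (- p (- x)) => _ [q Aq <-].
    have [hq hqp] := svalP q; apply: le_trans (sublinearN _ hq).
    by rewrite lerN2 hqp.
  have Sle q x : A q -> inf (S x) <= sval q x.
    by move=> Aq; apply: ge_inf; [exact: (Sinf x).2|exists q].
  have hi : sublinear (fun x => inf (S x)) /\ forall x, inf (S x) <= p x.
    split; last first.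
      by move=> x; apply: le_trans (Sle q0 x Aq0) _; have [_] := svalP q0.
    split.
      move=> x y; rewrite -lerBlDr; apply: lb_le_inf; first exact: (Sinf x).1.
      move=> _ [q Aq <-]; rewrite lerBlDr -lerBlDl.
      apply: lb_le_inf; first exact: (Sinf y).1.
      move=> _ [r Ar <-]; rewrite lerBlDl.
      have [/asboolP qr|/asboolP rq] := Atot q r Aq Ar.
        apply: le_trans (Sle r _ Ar) _; have [[rD _] _] := svalP r.
        by apply: le_trans (rD _ _) _; rewrite lerD2r.
      apply: le_trans (Sle q _ Aq) _; have [[qD _] _] := svalP q.
      by apply: le_trans (qD _ _) _; rewrite lerD2l.
    move=> t x tp; rewrite -ler_pdivrMl//; apply: lb_le_inf; first exact: (Sinf x).1.
    move=> _ [q Aq <-]; rewrite ler_pdivrMl//; apply: le_trans (Sle q _ Aq) _.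
    by have [[_ qZ] _] := svalP q; exact: qZ.
  exists (exist (fun q => sublinear q /\ forall x, q x <= p x) _ hi) => s As; apply/asboolP => x /=; exact: Sle.
have [hq qp] := svalP q; exists (sval q); split => // q' hq' q'q x.
have hq'p : sublinear q' /\ forall x, q' x <= p x.
  by split => // y; exact: le_trans (q'q y) (qp y).
pose s : T := exist (fun q => sublinear q /\ forall x, q x <= p x) q' hq'p.
have qs : le q s by apply/asboolP.
by have /asboolP := qmax s qs; apply.
Qed.

(* The minimal sublinear functionals are the linear ones. *)
Lemma norming_functional (p : V -> R) (x0 : V) : seminorm p ->
  exists l : V -> C, [/\ forall x y, l (x + y) = l x + l y,
    forall a x, l (a *: x) = a * l x, forall x, cabs (l x) <= p x &
    p x0 <= cabs (l x0)].
Proof.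
move=> hp.
have sp : sublinear p.
  split; first exact: snD.
  by move=> t x t0; rewrite (snZ hp) cabs_real gtr0_norm.
(* Minimizing below the shift of [p] along [x0] instead of below [p] secures [q (- x0) <= - p x0],
   the norming property. *)
have [q [hq qp qmin]] := minimal_sublinear (sublinear_shiftP x0 sp).
have [qD qZ] := hq.
have qp' x : q x <= p x.
  apply: le_trans (qp x) _; have := sublinear_shift_le x0 x sp (lexx 0).
  by rewrite rs0 addr0 mul0r subr0.
have qx0 : q (- x0) <= - p x0.
  apply: le_trans (qp _) _.
  have := sublinear_shift_le x0 (- x0) sp ler01.
  by rewrite rs1 addNr (sn0 hp) sub0r mul1r.
have qA x y : q (x + y) = q x + q y.
  apply/eqP; rewrite eq_le qD/=.
  have := qmin _ (sublinear_shiftP y hq).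
  have sle v : sublinear_shift q y v <= q v.
    by have := sublinear_shift_le y v hq (lexx 0); rewrite rs0 addr0 mul0r subr0.
  move=> /(_ sle x) H; have := le_trans H (sublinear_shift_le y x hq ler01).
  by rewrite rs1 mul1r => ?; lra.
have q0 := sublinear0 hq.
have qN x : q (- x) = - q x by apply/eqP; rewrite -subr_eq0 opprK addrC -qA subrr q0.
have qR t x : q (t ** x) = t * q x.
  have [tn|tp|->] := ltgtP t 0; last by rewrite rs0 q0 mul0r.
    have -> : t ** x = - ((- t) ** x).
      by rewrite -scaleNr; congr (_ *: _); congr Complex; rewrite /= ?opprK ?oppr0.
    by rewrite qN sublinearZ ?oppr_gt0// mulNr opprK.
  exact: sublinearZ.
pose I : C := Complex 0 1.
(* The complex-linear functional with real part [q]; complex linearity forces its imaginary part. *)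
pose l v : C := Complex (q v) (- q (I *: v)).
have lD x y : l (x + y) = l x + l y.
  by rewrite /l scalerDr !qA; congr Complex; rewrite /= opprD.
have lZ a x : l (a *: x) = a * l x.
  have e1 : a *: x = cRe a ** x + cIm a ** (I *: x).
    rewrite scalerA -scalerDl; congr (_ *: _).
    by case: a => s t; congr Complex; rewrite /= ?mulr0 ?mul0r ?mulr1 ?subr0 ?sub0r ?addr0 ?add0r.
  have e2 : I *: (a *: x) = cRe a ** (I *: x) - cIm a ** x.
    rewrite !scalerA -scalerBl; congr (_ *: _).
    by clear e1; case: a => s t; congr Complex; rewrite /= ?mulr0 ?mul0r ?mulr1 ?mul1r ?subr0 ?sub0r ?addr0 ?add0r ?oppr0 ?addr0.
  rewrite /l e2 [in q _]e1 !qA qN !qR.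
  by rewrite [a in RHS]complex_eta; congr Complex; rewrite /=; ring.
exists l; split => //.
- move=> x; have [lx|lx] := eqVneq (l x) 0; first by rewrite lx cabs0 (sn_ge0 hp).
  (* A rotation of [x] makes [l x] real, and [q <= p] bounds it there. *)
  pose s : C := Complex (cabs (l x)) 0 / l x.
  have s1 : cabs s = 1.
    by rewrite cabsM cabsV cabs_real ger0_norm ?cabs_ge0// divff// cabs_eq0.
  have : l (s *: x) = Complex (cabs (l x)) 0 by rewrite lZ /s divfK.
  move=> /(congr1 (@cRe _))/= <-.
  by apply: le_trans (qp' _) _; rewrite (snZ hp) s1 mul1r.
- apply: le_trans (Re_le_cabs _); apply: le_trans (ler_norm _); rewrite /l /=.
  by move: qx0; rewrite qN lerN2.
Qed.

End HahnBanach.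

Section VectorMaximumPrinciple.
Context {R : realType} {V : lmodType R[i]}.
Local Notation C := R[i].
Context (p : V -> R) (hp : seminorm p).

(** A functional dominated by [p] and norming [f w] reduces this to the scalar case. *)
Lemma max_principle (E : seq C) (f : C -> V) a b c d w A :
  intrect a b c d w -> w \notin E ->
  (forall z, intrect a b c d z -> z \notin E -> vdiff p f z) ->
  (forall z, inrect a b c d z -> z \notin E -> vcont p (inrect a b c d) f z) ->
  (forall e, e \in E -> exists dl M : R, 0 < dl /\
    forall z, inrect a b c d z -> z != e -> cabs (z - e) < dl -> p (f z) <= M) ->
  0 <= A -> (forall z, bdrect a b c d z -> p (f z) <= A) -> p (f w) <= A.
Proof.
move=> iw wE df cf bf A0 bd.
have [l [lD lZ lp lw]] := norming_functional (f w) hp.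
have lB x y : l (x - y) = l x - l y.
  by rewrite lD -scaleN1r lZ mulN1r.
apply: le_trans lw _.
apply: (@max_principle_scalar R E (fun z => l (f z)) a b c d) => //.
- move=> z zI zE; have [f' H] := df z zI zE; exists (l f') => e /H[dl [dl0 Hd]].
  exists dl; split => // h /Hd; apply: le_trans.
  by rewrite -[h *: _]/(h * l f') -lZ -!lB.
- move=> z zI zE e /(cf z zI zE)[dl [dl0 Hd]]; exists dl; split => // w' w'Q /(Hd _ w'Q).
  by apply: le_lt_trans; rewrite -lB.
- move=> e /bf[dl [M [dl0 H]]]; exists dl, M; split => // z zQ ze zz.
  exact: le_trans (lp _) (H z zQ ze zz).
- by move=> z /bd; apply: le_trans.
Qed.

End VectorMaximumPrinciple.

(** * The K-functional *)

Section ExtendedNorms.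
Context {R : realType} {V : lmodType R[i]}.
Local Notation C := R[i].
Context (N : V -> \bar R) (hN : is_enorm N).

Lemma en_ge0 x : (0 <= N x)%E. Proof. by case: hN. Qed.
Lemma en0 : N 0 = 0%E. Proof. by case: hN. Qed.

Lemma en_bound_ge0 x r : (N x <= r%:E)%E -> 0 <= r.
Proof. by move=> /(le_trans (en_ge0 x)); rewrite lee_fin. Qed.

Lemma enD x y a b : (N x <= a%:E)%E -> (N y <= b%:E)%E -> (N (x + y) <= (a + b)%:E)%E.
Proof.
by move=> xa yb; have [_ _ _ D _] := hN; apply: le_trans (D x y) _;
  rewrite EFinD; exact: leeD.
Qed.

Lemma enZ (a : C) x r : (N x <= r%:E)%E -> (N (a *: x) <= (cabs a * r)%:E)%E.
Proof.
move=> xr; have [->|a0] := eqVneq a 0; first by rewrite scale0r cabs0 mul0r en0.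
have [_ _ _ _ ->//] := hN; rewrite EFinM; apply: lee_wpmul2l => //.
by rewrite lee_fin cabs_ge0.
Qed.

Lemma enN x : N (- x) = N x.
Proof.
rewrite -scaleN1r; have [_ _ _ _ ->] := hN; last by rewrite oppr_eq0 oner_eq0.
by rewrite cabsN cabs1 mul1e.
Qed.

Lemma enB x y a b : (N x <= a%:E)%E -> (N y <= b%:E)%E -> (N (x - y) <= (a + b)%:E)%E.
Proof. by move=> xa yb; apply: enD => //; rewrite enN. Qed.

Lemma en_fin x : (N x < +oo)%E -> exists2 r, 0 <= r & N x = r%:E.
Proof.
move=> xoo; exists (fine (N x)); first by rewrite fine_ge0// en_ge0.
by rewrite fineK// ge0_fin_numE// en_ge0.
Qed.

Lemma en_geometric (a : nat -> V) (c q : R) : 0 < q < 1 -> 0 <= c ->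
  (forall n, (N (a n) <= (c * q ^+ n)%:E)%E) ->
  forall l k, (N ((\sum_(i < (l + k)%N) a i) - \sum_(i < l) a i)
    <= (c / (1 - q) * q ^+ l)%:E)%E.
Proof.
move=> /andP[q0 q1] c0 Ha l k.
(* The exact partial geometric sum is kept as the bound, since the weaker one does not pass through
   the induction on [k]. *)
suff H : (N ((\sum_(i < (l + k)%N) a i) - \sum_(i < l) a i) <=
    (c / (1 - q) * (q ^+ l - q ^+ (l + k)))%:E)%E.
  apply: le_trans H _; rewrite lee_fin ler_wpM2l ?divr_ge0 ?subr_ge0 ?(ltW q1)//.
  by rewrite lerBlDr lerDl exprn_ge0 ?(ltW q0).
elim: k => [|k IH]; first by rewrite addn0 !subrr en0 mulr0.
rewrite addnS big_ord_recr/= addrAC.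
apply: le_trans (enD IH (Ha (l + k)%N)) _; rewrite lee_fin; apply: eq_ler.
by rewrite exprS; field; rewrite subr_eq0 gt_eqF.
Qed.

Lemma en_series_cvg (a : nat -> V) (c q : R) : ecomplete N -> 0 < q < 1 -> 0 <= c ->
  (forall n, (N (a n) <= (c * q ^+ n)%:E)%E) ->
  exists x, (N x < +oo)%E /\ forall e, 0 < e -> exists M : nat, forall n, (M <= n)%N ->
    (N ((\sum_(i < n) a i) - x) < e%:E)%E.
Proof.
move=> cN q01 c0 Ha; have /andP[q0 q1] := q01.
have geo := en_geometric q01 c0 Ha.
apply: cN => [n|e e0].
  have := geo 0%N n; rewrite add0n big_ord0 subr0 => H.
  by apply: le_lt_trans H _; rewrite ltry.
set K := c / (1 - q) + 1.
have K0 : 0 < K by rewrite ltr_wpDl ?divr_ge0 ?subr_ge0 ?(ltW q1).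
have [M HM] : exists M : nat, forall n, (M <= n)%N -> K * q ^+ n < e.
  have := @cvg_geometric R K q; rewrite gtr0_norm// => /(_ q1).
  move=> /cvgrPdist_lt/(_ _ e0)[M _ H]; exists M => n /H /=.
  by rewrite sub0r normrN gtr0_norm// mulr_gt0 ?exprn_gt0.
exists M => k l.
wlog lk : k l / (l <= k)%N.
  move=> W Mk Ml; have [/W->//|/ltnW kl] := leqP l k.
  by rewrite -enN opprB; apply: W.
move=> Mk Ml; have := geo l (k - l)%N; rewrite subnKC// => H.
apply: le_lt_trans H _; rewrite lte_fin; apply: le_lt_trans (HM l Ml).
by rewrite ler_wpM2r ?exprn_ge0 ?(ltW q0)// lerDl.
Qed.

End ExtendedNorms.

Section Couple.
Context {R : realType} {V : lmodType R[i]}.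
Local Notation C := R[i].
Context (N0 N1 : V -> \bar R).

(* No information is lost by [fine]: [Kfun] is finite on [X0 + X1] for [0 < t]. *)
Definition kf (t : R) (v : V) : R := fine (Kfun N0 N1 t v).

Context (hX : is_couple N0 N1).

Let h0 : is_enorm N0. Proof. by case: hX => -[]. Qed.
Let h1 : is_enorm N1. Proof. by case: hX => -[]. Qed.

Lemma Kfun_ge0 t v : 0 < t -> (0 <= Kfun N0 N1 t v)%E.
Proof.
move=> t0; apply: le_ereal_inf_tmp => _ [x0 [x1 [_ ->]]].
by rewrite adde_ge0 ?mule_ge0 ?(en_ge0 h0) ?(en_ge0 h1)// lee_fin ltW.
Qed.

Lemma KfunE t v : 0 < t -> Kfun N0 N1 t v = (kf t v)%:E.
Proof.
move=> t0; rewrite /kf fineK// ge0_fin_numE ?Kfun_ge0//.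
have [_ _ /(_ v)[x0 [x1 [vE f0 f1]]] _] := hX.
have [r0 r00 e0] := en_fin h0 f0; have [r1 r10 e1] := en_fin h1 f1.
apply: (@le_lt_trans _ _ (N0 x0 + t%:E * N1 x1)%E).
  by apply: ereal_inf_lbound; exists x0, x1.
by rewrite e0 e1 -EFinM -EFinD ltry.
Qed.

Lemma kf_ge0 t v : 0 < t -> 0 <= kf t v.
Proof. by move=> t0; rewrite fine_ge0// Kfun_ge0. Qed.

Lemma kf_le t x0 x1 r0 r1 : 0 < t -> (N0 x0 <= r0%:E)%E -> (N1 x1 <= r1%:E)%E ->
  kf t (x0 + x1) <= r0 + t * r1.
Proof.
move=> t0 H0 H1; rewrite -lee_fin -KfunE//.
apply: (@le_trans _ _ (N0 x0 + t%:E * N1 x1)%E).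
  by apply: ereal_inf_lbound; exists x0, x1.
by rewrite EFinD EFinM; apply: leeD => //; apply: lee_wpmul2l => //; rewrite lee_fin ltW.
Qed.

Lemma kf_le0 t x r : 0 < t -> (N0 x <= r%:E)%E -> kf t x <= r.
Proof.
move=> t0 H; have := @kf_le t x 0 r 0 t0 H; rewrite addr0 mulr0 addr0; apply.
by rewrite (en0 h1).
Qed.

Lemma kf_le1 t x r : 0 < t -> (N1 x <= r%:E)%E -> kf t x <= t * r.
Proof.
move=> t0 H; have := @kf_le t 0 x 0 r t0 _ H; rewrite !add0r; apply.
by rewrite (en0 h0).
Qed.

Lemma kf_decomp t v e : 0 < t -> kf t v < e -> exists x0 x1 r0 r1,
  [/\ x0 + x1 = v, N0 x0 = r0%:E, N1 x1 = r1%:E, 0 <= r0 /\ 0 <= r1 & r0 + t * r1 < e].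
Proof.
move=> t0; rewrite -lte_fin -KfunE// => /ereal_inf_lt[_ [x0 [x1 [xv ->]]] H].
have p0 := en_ge0 h0 x0; have p1 := en_ge0 h1 x1.
have f0 : (N0 x0 < +oo)%E.
  rewrite ltNge; apply/negP; rewrite leye_eq => /eqP E; move: H; rewrite E addye//.
  by rewrite gt_eqF// (lt_le_trans (ltNyr 0))// mule_ge0// lee_fin ltW.
have f1 : (N1 x1 < +oo)%E.
  rewrite ltNge; apply/negP; rewrite leye_eq => /eqP E; move: H; rewrite E gt0_muley ?lte_fin//.
  by rewrite addey// gt_eqF// (lt_le_trans (ltNyr 0)).
have [r0 r00 e0] := en_fin h0 f0; have [r1 r10 e1] := en_fin h1 f1.
exists x0, x1, r0, r1; split => //.
by move: H; rewrite e0 e1 -EFinM -EFinD lte_fin.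
Qed.

Lemma kf_seminorm t : 0 < t -> seminorm (kf t).
Proof.
move=> t0.
have kD x y : kf t (x + y) <= kf t x + kf t y.
  apply/ler_addgt0Pr => e e0; have e2 : 0 < e / 2 by rewrite divr_gt0.
  have [|x0 [x1 [r0 [r1 [<- E0 E1 _ L1]]]]] := @kf_decomp t x (kf t x + e / 2) t0.
    by rewrite ltrDl.
  have [|y0 [y1 [s0 [s1 [<- F0 F1 _ L2]]]]] := @kf_decomp t y (kf t y + e / 2) t0.
    by rewrite ltrDl.
  rewrite addrACA; apply: le_trans (@kf_le t _ _ (r0 + s0) (r1 + s1) t0 _ _) _.
  - by apply: enD; rewrite ?E0 ?F0.
  - by apply: enD; rewrite ?E1 ?F1.
  - by clear -L1 L2; lra.
have kZ (a : C) x : kf t (a *: x) <= cabs a * kf t x.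
  have [->|a0] := eqVneq a 0.
    by rewrite scale0r cabs0 mul0r; apply: kf_le0 => //; rewrite (en0 h0).
  have ca : 0 < cabs a by rewrite cabs_gt0.
  rewrite -ler_pdivrMl//; apply/ler_addgt0Pr => e e0.
  have [|x0 [x1 [r0 [r1 [<- E0 E1 _ L1]]]]] := @kf_decomp t x (kf t x + e) t0.
    by rewrite ltrDl.
  rewrite ler_pdivrMl// scalerDr; apply: le_trans (@kf_le t _ _ (cabs a * r0) (cabs a * r1) t0 _ _) _.
  - by apply: enZ; rewrite ?E0.
  - by apply: enZ; rewrite ?E1.
  - by rewrite mulrCA -mulrDr ler_wpM2l ?(ltW ca)// ltW.
split => // a x; apply/eqP; rewrite eq_le kZ/=.
have [->|a0] := eqVneq a 0; first by rewrite cabs0 mul0r kf_ge0.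
have ca : 0 < cabs a by rewrite cabs_gt0.
rewrite -ler_pdivlMl// -cabsV; apply: le_trans (kZ _ _).
by rewrite scalerA mulVf// scale1r.
Qed.

Lemma kf_mono s t v : 0 < s -> s <= t -> kf s v <= kf t v.
Proof.
move=> s0 st; have t0 := lt_le_trans s0 st.
apply/ler_addgt0Pr => e e0.
have [|x0 [x1 [r0 [r1 [<- E0 E1 [p0 p1] L1]]]]] := @kf_decomp t v (kf t v + e) t0.
  by rewrite ltrDl.
apply: le_trans (ltW L1); apply: le_trans (@kf_le s _ _ r0 r1 s0 _ _) _; rewrite ?E0 ?E1//.
by rewrite lerD2l ler_wpM2r.
Qed.

Lemma kf_ratio s t v : 0 < s -> s <= t -> kf t v <= t / s * kf s v.
Proof.
move=> s0 st; have t0 := lt_le_trans s0 st.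
have ts : 1 <= t / s by rewrite ler_pdivlMr// mul1r.
rewrite -ler_pdivrMl ?divr_gt0//; apply/ler_addgt0Pr => e e0.
have [|x0 [x1 [r0 [r1 [<- E0 E1 [p0 p1] L1]]]]] := @kf_decomp s v (kf s v + e) s0.
  by rewrite ltrDl.
apply: le_trans (ltW L1); rewrite ler_pdivrMl ?divr_gt0//.
apply: le_trans (@kf_le t _ _ r0 r1 t0 _ _) _; rewrite ?E0 ?E1//.
rewrite mulrDr mulrA divfK ?gt_eqF// lerD2r.
exact: ler_peMl.
Qed.

Lemma kf_max1 t v : 0 < t -> kf t v <= Num.max 1 t * kf 1 v.
Proof.
move=> t0; have [t1|t1] := leP t 1.
  by rewrite mul1r; exact: kf_mono.
by have := @kf_ratio 1 t v ltr01 (ltW t1); rewrite divr1.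
Qed.

Lemma kf1_max t v : 0 < t -> kf 1 v <= Num.max 1 t^-1 * kf t v.
Proof.
move=> t0; have [t1|t1] := leP t 1.
  rewrite max_r ?invf_ge1//; have := @kf_ratio t 1 v t0 t1.
  by rewrite div1r.
rewrite max_l ?invf_le1 ?(ltW t1)// mul1r; apply: kf_mono => //; exact: ltW.
Qed.

Lemma kf1_eq0 v : kf 1 v = 0 -> v = 0.
Proof.
by move=> H; have [_ _ _] := hX; apply; rewrite KfunE// H.
Qed.

Lemma kf1_le_eps v : (forall e, 0 < e -> kf 1 v <= e) -> v = 0.
Proof.
move=> H; apply: kf1_eq0; apply/eqP; rewrite eq_le kf_ge0// andbT.
by apply/ler_addgt0Pr => e e0; rewrite add0r; exact: H.
Qed.

(** Near-optimal decompositions of the increments give two geometrically dominated series, one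
    summable in [X0] and one in [X1]. *)
Lemma couple_complete (v : nat -> V) (c q : R) : 0 < q < 1 -> 0 <= c ->
  (forall n, kf 1 (v n.+1 - v n) <= c * q ^+ n) ->
  exists l, forall e, 0 < e -> exists M : nat, forall n, (M <= n)%N -> kf 1 (v n - l) < e.
Proof.
move=> q01 c0 Hv; have /andP[q0 q1] := q01.
(* [c + 1] leaves the strict room that [kf_decomp] requires, even when [c = 0]. *)
have dec n : exists ab : V * V, [/\ ab.1 + ab.2 = v n.+1 - v n,
    (N0 ab.1 <= ((c + 1) * q ^+ n)%:E)%E & (N1 ab.2 <= ((c + 1) * q ^+ n)%:E)%E].
  have [|x0 [x1 [r0 [r1 [xE E0 E1 [p0 p1] L1]]]]] :=
      @kf_decomp 1 (v n.+1 - v n) ((c + 1) * q ^+ n) ltr01.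
    by apply: le_lt_trans (Hv n) _; rewrite mulrDl mul1r ltrDl exprn_gt0.
  exists (x0, x1); split => //=; rewrite ?E0 ?E1 lee_fin.
    by clear -L1 p1; lra.
  by clear -L1 p0; lra.
have [ab Hab] := choice dec.
have [_ [c0' c1'] _ _] := hX.
have cc : 0 <= c + 1 by rewrite addr_ge0.
have [|x [_ Hx]] := @en_series_cvg _ _ N0 h0 (fun n => (ab n).1) (c + 1) q c0' q01 cc.
  by move=> n; have [] := Hab n.
have [|y [_ Hy]] := @en_series_cvg _ _ N1 h1 (fun n => (ab n).2) (c + 1) q c1' q01 cc.
  by move=> n; have [] := Hab n.
exists (v 0%N + x + y) => e e0.
have e2 : 0 < e / 2 by rewrite divr_gt0.
have [M1 H1] := Hx _ e2; have [M2 H2] := Hy _ e2.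
exists (maxn M1 M2) => n; rewrite geq_max => /andP[/H1 K1 /H2 K2].
have vE : v n = v 0%N + (\sum_(i < n) (ab i).1 + \sum_(i < n) (ab i).2).
  elim: n {K1 K2} => [|n IH]; first by rewrite !big_ord0 !addr0.
  rewrite !big_ord_recr/= addrACA; have [-> _ _] := Hab n.
  by rewrite addrA -IH subrKC.
have -> : v n - (v 0%N + x + y) =
    (\sum_(i < n) (ab i).1 - x) + (\sum_(i < n) (ab i).2 - y).
  by rewrite vE; lincomb_goal (R[i]) V; ring.
have [r0 _ E0] := en_fin h0 (lt_trans K1 (ltry _)).
have [r1 _ E1] := en_fin h1 (lt_trans K2 (ltry _)).
move: K1 K2; rewrite E0 E1 !lte_fin => K1 K2.
apply: le_lt_trans (@kf_le 1 _ _ r0 r1 ltr01 _ _) _; rewrite ?E0 ?E1//.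
by clear -K1 K2; lra.
Qed.

End Couple.

(** * Removable singularities *)

Section ComplexExponential.
Context {R : realType}.
Local Notation C := R[i].
Local Notation hc := (seminorm_cabs R).

Definition cexp (z : C) : C :=
  Complex (expR (cRe z) * cos (cIm z))
          (expR (cRe z) * sin (cIm z)).

Lemma cexpD z w : cexp (z + w) = cexp z * cexp w.
Proof.
rewrite /cexp cReD cImD expRD cosD sinD.
by congr Complex; rewrite /=; ring.
Qed.

Lemma cabs_cexp z : cabs (cexp z) = expR (cRe z).
Proof.
rewrite /cabs /cexp/= !exprMn -mulrDr cos2Dsin2 mulr1 sqrtr_sqr.
by rewrite ger0_norm// expR_ge0.
Qed.

Lemma derive_eps (f : R -> R) (x df : R) : is_derive x 1 f df ->
  forall e, 0 < e -> exists2 d, 0 < d & forall h, `|h| < d ->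
    `|f (x + h) - f x - df * h| <= e * `|h|.
Proof.
move=> [dv dE] e e0.
have : h^-1 *: ((f \o shift x) (h *: 1) - f x) @[h --> (0:R)^'] --> df.
  by rewrite -dE; exact: dv.
move=> /cvgrPdist_lt/(_ _ e0)[d /= d0 H]; exists d => // h hd.
have [->|h0] := eqVneq h 0; first by rewrite addr0 subrr mulr0 subrr normr0 mulr0.
have := H h; rewrite /= sub0r normrN => /(_ hd h0).
rewrite /GRing.scale/= mulr1 => /ltW He.
have -> : f (x + h) - f x - df * h = (h^-1 * (f (h + x) - f x) - df) * h.
  by rewrite (addrC h x); field.
by rewrite normrM distrC ler_wpM2r.
Qed.

(** The functional equation reduces the claim to the point [0], where the real derivatives of
    [expR], [cos] and [sin] are combined. *)
Lemma cdiff_cexp z : cdiff cexp z.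
Proof.
suff H0 : forall e, 0 < e -> exists2 d, 0 < d & forall h, cabs h < d ->
    cabs (cexp h - 1 - h) <= e * cabs h.
  exists (cexp z) => e e0.
  have K0 : 0 < cabs (cexp z) by rewrite cabs_cexp expR_gt0.
  have e1 : 0 < e / cabs (cexp z) by rewrite divr_gt0.
  have [d d0 H] := H0 _ e1; exists d; split => // h /H {}H.
  have -> : cexp (z + h) - cexp z - h *: (cexp z : C^o) = cexp z * (cexp h - 1 - h).
    by rewrite cexpD -[h *: _]/(h * cexp z); ring.
  rewrite cabsM mulrC -ler_pdivlMr//; apply: le_trans H _; apply: eq_ler.
  by ring.
(* The remainder collects errors of total size at most [6 e1 |h|]; [e1 <= 1] also gives
   [expR x <= 2]. *)
move=> e e0; pose e1 := Num.min 1 (e / 8).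
have e10 : 0 < e1 by rewrite lt_min ltr01 divr_gt0.
have [d1 d10 H1] := derive_eps (is_derive_expR (0:R)) e10.
have [d2 d20 H2] := derive_eps (is_derive_cos (0:R)) e10.
have [d3 d30 H3] := derive_eps (is_derive_sin (0:R)) e10.
exists (Num.min (Num.min d1 d2) (Num.min d3 (e1 / 2))).
  by rewrite !lt_min d10 d20 d30 divr_gt0.
move=> h; rewrite !lt_min => /andP[/andP[c1 c2] /andP[c3 c4]].
set x := cRe h; set y := cIm h.
have xh : `|x| <= cabs h := Re_le_cabs h.
have yh : `|y| <= cabs h := Im_le_cabs h.
have := H1 x (le_lt_trans xh c1); have := H2 y (le_lt_trans yh c2).
have := H3 y (le_lt_trans yh c3).
rewrite !add0r expR0 cos0 sin0 oppr0 !mul1r mul0r !subr0 ?addr0.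
set X := expR x - 1 - x; set c := cos y - 1; set s := sin y - y => s1 k1 X1.
have e1le : e1 <= 1 by rewrite /e1 ge_min lexx.
have e8 : e1 <= e / 8 by rewrite /e1 ge_min lexx orbT.
have h0 := cabs_ge0 h.
have X2 : `|X| <= e1 * cabs h by apply: le_trans X1 _; rewrite ler_wpM2l ?(ltW e10).
have k2 : `|c| <= e1 * cabs h by apply: le_trans k1 _; rewrite ler_wpM2l ?(ltW e10).
have s2 : `|s| <= e1 * cabs h by apply: le_trans s1 _; rewrite ler_wpM2l ?(ltW e10).
have ex1 : `|expR x - 1| <= e1.
  have -> : expR x - 1 = X + x by rewrite /X subrK.
  apply: le_trans (ler_normD _ _) _.
  have : e1 * cabs h <= cabs h by rewrite ler_piMl.
  by clear -X2 xh c4 => ?; lra.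
have ex2 : `|expR x| <= 2.
  have := ler_normD (expR x - 1) 1; rewrite subrK normr1.
  by clear -ex1 e1le => ?; lra.
apply: le_trans (cabs_le_ReIm _) _; rewrite !cReB !cImB /= -/x -/y subr0.
have -> : expR x * cos y - 1 - x = expR x * c + X by rewrite /c /X; ring.
have -> : expR x * sin y - y = expR x * s + (expR x - 1) * y by rewrite /s; ring.
apply: le_trans (lerD (ler_normD _ _) (ler_normD _ _)) _; rewrite !normrM.
have p1 : `|expR x| * `|c| <= 2 * (e1 * cabs h) by exact: ler_pM.
have p2 : `|expR x| * `|s| <= 2 * (e1 * cabs h) by exact: ler_pM.
have p3 : `|expR x - 1| * `|y| <= e1 * cabs h by exact: ler_pM.
have p4 : e1 * cabs h <= e / 8 * cabs h by rewrite ler_wpM2r.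
have p5 : 0 <= e * cabs h by rewrite mulr_ge0 ?(ltW e0).
by clear -p1 p2 p3 p4 p5 X2; lra.
Qed.

Lemma vdiff_comp (V : lmodType C) (p : V -> R) (hp : seminorm p) (f : C -> V)
    (g : C -> C) z :
  cdiff g z -> vdiff p f (g z) -> vdiff p (fun w => f (g w)) z.
Proof.
move=> dg [f' Hf]; have cg := vdiff_cont hc (fun=> True) dg.
have [g' Hg] := dg; exists (g' *: f') => e e0.
set K := cabs g' + 1; have K0 : 0 < K by rewrite ltr_wpDl ?cabs_ge0.
set L := p f' + 1; have L0 : 0 < L by rewrite ltr_wpDl ?sn_ge0.
have e1 : 0 < e / 2 / K by rewrite !divr_gt0.
have e2 : 0 < Num.min 1 (e / 2 / L) by rewrite lt_min ltr01 !divr_gt0.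
have [d1 [d10 H1]] := Hf _ e1; have [d2 [d20 H2]] := Hg _ e2.
have [d3 [d30 H3]] := cg _ d10.
exists (Num.min d2 d3); split; first by rewrite lt_min d20.
move=> h; rewrite lt_min => /andP[/H2 h2 h3].
have zh : z + h - z = h by rewrite addrAC subrr add0r.
have := H3 (z + h) I; rewrite zh => /(_ h3) {}h3.
set k := g (z + h) - g z in h2 h3.
have h0 := cabs_ge0 h.
have h2' : cabs (k - h * g') <= cabs h.
  by apply: le_trans h2 _; apply: ler_piMl => //; rewrite ge_min lexx.
have h2'' : cabs (k - h * g') <= e / 2 / L * cabs h.
  by apply: le_trans h2 _; rewrite ler_wpM2r// ge_min lexx orbT.
have kK : cabs k <= K * cabs h.
  rewrite -[k](subrK (h * g')); apply: le_trans (cabsD _ _) _.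
  by rewrite cabsM /K mulrDl mul1r addrC lerD// mulrC.
have := H1 k h3; have -> : g z + k = g (z + h) by rewrite /k subrKC.
move=> Hk.
have -> : f (g (z + h)) - f (g z) - h *: (g' *: f') =
    (f (g (z + h)) - f (g z) - k *: f') + (k - h * g') *: f'.
  by lincomb_goal (R[i]) V; ring.
apply: le_trans (snD hp _ _) _; rewrite (snZ hp).
have -> : e * cabs h = e / 2 / K * (K * cabs h) + e / 2 / L * cabs h * L.
  by field; rewrite !gt_eqF.
apply: lerD; first by apply: le_trans Hk _; rewrite ler_wpM2l ?(ltW e1).
by apply: ler_pM; rewrite ?cabs_ge0 ?(sn_ge0 hp)// lerDl.
Qed.

End ComplexExponential.

Section RemovableSingularity.
Context {R : realType} {V : lmodType R[i]}.
Local Notation C := R[i].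
Context (p : V -> R) (hp : seminorm p).

(** The point [e] is left out, as the quotients below take a meaningless value there
    ([0^-1 = 0]). *)
Definition bounded_near (D : C -> Prop) (g : C -> V) (e : C) : Prop :=
  exists dl M : R, 0 < dl /\ forall z, D z -> z != e -> cabs (z - e) < dl -> p (g z) <= M.

Lemma vdiff_bounded_quotient D (g : C -> V) k : vdiff p g k ->
  bounded_near D (fun z => (z - k)^-1 *: (g z - g k)) k.
Proof.
move=> [g' /(_ 1 ltr01)[d [d0 H]]]; exists d, (p g' + 1); split => // z _ zk zd.
have := H _ zd; rewrite subrKC mul1r => Hz.
rewrite (snZ hp) cabsV ler_pdivrMl ?cabs_gt0 ?subr_eq0//.
have -> : g z - g k = (z - k) *: g' + (g z - g k - (z - k) *: g') by rewrite subrKC.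
by apply: le_trans (snD hp _ _) _; rewrite (snZ hp) mulrDr mulr1 lerD2l.
Qed.

Lemma bounded_near_quotient D (g : C -> V) v e k : e != k -> bounded_near D g e ->
  bounded_near D (fun z => (z - k)^-1 *: (g z - v)) e.
Proof.
move=> ek [dl [M [dl0 H]]].
have n0 : 0 < cabs (e - k) by rewrite cabs_gt0 subr_eq0.
exists (Num.min dl (cabs (e - k) / 2)), ((cabs (e - k) / 2)^-1 * (M + p v)).
split; first by rewrite lt_min dl0 divr_gt0.
move=> z Dz ze; rewrite lt_min => /andP[/(H z Dz ze) gz zd].
have zk : cabs (e - k) / 2 <= cabs (z - k).
  have := cabs_triB (e - k) (e - z).
  rewrite (_ : e - k - (e - z) = z - k) ?(cabsB e z); last by ring.
  by clear -zd => ?; lra.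
rewrite (snZ hp) cabsV; apply: ler_pM; rewrite ?invr_ge0 ?cabs_ge0 ?(sn_ge0 hp)//.
  by rewrite lef_pV2 ?posrE ?divr_gt0//; apply: lt_le_trans zk; rewrite divr_gt0.
by apply: le_trans (snB hp _ _) _; rewrite lerD2r.
Qed.

Lemma vdiff_quotient (g : C -> V) v k z : z != k -> vdiff p g z ->
  vdiff p (fun z => (z - k)^-1 *: (g z - v)) z.
Proof.
move=> zk dg; apply: (vdiffZ hp); first exact: cdiff_inv.
by apply: (vdiffD hp) => //; exact: vdiff_cst.
Qed.

(** Completeness along geometric sequences, the form in which [couple_complete] provides it for
    [K(1, .)]. *)
Definition geometrically_complete : Prop := forall (v : nat -> V) (c q : R),
  0 < q < 1 -> 0 <= c -> (forall n, p (v n.+1 - v n) <= c * q ^+ n) ->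
  exists l, forall e, 0 < e -> exists M : nat, forall n, (M <= n)%N -> p (v n - l) < e.

(* The second divided differences of [q = f / (z - z0)] are bounded near [z0]
   by the maximum principle, so its first ones at [z0] are Cauchy. *)
Lemma vdiff_division (f : C -> V) (z0 : C) (d : V) (r Mf : R) :
  geometrically_complete -> 0 < r -> f z0 = 0 ->
  let Q := inrect (cRe z0 - r) (cRe z0 + r)
                  (cIm z0 - r) (cIm z0 + r) in
  (forall z, Q z -> vdiff p f z) -> (forall z, Q z -> p (f z) <= Mf) ->
  (forall e, 0 < e -> exists dl, 0 < dl /\
     forall h, cabs h < dl -> p (f (z0 + h) - h *: d) <= e * cabs h) ->
  vdiff p (fun z => if z == z0 then d else (z - z0)^-1 *: f z) z0.
Proof.
move=> hcomp r0 fz0 Q df fM fd.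
set a := cRe z0 - r in Q df fM; set b := cRe z0 + r in Q df fM.
set c := cIm z0 - r in Q df fM; set c' := cIm z0 + r in Q df fM.
pose q z := (z - z0)^-1 *: f z.
have Qz0 : Q z0 by split; apply/andP; split; rewrite /a /b /c /c'; clear -r0; lra.
have Mf0 : 0 <= Mf by apply: le_trans (fM _ Qz0); exact: sn_ge0.
have intr z : cabs (z - z0) < r -> intrect a b c c' z.
  move=> zr; have := Re_le_cabs (z - z0); have := Im_le_cabs (z - z0).
  rewrite cReB cImB !ler_norml => /andP[? ?] /andP[? ?].
  by split; apply/andP; split; rewrite /a /b /c /c'; lra.
have bdr z : bdrect a b c c' z -> r <= cabs (z - z0).
  have rr : `|r| = r by rewrite gtr0_norm.
  by move=> [_ [|[|[|]]]] zE; [apply: le_trans (Re_le_cabs _)|apply: le_trans (Re_le_cabs _)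
   |apply: le_trans (Im_le_cabs _)|apply: le_trans (Im_le_cabs _)];
   rewrite ?cReB ?cImB zE /a /b /c /c' -[leLHS]rr; [rewrite -normrN| |rewrite -normrN|];
   apply: eq_ler; congr `| _ |; ring.
have bdrk z k : cabs (k - z0) < r / 2 -> bdrect a b c c' z -> r / 2 <= cabs (z - k).
  move=> kr /bdr zr; have := cabs_triB (z - z0) (k - z0).
  rewrite (_ : z - z0 - (k - z0) = z - k); last by ring.
  by clear -kr zr => ?; lra.
have dq z : Q z -> z != z0 -> vdiff p q z.
  by move=> zQ zz; apply: (vdiffZ hp); [exact: cdiff_inv|exact: df].
pose M1 := Mf / r.
have M10 : 0 <= M1 by rewrite divr_ge0// ltW.
have q_bd z : bdrect a b c c' z -> p (q z) <= M1.
  move=> zb; have zr := bdr _ zb; have zQ := proj1 zb.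
  rewrite (snZ hp) cabsV mulrC; apply: ler_pM; rewrite ?invr_ge0 ?cabs_ge0 ?(sn_ge0 hp)//.
    exact: fM.
  by rewrite lef_pV2 ?posrE//; exact: lt_le_trans zr.
have q_near : bounded_near Q q z0.
  have := vdiff_bounded_quotient Q (df _ Qz0); rewrite fz0.
  by move=> [dl [M [dl0 H]]]; exists dl, M; split => // z zQ zz zd;
     have := H z zQ zz zd; rewrite subr0.
have q_bnd z : intrect a b c c' z -> z != z0 -> p (q z) <= M1.
  move=> zI zz; apply: (max_principle hp (E := [:: z0]) zI) => //.
  - by rewrite inE.
  - by move=> w wI; rewrite inE => wz; apply: dq => //; exact: intrect_sub.
  - by move=> w wI; rewrite inE => wz; apply: vdiff_cont => //; exact: dq.
  - by move=> e; rewrite inE => /eqP ->.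
have Qk k : cabs (k - z0) < r / 2 -> Q k.
  by move=> kr; apply: intrect_sub; apply: intr; clear -kr r0; lra.
(* Each further divided difference adds a bounded singularity at its node; its boundary bound uses
   [|z - k| >= r / 2], so it is uniform over the nodes in the disc of radius [r / 2]. *)
pose q1 k z := (z - k)^-1 *: (q z - q k).
pose M2 := (M1 + M1) / (r / 2).
have M20 : 0 <= M2 by rewrite divr_ge0 ?addr_ge0// divr_ge0// ltW.
have in_k k : cabs (k - z0) < r / 2 -> k != z0 -> p (q k) <= M1.
  by move=> kr kz; apply: q_bnd => //; apply: intr; clear -kr r0; lra.
have dq1 k z : Q z -> z != z0 -> z != k -> vdiff p (q1 k) z.
  by move=> zQ zz zk; apply: vdiff_quotient => //; exact: dq.
have q1_bd k z : cabs (k - z0) < r / 2 -> k != z0 -> bdrect a b c c' z -> p (q1 k z) <= M2.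
  move=> kr kz zb; have zk := bdrk z k kr zb.
  have r2 : 0 < r / 2 by rewrite divr_gt0.
  rewrite (snZ hp) cabsV mulrC; apply: ler_pM; rewrite ?invr_ge0 ?cabs_ge0 ?(sn_ge0 hp)//.
    by apply: le_trans (snB hp _ _) _; apply: lerD; [exact: q_bd|exact: in_k].
  by rewrite lef_pV2 ?posrE//; exact: lt_le_trans zk.
have q1_bnd k z : cabs (k - z0) < r / 2 -> k != z0 -> intrect a b c c' z ->
    z != z0 -> z != k -> p (q1 k z) <= M2.
  move=> kr kz zI zz zk; apply: (max_principle hp (E := [:: z0; k]) zI) => //.
  - by rewrite !inE negb_or zz.
  - by move=> w wI; rewrite !inE negb_or => /andP[wz wk]; apply: dq1 => //; exact: intrect_sub.
  - by move=> w wI; rewrite !inE negb_or => /andP[wz wk]; apply: vdiff_cont => //; exact: dq1.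
  - move=> e; rewrite !inE => /orP[/eqP ->|/eqP ->].
      by apply: bounded_near_quotient => //; rewrite eq_sym.
    by apply: vdiff_bounded_quotient; apply: dq => //; exact: Qk.
  - by move=> w wb; exact: q1_bd.
have q1_near k e : cabs (k - z0) < r / 2 -> k != z0 -> cabs (e - z0) < r / 2 ->
    e = z0 \/ e = k -> bounded_near Q (q1 k) e.
  move=> kr kz er [->|->].
    by apply: bounded_near_quotient => //; rewrite eq_sym.
  by apply: vdiff_bounded_quotient; apply: dq => //; exact: Qk.
pose M3 := (M2 + M2) / (r / 2).
have M30 : 0 <= M3 by rewrite divr_ge0 ?addr_ge0// divr_ge0// ltW.
have q2_bnd k1 k2 z : cabs (k1 - z0) < r / 2 -> k1 != z0 ->
    cabs (k2 - z0) < r / 2 -> k2 != z0 -> k1 != k2 ->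
    intrect a b c c' z -> z != z0 -> z != k1 -> z != k2 ->
    p ((z - k2)^-1 *: (q1 k1 z - q1 k1 k2)) <= M3.
  move=> k1r k1z k2r k2z k12 zI zz zk1 zk2.
  have k21 : k2 != k1 by rewrite eq_sym.
  have z00 : cabs (z0 - z0) < r / 2 by rewrite subrr cabs0 divr_gt0.
  have dk w : Q w -> w != z0 -> w != k1 -> w != k2 ->
      vdiff p (fun z => (z - k2)^-1 *: (q1 k1 z - q1 k1 k2)) w.
    by move=> wQ w0 w1 w2; apply: vdiff_quotient => //; exact: dq1.
  apply: (max_principle hp (E := [:: z0; k1; k2])
    (f := fun z => (z - k2)^-1 *: (q1 k1 z - q1 k1 k2)) zI) => //.
  - by rewrite !inE !negb_or zz zk1.
  - move=> w wI; rewrite !inE !negb_or => /and3P[? ? ?]; apply: dk => //; exact: intrect_sub.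
  - by move=> w wI; rewrite !inE !negb_or => /and3P[? ? ?]; apply: vdiff_cont => //; exact: dk.
  - move=> e; rewrite !inE => /or3P[/eqP ->|/eqP ->|/eqP ->].
    + by apply: bounded_near_quotient; [rewrite eq_sym|apply: q1_near => //; left].
    + by apply: bounded_near_quotient => //; apply: q1_near => //; right.
    + by apply: vdiff_bounded_quotient; apply: dq1 => //; exact: Qk.
  - move=> w wb; have wk := bdrk w k2 k2r wb.
    have r2 : 0 < r / 2 by rewrite divr_gt0.
    rewrite (snZ hp) cabsV mulrC; apply: ler_pM; rewrite ?invr_ge0 ?cabs_ge0 ?(sn_ge0 hp)//.
      apply: le_trans (snB hp _ _) _; apply: lerD; first exact: q1_bd.
      by apply: q1_bnd => //; apply: intr; clear -k2r r0; lra.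
    by rewrite lef_pV2 ?posrE//; exact: lt_le_trans wk.
(* The limit of [q1 k z] as [z -> z0]: the divided difference between [z0] and [k] of the function
   with value [d] at [z0]. *)
pose D k := (z0 - k)^-1 *: (d - q k).
have qlim e : 0 < e -> exists2 dl, 0 < dl & forall h, h != 0 -> cabs h < dl ->
    p (q (z0 + h) - d) <= e.
  move=> /fd[dl [dl0 H]]; exists dl => // h h0 /H hh.
  have -> : q (z0 + h) - d = h^-1 *: (f (z0 + h) - h *: d).
    rewrite /q addrAC subrr add0r scalerBr scalerA mulVf// scale1r//.
  by rewrite (snZ hp) cabsV ler_pdivrMl ?cabs_gt0// mulrC.
have D_lip k1 k2 : cabs (k1 - z0) < r / 2 -> k1 != z0 ->
    cabs (k2 - z0) < r / 2 -> k2 != z0 -> k1 != k2 ->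
    p (D k1 - D k2) <= M3 * cabs (k1 - k2).
  move=> k1r k1z k2r k2z k12.
  have n1 : 0 < cabs (k1 - z0) by rewrite cabs_gt0 subr_eq0.
  have n2 : 0 < cabs (k2 - z0) by rewrite cabs_gt0 subr_eq0.
  apply/ler_addgt0Pr => e e0.
  (* The total coefficient of [e / K] in the two bounds [L] below, for replacing [D k] by [q1 k z]
     at a point [z] close to [z0]. *)
  pose K := 2 / cabs (k1 - z0) + 2 / cabs (k2 - z0) + (2 / cabs (k1 - z0)) *
     (p (d - q k1) / cabs (k1 - z0)) + (2 / cabs (k2 - z0)) * (p (d - q k2) / cabs (k2 - z0)).
  have K0 : 0 < K.
    rewrite /K; do 2![apply: ltr_wpDr;
      first by rewrite !mulr_ge0 ?invr_ge0 ?cabs_ge0 ?(sn_ge0 hp)].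
    by rewrite addr_gt0 ?divr_gt0.
  have eK : 0 < e / K by rewrite divr_gt0.
  have [dl dl0 Hq] := qlim _ eK.
  pose m := Num.min (Num.min dl (e / K)) (Num.min (Num.min (cabs (k1 - z0)) (cabs (k2 - z0))) r) / 2.
  have m2 : 0 < m * 2 by rewrite divfK// !lt_min dl0 n1 n2 r0 eK.
  have : [/\ m * 2 <= dl, m * 2 <= e / K, m * 2 <= cabs (k1 - z0), m * 2 <= cabs (k2 - z0) & m * 2 <= r].
    by rewrite divfK// !ge_min !lexx !orbT.
  move=> [m3 mK m4 m5 m6]; have m0 : 0 < m by clear -m2; lra.
  pose h : C := Complex m 0; pose z := z0 + h.
  have hm : cabs h = m by rewrite cabs_real gtr0_norm.
  have h0 : h != 0 by rewrite -cabs_gt0 hm.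
  have zh : z - z0 = h by rewrite /z addrAC subrr add0r.
  have zk k : m * 2 <= cabs (k - z0) -> cabs (k - z0) / 2 <= cabs (z - k) /\ z != k.
    move=> mk; have : cabs (k - z0) / 2 <= cabs (z - k).
      have := cabs_triB (k - z0) (z - z0); rewrite (_ : k - z0 - (z - z0) = k - z); last by ring.
      by rewrite (cabsB k z) zh hm; clear -mk => ?; lra.
    move=> H; split => //; rewrite -subr_eq0 -cabs_gt0; apply: lt_le_trans H.
    by clear -mk m0; lra.
  have [a1 zk1] := zk k1 m4; have [a2 zk2] := zk k2 m5.
  have zz : z != z0 by rewrite -subr_eq0 zh.
  have zI : intrect a b c c' z by apply: intr; rewrite zh hm; clear -m6 m0; lra.
  have k21 : k2 - k1 != 0 by rewrite subr_eq0 eq_sym.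
  (* By symmetry of divided differences, exchanging the node costs [k1 - k2] times a second
     difference, hence the Lipschitz constant [M3]. *)
  have E1 : q1 k1 z - q1 k2 z = (k1 - k2) *: ((z - k2)^-1 *: (q1 k1 z - q1 k1 k2)).
    have nA : z - k1 != 0 by rewrite subr_eq0.
    have nB : z - k2 != 0 by rewrite subr_eq0.
    by rewrite /q1; lincomb_goal (R[i]) V; field; rewrite ?nA ?nB ?k21.
  have L k : k != z0 -> m * 2 <= cabs (k - z0) -> p (D k - q1 k z) <=
      2 / cabs (k - z0) * (e / K) + 2 / cabs (k - z0) * (p (d - q k) / cabs (k - z0)) * (e / K).
    move=> kz mk; have [b1 b2] := zk k mk.
    have kp : 0 < cabs (k - z0) by rewrite cabs_gt0 subr_eq0.
    have zkn : z - k != 0 by rewrite subr_eq0.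
    have -> : D k - q1 k z = (z - k)^-1 *: (d - q z) + ((z - k)^-1 * (z0 - k)^-1 * h) *: (d - q k).
      have zkn' : z0 - k != 0 by rewrite subr_eq0 eq_sym.
      rewrite /D /q1 -zh; lincomb_goal (R[i]) V; field; rewrite ?zkn ?zkn'//.
    have inv2 : (cabs (z - k))^-1 <= 2 / cabs (k - z0).
      by rewrite -[leRHS]invrK invf_div lef_pV2 ?posrE ?divr_gt0// cabs_gt0.
    apply: le_trans (snD hp _ _) _; rewrite !(snZ hp) !cabsM !cabsV hm (cabsB z0 k).
    apply: lerD.
      apply: ler_pM; rewrite ?invr_ge0 ?cabs_ge0 ?(sn_ge0 hp)// (snBC hp).
      by apply: Hq => //; rewrite hm; clear -m3 m0; lra.
    have -> : 2 / cabs (k - z0) * (p (d - q k) / cabs (k - z0)) * (e / K) =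
      2 / cabs (k - z0) * (cabs (k - z0))^-1 * (e / K) * p (d - q k) by ring.
    apply: ler_wpM2r; first exact: sn_ge0.
    apply: ler_pM; rewrite ?(ltW m0) ?mulr_ge0 ?invr_ge0 ?cabs_ge0//.
      by rewrite ler_wpM2r ?invr_ge0 ?cabs_ge0.
    by clear -mK m0; lra.
  have -> : D k1 - D k2 = (q1 k1 z - q1 k2 z) + ((D k1 - q1 k1 z) - (D k2 - q1 k2 z)).
    by lincomb_goal (R[i]) V; ring.
  apply: le_trans (snD hp _ _) _; apply: lerD.
    rewrite E1 (snZ hp) mulrC ler_wpM2r ?cabs_ge0//; exact: q2_bnd.
  apply: le_trans (snB hp _ _) _; apply: le_trans (lerD (L _ k1z m4) (L _ k2z m5)) _.
  apply: eq_ler; transitivity (K * (e / K)); last by field; rewrite gt_eqF.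
  by rewrite /K; ring.
(* Dyadic points tending to [z0]: along them [D] has geometric increments. Its limit [L] is the
   derivative sought, since the remainder at [h] is [h (D (z0 + h) - L)]. *)
pose kn (n : nat) : C := z0 + Complex (r / 4 * 2^-1 ^+ n) 0.
have knz n : kn n - z0 = Complex (r / 4 * 2^-1 ^+ n) 0 by rewrite /kn addrAC subrr add0r.
have knp n : 0 < r / 4 * 2^-1 ^+ n by rewrite mulr_gt0 ?exprn_gt0 ?divr_gt0 ?invr_gt0.
have half01 : 0 < (2^-1 : R) < 1 by rewrite invr_gt0 invf_lt1 ?ltr1n ?ltr0n.
have pow1 n : (2^-1 : R) ^+ n <= 1.
  by apply: exprn_ile1; case/andP: half01 => /ltW ? /ltW ?.
have kn_r n : cabs (kn n - z0) < r / 2.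
  rewrite knz cabs_real gtr0_norm//; apply: le_lt_trans (_ : r / 4 < _).
    by apply: ler_piMr => //; rewrite divr_ge0// ltW.
  by clear -r0; lra.
have kn0 n : kn n != z0 by rewrite -subr_eq0 -cabs_gt0 knz cabs_real gtr0_norm.
have [||L HL] := hcomp (fun n => D (kn n)) (M3 * (r / 4)) 2^-1 half01.
- by rewrite mulr_ge0// divr_ge0// ltW.
- move=> n; have kk : kn n.+1 - kn n = Complex (- (r / 4 * 2^-1 ^+ n.+1)) 0.
    rewrite /kn opprD addrACA subrr add0r.
    by congr Complex; rewrite /= ?subr0// exprS; field.
  have kkc : cabs (kn n.+1 - kn n) = r / 4 * 2^-1 ^+ n.+1.
    by rewrite kk cabs_real normrN gtr0_norm.
  apply: le_trans (D_lip _ _ _ _ _ _ _) _ => //.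
    by rewrite -subr_eq0 -cabs_gt0 kkc.
  rewrite kkc mulrA; apply: ler_wpM2l; first by rewrite mulr_ge0// divr_ge0// ltW.
  by rewrite exprS ler_piMl ?exprn_ge0 ?invr_ge0// ltW//; case/andP: half01.
have DL k : k != z0 -> cabs (k - z0) < r / 2 -> p (D k - L) <= M3 * cabs (k - z0).
  move=> kz kr; apply/ler_addgt0Pr => e e0.
  have e2 : 0 < e / 2 by rewrite divr_gt0.
  have [M HM] := HL _ e2.
  have [n0' Hn0] := @lt_half_pow R (M3 * (r / 4)) _ e2.
  pose n := maxn M n0'.
  have knr : M3 * cabs (kn n - z0) <= e / 2.
    rewrite knz cabs_real gtr0_norm// mulrA; apply: le_trans (ltW Hn0).
    rewrite -exprVn; apply: ler_wpM2l; first by rewrite mulr_ge0// divr_ge0// ltW.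
    case/andP: half01 => hl0 hl1; apply: ler_wiXn2l; rewrite ?(ltW hl0) ?(ltW hl1)//.
    exact: leq_maxr.
  have [kE|kn1] := eqVneq k (kn n).
    rewrite kE; apply: le_trans (ltW (HM n (leq_maxl _ _))) _.
    have : 0 <= M3 * cabs (kn n - z0) by rewrite mulr_ge0 ?cabs_ge0.
    by clear -e0 => ?; lra.
  apply: le_trans (sn_tri hp (D (kn n)) _ _) _.
  apply: le_trans (lerD (D_lip _ _ kr kz (kn_r n) (kn0 n) kn1) (ltW (HM n (leq_maxl _ _)))) _.
  have : M3 * cabs (k - kn n) <= M3 * (cabs (k - z0) + cabs (kn n - z0)).
    rewrite ler_wpM2l//; have -> : k - kn n = (k - z0) - (kn n - z0) by ring.
    by apply: le_trans (cabsD _ _) _; rewrite cabsN.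
  by clear -knr; rewrite mulrDr => ?; lra.
exists L => e e0.
exists (Num.min (r / 2) (e / (M3 + 1))); split.
  by rewrite lt_min !divr_gt0// ltr_wpDl.
move=> h; rewrite lt_min => /andP[hr he]; rewrite eqxx.
have [->|h0] := eqVneq h 0.
  by rewrite addr0 eqxx subrr scale0r subrr (sn0 hp) cabs0 mulr0.
have zh : z0 + h - z0 = h by rewrite addrAC subrr add0r.
have zhz : z0 + h != z0 by rewrite -subr_eq0 zh.
rewrite (negbTE zhz).
have -> : (z0 + h - z0)^-1 *: f (z0 + h) - d - h *: L = h *: (D (z0 + h) - L).
  rewrite /D -/(q (z0 + h)) (_ : z0 - (z0 + h) = - h); last by ring.
  by lincomb_goal (R[i]) V; field.
rewrite (snZ hp) mulrC ler_wpM2r ?cabs_ge0//.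
apply: le_trans (DL _ zhz _) _; rewrite zh//.
move: he; rewrite ltr_pdivlMr ?ltr_wpDl// => /ltW; apply: le_trans.
by rewrite mulrC ler_wpM2l ?cabs_ge0// lerDl.
Qed.

End RemovableSingularity.

(** * The Calderon space *)

Section Admissible.
Context {R : realType} {V : lmodType R[i]}.
Local Notation C := R[i].
Local Notation hc := (seminorm_cabs R).
Context (N0 N1 : V -> \bar R) (hX : is_couple N0 N1).
Local Notation K := (kf N0 N1).

Let p1 : seminorm (K 1). Proof. exact: (kf_seminorm hX ltr01). Qed.
Let h0 : is_enorm N0. Proof. by case: hX => -[]. Qed.
Let h1 : is_enorm N1. Proof. by case: hX => -[]. Qed.

Definition strip (z : C) : Prop := 0 <= cRe z <= 1.
Definition ostrip (z : C) : Prop := 0 < cRe z < 1.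
Definition line (j : bool) (t : R) : C := Complex j%:R t.
Definition endnorm (j : bool) : V -> \bar R := if j then N1 else N0.

Lemma ostrip_sub z : ostrip z -> strip z.
Proof. by move=> /andP[/ltW ? /ltW ?]; apply/andP. Qed.

Lemma line_strip j t : strip (line j t).
Proof. by case: j; rewrite /strip /= lexx ler01. Qed.

Lemma lineB j s t : cabs (line j s - line j t) = `|s - t|.
Proof.
by rewrite -(cabs_imag (s - t)); congr cabs; congr Complex; rewrite /= subrr.
Qed.

Lemma endnorm_enorm j : is_enorm (endnorm j).
Proof. by case: j; [exact: h1|exact: h0]. Qed.

Definition bdcont (N : V -> \bar R) (F : R -> V) : Prop :=
  (exists M : R, forall t : R, (N (F t) <= M%:E)%E) /\
  (forall t e : R, 0 < e -> exists d : R, 0 < d /\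
     forall s : R, `|s - t| < d -> (N (F s - F t)%R < e%:E)%E).

(** [admissible] rewritten with the real seminorm [K 1], so that the calculus above applies. *)
Definition adm (f : C -> V) : Prop :=
  [/\ exists M : R, forall z, strip z -> K 1 (f z) <= M,
      forall z, strip z -> vcont (K 1) strip f z,
      forall z, ostrip z -> vdiff (K 1) f z &
      forall j : bool, bdcont (endnorm j) (fun t => f (line j t))].

Lemma admP f : admissible N0 N1 f <-> adm f.
Proof.
split=> -[[M HM] cf df bf]; split.
- by exists M => z /HM; rewrite KfunE// lee_fin.
- move=> z zS e e0; have [d [d0 H]] := cf z zS e e0; exists d; split => // w wS wz.
  by have := H w wS wz; rewrite KfunE// lte_fin.
- move=> z /df[f' H]; exists f' => e e0; have [d [d0 Hd]] := H e e0.
  exists d; split => // h hd; have [->|hn] := eqVneq h 0.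
    by rewrite addr0 scale0r !subrr (sn0 p1) cabs0 mulr0.
  have := Hd h hn hd; rewrite KfunE// lte_fin => /ltW He.
  have -> : f (z + h) - f z - h *: f' = h *: (h^-1 *: (f (z + h) - f z) - f').
    by rewrite scalerBr scalerA mulfV// scale1r.
  by rewrite (snZ p1) mulrC ler_wpM2r ?cabs_ge0.
- by move=> j; have := bf j; case: j.
- by exists M => z /HM; rewrite KfunE// lee_fin.
- move=> z zS e e0; have [d [d0 H]] := cf z zS e e0; exists d; split => // w wS wz.
  by rewrite KfunE// lte_fin; exact: H.
- move=> z /df[f' H]; exists f' => e e0; have e2 : 0 < e / 2 by rewrite divr_gt0.
  have [d [d0 Hd]] := H _ e2; exists d; split => // h hn hd.
  rewrite KfunE// lte_fin; apply: le_lt_trans (_ : e / 2 < _); last by lra.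
  have -> : h^-1 *: (f (z + h) - f z) - f' = h^-1 *: (f (z + h) - f z - h *: f').
    by rewrite [RHS]scalerBr scalerA mulVf// scale1r.
  by rewrite (snZ p1) cabsV ler_pdivrMl ?cabs_gt0// mulrC Hd.
- by move=> j; have := bf j; case: j.
Qed.

Definition Fbound (f : C -> V) (A : R) : Prop :=
  forall j t, (endnorm j (f (line j t)) <= A%:E)%E.

Lemma Fbound_ge0 f A : Fbound f A -> 0 <= A.
Proof. by move=> /(_ true 0); apply: en_bound_ge0; exact: endnorm_enorm. Qed.

Lemma Fbound_Fnorm f A : (Fnorm N0 N1 f <= A%:E)%E <-> Fbound f A.
Proof.
rewrite /Fnorm ge_max; split=> [/andP[b0 b1] j t|H].
  case: j; [apply: le_trans b1|apply: le_trans b0]; apply: ereal_sup_ubound; by exists t.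
apply/andP; split; apply: ge_ereal_sup => _ [t _ <-]; [exact: (H false t)|exact: (H true t)].
Qed.

Lemma adm_Fbound f : adm f -> exists A, Fbound f A.
Proof.
move=> [_ _ _ b]; have [[M0 H0] _] := b false; have [[M1 H1] _] := b true.
exists (Num.max M0 M1) => -[] t.
  by apply: le_trans (H1 t) _; rewrite lee_fin le_max lexx orbT.
by apply: le_trans (H0 t) _; rewrite lee_fin le_max lexx.
Qed.

Lemma cinterp_le f A theta x : adm f -> Fbound f A -> f (Complex theta 0) = x ->
  (cinterp N0 N1 theta x <= A%:E)%E.
Proof.
move=> af bf fx; apply: (@le_trans _ _ (Fnorm N0 N1 f)); last exact/Fbound_Fnorm.
by apply: ereal_inf_lbound; exists f => //; split => //; apply/admP.
Qed.

Lemma cinterp_fin f theta x : adm f -> f (Complex theta 0) = x ->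
  (cinterp N0 N1 theta x < +oo)%E.
Proof.
move=> af fx; have [A HA] := adm_Fbound af.
by apply: le_lt_trans (cinterp_le af HA fx) _; rewrite ltry.
Qed.

Lemma cinterp_lt theta x A : (cinterp N0 N1 theta x < A%:E)%E ->
  exists f, [/\ adm f, Fbound f A & f (Complex theta 0) = x].
Proof.
move=> /ereal_inf_lt[_ [f [/admP af fx] <-] /ltW fA].
by exists f; split => //; apply/Fbound_Fnorm.
Qed.

Lemma cinterp_finP theta x : (cinterp N0 N1 theta x < +oo)%E ->
  exists2 f, adm f & f (Complex theta 0) = x.
Proof.
by move=> /ereal_inf_lt[_ [f [/admP af fx] _] _]; exists f.
Qed.

Lemma bdcont_mul N (a : R -> C) (F : R -> V) B : is_enorm N ->
  (forall t, cabs (a t) <= B) ->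
  (forall t e, 0 < e -> exists d, 0 < d /\ forall s, `|s - t| < d -> cabs (a s - a t) < e) ->
  bdcont N F -> bdcont N (fun t => a t *: F t).
Proof.
move=> hN aB ac [[M HM] cF]; have B0 : 0 <= B by apply: le_trans (aB 0); exact: cabs_ge0.
have M0 : 0 <= M by exact: (en_bound_ge0 hN (HM 0)).
split.
  exists (B * M) => t; apply: le_trans (enZ hN _ (HM t)) _.
  by rewrite lee_fin ler_wpM2r.
move=> t e e0.
have e1 : 0 < e / 2 / (B + 1) by rewrite !divr_gt0// ltr_wpDl.
have e2 : 0 < e / 2 / (M + 1) by rewrite !divr_gt0// ltr_wpDl.
have [d1 [d10 H1]] := cF t _ e1; have [d2 [d20 H2]] := ac t _ e2.
exists (Num.min d1 d2); split; first by rewrite lt_min d10.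
move=> s; rewrite lt_min => /andP[/H1 k1 /H2 k2].
have -> : a s *: F s - a t *: F t = a s *: (F s - F t) + (a s - a t) *: F t.
  by lincomb_goal (R[i]) V; ring.
apply: le_lt_trans (enD hN (enZ hN (a s) (ltW k1)) (enZ hN (a s - a t) (HM t))) _.
rewrite lte_fin.
have q1 : cabs (a s) * (e / 2 / (B + 1)) <= e / 2.
  rewrite mulrCA ler_piMr ?divr_ge0 ?(ltW e0)// ler_pdivrMr ?ltr_wpDl// mul1r.
  by apply: le_trans (aB s) _; rewrite lerDl.
have q2 : cabs (a s - a t) * M < e / 2.
  apply: le_lt_trans (_ : e / 2 / (M + 1) * M < _).
    by rewrite ler_wpM2r// ltW.
  by rewrite mulrAC ltr_pdivrMr ?ltr_wpDl// ltr_pM2l ?divr_gt0// ltrDl.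
by lra.
Qed.

Lemma bdcont_add N F G : is_enorm N -> bdcont N F -> bdcont N G ->
  bdcont N (fun t => F t + G t).
Proof.
move=> hN [[M HM] cF] [[M' HM'] cG]; split.
  by exists (M + M') => t; apply: enD.
move=> t e e0; have e2 : 0 < e / 2 by rewrite divr_gt0.
have [d1 [d10 H1]] := cF t _ e2; have [d2 [d20 H2]] := cG t _ e2.
exists (Num.min d1 d2); split; first by rewrite lt_min d10.
move=> s; rewrite lt_min => /andP[/H1 k1 /H2 k2].
rewrite opprD addrACA.
have [r1 _ E1] := en_fin hN (lt_trans k1 (ltry _)).
have [r2 _ E2] := en_fin hN (lt_trans k2 (ltry _)).
move: k1 k2; rewrite E1 E2 !lte_fin => k1 k2.
apply: le_lt_trans (enD hN (a := r1) (b := r2) _ _) _; rewrite ?E1 ?E2//.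
by rewrite lte_fin; lra.
Qed.

Lemma adm_mul (a : C -> C) f B : (forall z, strip z -> cabs (a z) <= B) ->
  (forall z, strip z -> ccont strip a z) -> (forall z, ostrip z -> cdiff a z) ->
  adm f -> adm (fun z => a z *: f z).
Proof.
move=> aB ca da [[M HM] cf df bf]; split.
- exists (B * M) => z zS; rewrite (snZ p1); apply: ler_pM; rewrite ?cabs_ge0 ?(sn_ge0 p1)//.
    exact: aB.
  exact: HM.
- by move=> z zS; apply: (vcontZ p1); [exact: ca|exact: cf].
- by move=> z zS; apply: (vdiffZ p1); [exact: da|exact: df].
- move=> j; apply: (bdcont_mul (a := fun t => a (line j t)) (B := B)) => //.
  + exact: endnorm_enorm.
  + by move=> t; apply: aB; exact: line_strip.
  move=> t e e0; have [d [d0 H]] := ca _ (line_strip j t) e e0.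
  by exists d; split => // s st; apply: H; [exact: line_strip|rewrite lineB].
Qed.

Lemma Fbound_mul (a : C -> C) f B A : (forall j t, cabs (a (line j t)) <= B) ->
  Fbound f A -> Fbound (fun z => a z *: f z) (B * A).
Proof.
move=> aB bf j t; apply: le_trans (enZ (endnorm_enorm j) _ (bf j t)) _.
by rewrite lee_fin ler_wpM2r// (Fbound_ge0 bf).
Qed.

Lemma adm_add f g : adm f -> adm g -> adm (fun z => f z + g z).
Proof.
move=> [[M HM] cf df bf] [[M' HM'] cg dg bg]; split.
- exists (M + M') => z zS; apply: le_trans (snD p1 _ _) _.
  by apply: lerD; [exact: HM|exact: HM'].
- by move=> z zS; apply: (vcontD p1); [exact: cf|exact: cg].
- by move=> z zS; apply: (vdiffD p1); [exact: df|exact: dg].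
- by move=> j; apply: bdcont_add => //; exact: endnorm_enorm.
Qed.

Lemma adm_scale (c : C) f : adm f -> adm (fun z => c *: f z).
Proof.
move=> af; apply: (adm_mul (a := fun=> c) (B := cabs c)) => //.
- by move=> z _; exact: (vcont_cst hc).
- by move=> z _; exact: cdiff_cst.
Qed.

Lemma adm_sub f g : adm f -> adm g -> adm (fun z => f z - g z).
Proof.
move=> af ag; have := adm_add af (adm_scale (-1) ag).
by congr adm; apply/funext => z; rewrite scaleN1r.
Qed.

Lemma Fbound_sub f g A B : Fbound f A -> Fbound g B -> Fbound (fun z => f z - g z) (A + B).
Proof. by move=> fA gB j t; apply: enB => //; exact: endnorm_enorm. Qed.

Lemma adm_cst x : (N0 x < +oo)%E -> (N1 x < +oo)%E -> adm (fun=> x).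
Proof.
move=> f0 f1; split.
- by exists (K 1 x).
- by move=> z _; exact: (vcont_cst p1).
- by move=> z _; exact: (vdiff_cst p1).
- move=> j; have fj : (endnorm j x < +oo)%E by case: j.
  have hj := endnorm_enorm j; have [r _ E] := en_fin hj fj.
  split; first by exists r => t; rewrite E.
  by move=> t e e0; exists 1; split => // s _; rewrite subrr (en0 hj) lte_fin.
Qed.

Lemma adm_shift f (tau : R) : adm f -> adm (fun z => f (z + Complex 0 tau)).
Proof.
have sh z : cRe (z + Complex 0 tau) = cRe z by rewrite cReD addr0.
have ss z : strip z -> strip (z + Complex 0 tau) by rewrite /strip sh.
have sl j t : line j t + Complex 0 tau = line j (t + tau).
  by congr Complex; rewrite /= addr0.
move=> [[M HM] cf df bf]; split.
- by exists M => z /ss; exact: HM.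
- move=> z /ss /cf H e /H[d [d0 Hd]]; exists d; split => // w /ss wS wz; apply: Hd => //.
  by rewrite (_ : _ - _ = w - z)//; ring.
- move=> z zS; have : ostrip (z + Complex 0 tau) by rewrite /ostrip sh.
  by move=> /df[f' H]; exists f' => e /H[d [d0 Hd]]; exists d; split => // h /Hd;
    rewrite (addrAC z (Complex 0 tau) h).
- move=> j; have [[M' HM'] cb] := bf j; split; first by exists M' => t; rewrite sl.
  move=> t e e0; have [d [d0 H]] := cb (t + tau) e e0; exists d; split => // s st.
  by rewrite !sl; apply: H; rewrite opprD addrACA subrr addr0.
Qed.

Lemma Fbound_shift f (tau : R) A : Fbound f A -> Fbound (fun z => f (z + Complex 0 tau)) A.
Proof.
move=> H j t; have -> : line j t + Complex 0 tau = line j (t + tau).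
  by congr Complex; rewrite /= addr0.
exact: H.
Qed.

(** All [K(t, .)] are equivalent to [K(1, .)], in which admissibility is formulated. *)
Lemma vdiff_kf t f z : 0 < t -> vdiff (K 1) f z -> vdiff (K t) f z.
Proof.
move=> t0 [f' H]; exists f' => e e0.
have m0 : 0 < Num.max 1 t by rewrite lt_max ltr01.
have e1 : 0 < e / Num.max 1 t by rewrite divr_gt0.
have [d [d0 Hd]] := H _ e1; exists d; split => // h /Hd hh.
apply: le_trans (kf_max1 hX _ t0) _; rewrite -ler_pdivlMl//; apply: le_trans hh _.
by apply: eq_ler; ring.
Qed.

Lemma vcont_kf t D f z : 0 < t -> vcont (K 1) D f z -> vcont (K t) D f z.
Proof.
move=> t0 H e e0.
have m0 : 0 < Num.max 1 t by rewrite lt_max ltr01.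
have e1 : 0 < e / Num.max 1 t by rewrite divr_gt0.
have [d [d0 Hd]] := H _ e1; exists d; split => // w wD wz.
apply: le_lt_trans (kf_max1 hX _ t0) _; rewrite -ltr_pdivlMl// mulrC.
exact: Hd.
Qed.

Lemma adm_endpoint_kf f A t j s : 0 < t -> Fbound f A ->
  K t (f (line j s)) <= expR (ln t * j%:R) * A.
Proof.
move=> t0 H; have := H j s; case: j => /= Hj.
  by rewrite mulr1 lnK ?posrE//; exact: (kf_le1 hX).
by rewrite mulr0 expR0 mul1r; exact: (kf_le0 hX).
Qed.

(* The three lines inequality for [t ^ (- z) f(z)] in the norm [K(t, .)]; the
   factor [L / (z + L)] makes the function small at infinity. *)
Lemma strip_max f A t w : adm f -> Fbound f A -> 0 < t -> ostrip w ->
  K t (f w) <= expR (ln t * cRe w) * A.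
Proof.
move=> af bf t0 wS; have [[M HM] cf df _] := af.
have pt := kf_seminorm hX t0.
have A0 := Fbound_ge0 bf.
set lt := ln t.
set X := expR (- lt * cRe w) * K t (f w).
suff : X <= A.
  by rewrite /X mulNr expRN ler_pdivrMl ?expR_gt0.
(* At [w] the factor costs at most [(|w| + L) / L], which tends to [1] as [L] grows. *)
suff main L : 0 < L -> X * L <= A * (cabs w + L).
  rewrite leNgt; apply/negP => AX.
  have XA : 0 < X - A by rewrite subr_gt0.
  pose L := A * cabs w / (X - A) + 1.
  have L0 : 0 < L by rewrite ltr_wpDl// divr_ge0 ?(ltW XA)// mulr_ge0 ?cabs_ge0.
  have := main L L0; rewrite leNgt => /negP; apply.
  rewrite mulrDr -ltrBrDr -mulrBl /L mulrDr mulr1 mulrCA divff ?gt_eqF// mulr1.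
  by rewrite ltrDl.
move=> L0.
pose cL : C := Complex (- L) 0.
have M0 : 0 <= M.
  by apply: le_trans (HM w (ostrip_sub wS)); exact: (sn_ge0 p1).
pose M' := Num.max 1 t * M.
have M'0 : 0 <= M' by rewrite mulr_ge0// le_max ler01.
have HM' z : strip z -> K t (f z) <= M'.
  move=> /HM zM; apply: le_trans (kf_max1 hX _ t0) _.
  by rewrite ler_wpM2l// le_max ler01.
pose B := 1 + expR (- lt).
have B0 : 0 < B by rewrite addr_gt0 ?expR_gt0.
have HB x : 0 <= x <= 1 -> expR (- lt * x) <= B.
  move=> /andP[x0 x1].
  have [l0|l0] := leP 0 lt.
    apply: le_trans (_ : 1 <= _); last by rewrite lerDl.
    by rewrite -expR0 ler_expR mulNr oppr_le0 mulr_ge0.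
  apply: le_trans (_ : expR (- lt) <= _); last by rewrite lerDr.
  by rewrite ler_expR ler_piMr// oppr_ge0 ltW.
pose a z := cexp (Complex (- lt) 0 * z) * (Complex L 0 * (z - cL)^-1).
have zL z : strip z -> L <= cabs (z - cL) /\ `|cIm z| <= cabs (z - cL).
  move=> /andP[z0 z1]; split.
    apply: le_trans (Re_le_cabs _); apply: le_trans (ler_norm _).
    by rewrite cReB /= opprK lerDr.
  by apply: le_trans (Im_le_cabs _); rewrite cImB /= subr0.
have aE z : cabs (a z) = expR (- lt * cRe z) * (L / cabs (z - cL)).
  by rewrite !cabsM cabs_cexp cReM /= mul0r subr0 cabsV cabs_real gtr0_norm.
have zLp z : strip z -> 0 < cabs (z - cL) by move=> /zL[H _]; exact: lt_le_trans H.
have da z : strip z -> cdiff a z.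
  move=> zS; apply: cdiffM.
    apply: (vdiff_comp hc (f := cexp : C -> C^o) (g := fun z => Complex (- lt) 0 * z)).
      by apply: cdiffM; [exact: cdiff_cst|exact: cdiff_id].
    exact: cdiff_cexp.
  apply: cdiffM; first exact: cdiff_cst.
  by apply: cdiff_inv; rewrite -subr_eq0 -cabs_gt0; exact: zLp.
have key eta : 0 < eta -> K t (a w *: f w) <= A + eta.
  move=> eta0.
  (* So high that on the horizontal sides the function is at most [B (L / H) M' <= eta]. *)
  pose H := `|cIm w| + 1 + B * L * M' / eta.
  have BLM : 0 <= B * L * M' / eta.
    by apply: divr_ge0; [apply: mulr_ge0 => //; apply: mulr_ge0|]; exact: ltW.
  have H0 : `|cIm w| + 1 <= H by rewrite /H lerDl.
  have Hp : 0 < H by apply: lt_le_trans H0; rewrite ltr_wpDl.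
  have Qs z : inrect 0 1 (- H) H z -> strip z by case.
  apply: (max_principle pt (E := [::]) (f := fun z => a z *: f z) (a := 0) (b := 1) (c := - H) (d := H)) => //.
  - split => //; have := ler_norm (cIm w); have := ler_norm (- cIm w).
    by rewrite normrN => *; apply/andP; split; lra.
  - move=> z [zS _] _; apply: (vdiffZ pt); first by apply: da; exact: ostrip_sub.
    by apply: vdiff_kf => //; exact: df.
  - move=> z zQ _; apply: (vcontZ pt).
      by apply: (vdiff_cont hc); apply: da; exact: Qs.
    by apply: vcont_kf => //; apply: (vcontS (D := strip)) (cf z (Qs z zQ)).
  - by rewrite addr_ge0// ltW.
  - move=> z [zQ zb]; have zS := Qs z zQ; rewrite (snZ pt) aE.
    have [zL1 zL2] := zL z zS; have zp := zLp z zS.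
    have fr : L / cabs (z - cL) <= 1 by rewrite ler_pdivrMr// mul1r.
    have fr0 : 0 <= L / cabs (z - cL) by rewrite divr_ge0 ?cabs_ge0 ?ltW.
    have side (j : bool) : cRe z = j%:R -> expR (- lt * cRe z) * (L / cabs (z - cL)) * K t (f z) <= A + eta.
      move=> zj; rewrite zj.
      have -> : f z = f (line j (cIm z)) by rewrite [z in LHS]complex_eta zj.
      have b1 := adm_endpoint_kf j (cIm z) t0 bf.
      apply: le_trans (_ : expR (- lt * j%:R) * 1 * (expR (lt * j%:R) * A) <= _).
        apply: ler_pM => //; first by rewrite mulr_ge0 ?expR_ge0.
          exact: (sn_ge0 pt).
        by apply: ler_wpM2l; first exact: expR_ge0.
      rewrite mulr1 mulrA -expRD mulNr addNr expR0 mul1r lerDl ltW//.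
    have topbot : `|cIm z| = H -> expR (- lt * cRe z) * (L / cabs (z - cL)) * K t (f z) <= A + eta.
      move=> zH; apply: le_trans (_ : B * (L / H) * M' <= _).
        apply: ler_pM => //; first by rewrite mulr_ge0 ?expR_ge0.
        - exact: (sn_ge0 pt).
        - apply: ler_pM; rewrite ?expR_ge0//; first exact: HB.
          by apply: ler_wpM2l; [exact: ltW|rewrite lef_pV2 ?posrE// -zH].
        - exact: HM'.
      apply: le_trans (_ : eta <= _); last by rewrite lerDr.
      have -> : B * (L / H) * M' = (B * L * M') / H by ring.
      by rewrite ler_pdivrMr// [leRHS]mulrC -ler_pdivrMr// /H lerDr addr_ge0.
    case: zb => [z0|[z1|[zH|zH]]].
    + exact: (side false).
    + exact: (side true).
    + by apply: topbot; rewrite zH normrN gtr0_norm.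
    + by apply: topbot; rewrite zH gtr0_norm.
have {}key : K t (a w *: f w) <= A by apply/ler_addgt0Pr => eta /key.
have wp := zLp w (ostrip_sub wS).
move: key; rewrite (snZ pt) aE mulrAC mulrA -/X ler_pdivrMr//.
rewrite -/X => key; apply: le_trans key _; apply: ler_wpM2l => //.
apply: le_trans (cabsD _ _) _; rewrite lerD2l cabsN cabs_real normrN gtr0_norm//.
Qed.

Lemma kf_geometrically_complete : geometrically_complete (K 1).
Proof. by move=> v c q; exact: (couple_complete hX). Qed.

Lemma vcont_eq p D (f g : C -> V) z r : 0 < r ->
  (forall w, cabs (w - z) < r -> f w = g w) -> vcont p D f z -> vcont p D g z.
Proof.
move=> r0 fg H e /H[d [d0 Hd]]; exists (Num.min d r); split; first by rewrite lt_min d0.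
move=> w Dw; rewrite lt_min => /andP[wd wr]; rewrite -!fg// ?Hd//.
by rewrite subrr cabs0.
Qed.

(** The quotient is completed at [theta] by the derivative of [f], and [vdiff_division] makes it
    analytic there. The norm is lost by the distance of [theta] to the boundary lines only. *)
Lemma adm_division f theta : 0 < theta < 1 -> adm f -> f (Complex theta 0) = 0 ->
  exists g, [/\ adm g, forall z, f z = (z - Complex theta 0) *: g z &
    forall A, Fbound f A -> Fbound g (A / Num.min theta (1 - theta))].
Proof.
move=> /andP[th0 th1] af f0; have [[M HM] cf df bf] := af.
set z0 : C := Complex theta 0; set m := Num.min theta (1 - theta).
have m0 : 0 < m by rewrite lt_min th0 subr_gt0.
have [m1 m2] : m <= theta /\ m <= 1 - theta by rewrite /m !ge_min !lexx orbT.
have z0S : ostrip z0 by rewrite /ostrip th0.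
have [d Hd] := df z0 z0S.
pose g z := if z == z0 then d else (z - z0)^-1 *: f z.
have gE z : z != z0 -> g z = (z - z0)^-1 *: f z by rewrite /g => /negbTE ->.
have loc z : z != z0 -> exists2 r, 0 < r & forall w, cabs (w - z) < r -> (w - z0)^-1 *: f w = g w.
  move=> zz; exists (cabs (z - z0)); first by rewrite cabs_gt0 subr_eq0.
  move=> w wz; rewrite gE//; apply/eqP => wz0; move: wz.
  by rewrite wz0 cabsB ltxx.
have gd z : ostrip z -> vdiff (K 1) g z.
  move=> zS; have [->|zz] := eqVneq z z0; last first.
    have [r r0 H] := loc z zz; apply: (vdiff_eq r0 H).
    by apply: (vdiffZ p1); [exact: cdiff_inv|exact: df].
  have r0 : 0 < m / 2 by rewrite divr_gt0.
  have Qs w : inrect (cRe z0 - m / 2) (cRe z0 + m / 2)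
                  (cIm z0 - m / 2) (cIm z0 + m / 2) w -> ostrip w.
    by move=> [/andP[/= q1 q2] _]; apply/andP; split; lra.
  apply: (vdiff_division p1 (r := m / 2) (Mf := M)) => //.
  - exact: kf_geometrically_complete.
  - by move=> w /Qs; exact: df.
  - by move=> w /Qs /ostrip_sub; exact: HM.
  - move=> e /Hd[dl [dl0 H]]; exists dl; split => // h /H.
    by rewrite f0 subr0.
have gc z : strip z -> vcont (K 1) strip g z.
  move=> zS; have [->|zz] := eqVneq z z0.
    by apply: (vdiff_cont p1); exact: gd.
  have [r r0 H] := loc z zz; apply: (vcont_eq r0 H).
  apply: (vcontZ p1); last exact: cf.
  by apply: (vdiff_cont hc); exact: cdiff_inv.
have linez j t : m <= cabs (line j t - z0) /\ line j t != z0.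
  suff H : m <= cabs (line j t - z0).
    by split => //; rewrite -subr_eq0 -cabs_gt0; exact: lt_le_trans H.
  apply: le_trans (Re_le_cabs _); rewrite cReB /=.
  case: j => /=; first by apply: le_trans (ler_norm _).
  by rewrite distrC subr0; apply: le_trans (ler_norm _).
have inv_le j t : cabs (line j t - z0)^-1 <= m^-1.
  have [h _] := linez j t; rewrite cabsV lef_pV2 ?posrE//; exact: lt_le_trans h.
exists g; split.
- split => //.
  + have [r [r0 Hr]] := vcont_bound p1 (gc z0 (ostrip_sub z0S)).
    exists (Num.max (K 1 (g z0) + 1) (r^-1 * M)) => z zS; rewrite le_max.
    have [zr|rz] := ltP (cabs (z - z0)) r; first by rewrite Hr.
    have zz : z != z0 by rewrite -subr_eq0 -cabs_gt0; exact: lt_le_trans rz.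
    apply/orP; right; rewrite gE// (snZ p1) cabsV.
    apply: ler_pM; rewrite ?invr_ge0 ?cabs_ge0 ?(sn_ge0 p1)//; last exact: HM.
    by rewrite lef_pV2 ?posrE//; exact: lt_le_trans rz.
  + move=> j; have -> : (fun t => g (line j t)) = (fun t => (line j t - z0)^-1 *: f (line j t)).
      by apply/funext => t; rewrite gE//; have [] := linez j t.
    apply: (bdcont_mul (a := fun t => (line j t - z0)^-1) (B := m^-1)) => //.
      exact: endnorm_enorm.
    move=> t e e0.
    have [dl [dl0 H]] := vdiff_cont hc (fun=> True) (cdiff_inv (proj2 (linez j t))) e0.
    by exists dl; split => // s st; apply: H => //; rewrite lineB.
- move=> z; have [->|zz] := eqVneq z z0; first by rewrite subrr scale0r f0.
  by rewrite gE// scalerA mulfV ?scale1r// subr_eq0.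
- move=> A bA j t; rewrite gE; last by have [] := linez j t.
  apply: le_trans (enZ (endnorm_enorm j) _ (bA j t)) _.
  by rewrite lee_fin mulrC ler_wpM2l// (Fbound_ge0 bA).
Qed.

End Admissible.

(** * Propagation of invertibility along the strip *)

Section Core.
Context {R : realType} {V W : lmodType R[i]}.
Local Notation C := R[i].
Local Notation hc := (seminorm_cabs R).
Context (N0 N1 : V -> \bar R) (M0 M1 : W -> \bar R).
Context (hX : is_couple N0 N1) (hY : is_couple M0 M1).
Context (T : {linear V -> W}).
Context (hT0 : bounded_between N0 M0 T) (hT1 : bounded_between N1 M1 T).
Local Notation KX := (kf N0 N1).
Local Notation KY := (kf M0 M1).

Lemma operator_bound : exists2 c : R, 1 <= c &
  forall j x r, (endnorm N0 N1 j x <= r%:E)%E -> (endnorm M0 M1 j (T x) <= (c * r)%:E)%E.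
Proof.
have [c0 H0] := hT0; have [c1 H1] := hT1.
(* The constants of [bounded_between] may have any sign; the maximum with [1] makes the common one
   positive. *)
exists (Num.max 1 (Num.max c0 c1)); first by rewrite le_max lexx.
have cle (j : bool) : (if j then c1 else c0) <= Num.max 1 (Num.max c0 c1).
  by case: j; rewrite !le_max lexx ?orbT.
move=> j x r xr; have xoo := le_lt_trans xr (ltry _).
have [r' r'0 E] := en_fin (endnorm_enorm hX j) xoo.
have rr : r' <= r by rewrite -lee_fin -E.
have H : (endnorm M0 M1 j (T x) <= (if j then c1 else c0)%:E * r'%:E)%E.
  by rewrite -E; case: j xoo {xr E} => xoo; [exact: H1|exact: H0].
apply: le_trans H _; rewrite -EFinM lee_fin.
apply: le_trans (_ : Num.max 1 (Num.max c0 c1) * r' <= _); first by rewrite ler_wpM2r.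
by rewrite ler_wpM2l// le_max ler01.
Qed.

Section Bounded.
Context (cT : R) (cT1 : 1 <= cT).
Context (hT : forall j x r, (endnorm N0 N1 j x <= r%:E)%E ->
  (endnorm M0 M1 j (T x) <= (cT * r)%:E)%E).

Let cT0 : 0 < cT. Proof. exact: lt_le_trans cT1. Qed.

Lemma kf_operator t v : 0 < t -> KY t (T v) <= cT * KX t v.
Proof.
move=> t0; rewrite -ler_pdivrMl//; apply/ler_addgt0Pr => e e0.
have [|x0 [x1 [r0 [r1 [<- E0 E1 _ L1]]]]] := @kf_decomp _ _ _ _ hX t v (KX t v + e) t0.
  by rewrite ltrDl.
apply: le_trans (ltW L1); rewrite ler_pdivrMl// linearD.
apply: le_trans (@kf_le _ _ _ _ hY t _ _ (cT * r0) (cT * r1) t0 _ _) _.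
- by have := @hT false x0 r0; rewrite /= E0; apply.
- by have := @hT true x1 r1; rewrite /= E1; apply.
- by apply: eq_ler; ring.
Qed.

Lemma adm_operator f : adm N0 N1 f -> adm M0 M1 (fun z => T (f z)).
Proof.
have tB v : KY 1 (T v) <= cT * KX 1 v by exact: kf_operator.
move=> [[M HM] cf df bf]; split.
- exists (cT * M) => z zS; apply: le_trans (tB _) _.
  by rewrite ler_wpM2l ?(ltW cT0)// HM.
- move=> z zS e e0; have e1 : 0 < e / cT by rewrite divr_gt0.
  have [d [d0 H]] := cf z zS _ e1; exists d; split => // w wS wz.
  rewrite -linearB; apply: le_lt_trans (tB _) _.
  by rewrite -ltr_pdivlMl// mulrC H.
- move=> z zS; have [f' H] := df z zS; exists (T f') => e e0.
  have e1 : 0 < e / cT by rewrite divr_gt0.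
  have [d [d0 Hd]] := H _ e1; exists d; split => // h /Hd hh.
  rewrite -linearZ -!linearB; apply: le_trans (tB _) _.
  rewrite -ler_pdivlMl//; apply: le_trans hh _; apply: eq_ler; ring.
- move=> j; have [[M' HM'] cb] := bf j; split.
    by exists (cT * M') => t; exact: hT.
  move=> t e e0; have e1 : 0 < e / (cT * 2) by rewrite divr_gt0// mulr_gt0.
  have [d [d0 H]] := cb t _ e1; exists d; split => // s st.
  rewrite -linearB; apply: le_lt_trans (hT (ltW (H s st))) _; rewrite lte_fin.
  have -> : cT * (e / (cT * 2)) = e / 2 by field; rewrite gt_eqF.
  by rewrite ltr_pdivrMr// ltr_pMr// ltr1n.
Qed.

Lemma Fbound_operator f A : Fbound N0 N1 f A -> Fbound M0 M1 (fun z => T (f z)) (cT * A).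
Proof. by move=> H j t; apply: hT. Qed.

Context (theta : R) (htheta : 0 < theta < 1).
Local Notation z0 := (Complex theta 0 : C).
Local Notation cX := (cinterp N0 N1 theta).
Local Notation cY := (cinterp M0 M1 theta).
Context (cI : R) (cI1 : 1 <= cI).
Context (hsurj : forall y, (cY y < +oo)%E -> exists x, (cX x < +oo)%E /\ T x = y).
Context (hlow : forall x, (cX x < +oo)%E -> (cX x <= cI%:E * cY (T x))%E).

Let cI0 : 0 < cI. Proof. exact: lt_le_trans cI1. Qed.

Lemma solve_at g A : adm M0 M1 g -> Fbound M0 M1 g A -> 0 < A ->
  exists f, [/\ adm N0 N1 f, T (f z0) = g z0 & Fbound N0 N1 f (2 * cI * A)].
Proof.
move=> ag bg A0.
have [x [xoo Tx]] := hsurj (cinterp_fin hY ag (erefl (g z0))).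
(* The infimum defining the norm may not be attained; the factor [2] gives strict room, thanks to
   [0 < A]. *)
have : (cX x < (2 * cI * A)%:E)%E.
  apply: le_lt_trans (hlow xoo) _; rewrite Tx.
  apply: (@le_lt_trans _ _ (cI%:E * A%:E)%E).
    by apply: lee_wpmul2l; [rewrite lee_fin ltW|exact: (cinterp_le hY ag bg)].
  rewrite -EFinM lte_fin -mulrA ltr_pMl ?ltr1n// mulr_gt0//.
move=> /(cinterp_lt hX)[f [af bf fx]]; exists f; split => //.
by rewrite fx.
Qed.

(** The bound involves the norm of [g] and not that of [f]: the lower bound for [T] supplies a
    better representative of [f z0], to which [strip_max] applies. *)
Lemma inverse_estimate f g A t : adm N0 N1 f -> adm M0 M1 g -> Fbound M0 M1 g A ->
  T (f z0) = g z0 -> 0 < t -> KX t (f z0) <= expR (ln t * theta) * (cI * A).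
Proof.
move=> af ag bg Tf t0.
have z0S : ostrip z0 by [].
rewrite -ler_pdivrMl ?expR_gt0//; apply/ler_addgt0Pr => e e0.
rewrite ler_pdivrMl ?expR_gt0//.
have : (cX (f z0) < (cI * A + e)%:E)%E.
  apply: le_lt_trans (hlow (cinterp_fin hX af (erefl _))) _; rewrite Tf.
  apply: (@le_lt_trans _ _ (cI%:E * A%:E)%E).
    by apply: lee_wpmul2l; [rewrite lee_fin ltW|exact: (cinterp_le hY ag bg)].
  by rewrite -EFinM lte_fin ltrDl.
move=> /(cinterp_lt hX)[f' [af' bf' <-]].
exact: (strip_max hX af' bf' t0 z0S).
Qed.

Let m := Num.min theta (1 - theta).
Let m0 : 0 < m.
Proof. by case/andP: htheta => ? ?; rewrite lt_min subr_gt0; apply/andP. Qed.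
(** The factor lost in one step: the error [g - T f] is at most [(1 + 2 cT cI) A], and division by
    [z - theta] costs [1 / m]. *)
Definition error_growth : R := Num.max 1 ((1 + cT * (2 * cI)) / m).
Let B1 : 1 <= error_growth. Proof. by rewrite le_max lexx. Qed.
Let B0 : 0 < error_growth. Proof. exact: lt_le_trans B1. Qed.
(** The first entry keeps the disc inside the strip, the second turns [(|z - theta| error_growth)^n]
    into at most [e^(-n)]. *)
Definition solution_radius : R := Num.min (m / 2) (expR (-1) / error_growth).
Let rho0 : 0 < solution_radius. Proof. by rewrite lt_min !divr_gt0// expR_gt0. Qed.
Let rhoB : solution_radius * error_growth <= expR (-1).
Proof. by rewrite -ler_pdivlMr// ge_min lexx orbT. Qed.
Let rhom : solution_radius <= m / 2. Proof. by rewrite ge_min lexx. Qed.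

Let e1_half : expR (-1) <= (2^-1 : R).
Proof.
rewrite expRN lef_pV2 ?posrE ?expR_gt0//.
by apply: le_trans (expR_ge1Dx 1); rewrite -[1 + 1]/(2%:R : R).
Qed.

Lemma disc_ostrip z : cabs (z - z0) <= solution_radius -> ostrip z.
Proof.
move=> zr; have := le_trans (Re_le_cabs (z - z0)) zr; rewrite cReB ler_norml /=.
move=> /andP[z1 z2]; have mt : m <= theta by rewrite /m ge_min lexx.
have mt' : m <= 1 - theta by rewrite /m ge_min lexx orbT.
have := rhom; have := m0 => ? ?; apply/andP; split; lra.
Qed.

(* Solving [T f = g] near [z0]: correct at [z0], divide the error by [z - z0]
   and repeat. *)
Lemma local_solution n g A : adm M0 M1 g -> Fbound M0 M1 g A -> 0 < A ->
  exists (P : C -> V) (gn : C -> W),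
  [/\ forall z, ostrip z -> vdiff (KX 1) P z,
      adm M0 M1 gn /\ Fbound M0 M1 gn (error_growth ^+ n * A),
      forall z, T (P z) = g z - (z - z0) ^+ n *: gn z,
      forall z t, cabs (z - z0) <= solution_radius -> 0 < t ->
        KX t (P z) <= expR (ln t * cRe z) * (4 * cI * A) &
      forall tau, exists2 F, adm N0 N1 F & F z0 = P (z0 + Complex 0 tau)].
Proof.
have h0 : is_enorm N0 by case: hX => -[].
have h1 : is_enorm N1 by case: hX => -[].
have p1 : seminorm (KX 1) by exact: (kf_seminorm hX ltr01).
elim: n g A => [|n IH] g A ag bg A0.
  exists (fun=> 0), g; split.
  - by move=> z _; exact: (vdiff_cst p1).
  - by rewrite expr0 mul1r.
  - by move=> z; rewrite linear0 expr0 scale1r subrr.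
  - move=> z t _ t0; rewrite (sn0 (kf_seminorm hX t0)).
    by rewrite !mulr_ge0 ?expR_ge0 ?(ltW cI0) ?(ltW A0).
  - by move=> tau; exists (fun=> 0) => //; apply: (adm_cst hX); rewrite ?(en0 h0) ?(en0 h1) ltry.
have [f [af fz0 bf]] := solve_at ag bg A0.
pose d z := g z - T (f z).
have ad : adm M0 M1 d by apply: (adm_sub hY) => //; exact: adm_operator.
have bd : Fbound M0 M1 d (A + cT * (2 * cI * A)).
  by apply: (Fbound_sub hY) => //; exact: Fbound_operator.
have dz0 : d z0 = 0 by rewrite /d fz0 subrr.
have [g1 [ag1 dE bg1]] := adm_division hY htheta ad dz0.
have {}bg1 : Fbound M0 M1 g1 (error_growth * A).
  move=> j t; apply: le_trans (bg1 _ bd j t) _; rewrite lee_fin -/m.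
  have -> : (A + cT * (2 * cI * A)) / m = (1 + cT * (2 * cI)) / m * A by ring.
  by rewrite ler_wpM2r ?(ltW A0)// /error_growth le_max lexx orbT.
have BA0 : 0 < error_growth * A by rewrite mulr_gt0.
have [P [gn [dP [agn bgn] TP KP FP]]] := IH g1 _ ag1 bg1 BA0.
exists (fun z => f z + (z - z0) *: P z), gn; split.
- move=> z zS; have [_ _ df _] := af; apply: (vdiffD p1); first exact: df.
  apply: (vdiffZ p1); last exact: dP.
  by apply: cdiffB_cst; exact: cdiff_id.
- by split => //; rewrite exprSr -mulrA.
- move=> z; rewrite linearD linearZ/= TP.
  have -> : T (f z) = g z - (z - z0) *: g1 z by rewrite -dE /d; lincomb_goal (R[i]) W; ring.
  by rewrite exprS; lincomb_goal (R[i]) W; ring.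
- move=> z t zr t0; have zS := disc_ostrip zr.
  have pt := kf_seminorm hX t0.
  apply: le_trans (snD pt _ _) _; rewrite (snZ pt).
  have k1 := strip_max hX af bf t0 zS; have k2 := KP z t zr t0.
  have k3 : cabs (z - z0) * KX t (P z) <=
      solution_radius * (expR (ln t * cRe z) * (4 * cI * (error_growth * A))).
    by apply: ler_pM => //; rewrite ?cabs_ge0 ?(sn_ge0 pt).
  apply: le_trans (lerD k1 k3) _.
  set E := expR _; have E0 : 0 <= E by exact: expR_ge0.
  have -> : solution_radius * (E * (4 * cI * (error_growth * A))) =
    (solution_radius * error_growth) * (E * (4 * cI * A)) by ring.
  (* The step contributes [2 cI A] and the rest at most half of [4 cI A], so [4 cI A] is reproduced
     and stays uniform in [n]. *)
  have k4 : (solution_radius * error_growth) * (E * (4 * cI * A)) <= 2^-1 * (E * (4 * cI * A)).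
    rewrite ler_wpM2r ?mulr_ge0 ?(ltW cI0) ?(ltW A0)//.
    exact: le_trans rhoB e1_half.
  by apply: le_trans (lerD (lexx _) k4) _; apply: eq_ler; field.
(* [P] has polynomial factors and need not be bounded on the strip. Freezing them at [i tau] and
   translating [f] shows that its values on [Re z = theta] still lie in the complex space. *)
- move=> tau; have [F aF Fz0] := FP tau.
  exists (fun z => f (z + Complex 0 tau) + Complex 0 tau *: F z).
    by apply: (adm_add hX); [exact: adm_shift|exact: (adm_scale hX)].
  by rewrite Fz0 addrAC subrr add0r.
Qed.

Lemma adm_power s y : 0 < s -> (M0 y < +oo)%E -> (M1 y < +oo)%E ->
  adm M0 M1 (fun z => cexp (Complex (ln s) 0 * (z - z0)) *: y).
Proof.
move=> s0 y0 y1.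
have da z : cdiff (fun z => cexp (Complex (ln s) 0 * (z - z0))) z.
  apply: (vdiff_comp hc (f := cexp : C -> C^o) (g := fun z => Complex (ln s) 0 * (z - z0))).
    by apply: cdiffM; [exact: cdiff_cst|apply: cdiffB_cst; exact: cdiff_id].
  exact: cdiff_cexp.
apply: (adm_mul hY (B := expR `|ln s|)).
- move=> z /andP[z1 z2]; rewrite cabs_cexp ler_expR cReM cReB /= mul0r subr0.
  apply: le_trans (ler_norm _) _; rewrite normrM ler_piMr// ler_norml.
  by case/andP: htheta => ? ?; apply/andP; split; lra.
- by move=> z _; exact: (vdiff_cont hc).
- by move=> z _; exact: da.
- exact: (adm_cst hY).
Qed.

(** The modulus of [s^(z - theta)] is [s^(- theta)] on one line and [s^(1 - theta)] on the other;
    the hypotheses, [J(s, y) <= J], balance the two. *)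
Lemma Fbound_power s y J : 0 < s -> (M0 y <= J%:E)%E -> (M1 y <= (J / s)%:E)%E ->
  Fbound M0 M1 (fun z => cexp (Complex (ln s) 0 * (z - z0)) *: y) (expR (- (ln s * theta)) * J).
Proof.
move=> s0 y0 y1 j t.
have h0 : is_enorm M0 by case: hY => -[].
have h1 : is_enorm M1 by case: hY => -[].
case: j => /=; [apply: le_trans (enZ h1 _ y1) _|apply: le_trans (enZ h0 _ y0) _];
  rewrite lee_fin cabs_cexp cReM cReB /= mul0r subr0; apply: eq_ler.
  by rewrite mulrBr mulr1 expRD lnK ?posrE//; field; rewrite gt_eqF.
by rewrite sub0r mulrN.
Qed.

Lemma expR_small (c K e : R) : 0 < c -> 0 < e -> exists n : nat, K * expR (- (n%:R * c)) <= e.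
Proof.
move=> c0 e0; exists (Num.truncn (K / e / c)).+1.
set n := _.+1; have nc : K / e <= n%:R * c.
  by rewrite -ler_pdivrMr// ltW// truncnS_gt.
rewrite expRN ler_pdivrMr ?expR_gt0// mulrC -ler_pdivrMr//.
apply: le_trans nc _; apply: le_trans (expR_ge1Dx _); rewrite lerDr ler01//.
Qed.

(** The sign [sg] selects the side of the line [Re z = theta]; the two exponents together give decay
    in [|ln t - ln s|]. *)
Lemma core_one_sided (sg : R) s J x y t : sg = 1 \/ sg = -1 -> 0 < s -> 0 < J ->
  (M0 y <= J%:E)%E -> (M1 y <= (J / s)%:E)%E -> (cX x < +oo)%E -> T x = y -> 0 < t ->
  KX t x <= 4 * cI * J * expR ((ln t - ln s) * (theta + sg * (solution_radius / 4))).
Proof.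
move=> hsg s0 J0 y0 y1 xoo Tx t0.
have p1 : seminorm (KX 1) by exact: (kf_seminorm hX ltr01).
have pt : seminorm (KX t) by exact: (kf_seminorm hX t0).
set A := expR (- (ln s * theta)) * J.
have A0 : 0 < A by rewrite mulr_gt0 ?expR_gt0.
pose ex z := cexp (Complex (ln s) 0 * (z - z0)).
pose g z := ex z *: y.
have ag : adm M0 M1 g by apply: adm_power => //; [exact: le_lt_trans y0 (ltry _)|exact: le_lt_trans y1 (ltry _)].
have bg : Fbound M0 M1 g A by exact: Fbound_power.
have dex z : cdiff ex z.
  apply: (vdiff_comp hc (f := cexp : C -> C^o) (g := fun z => Complex (ln s) 0 * (z - z0))).
    by apply: cdiffM; [exact: cdiff_cst|apply: cdiffB_cst; exact: cdiff_id].
  exact: cdiff_cexp.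
have [Fx aFx Fxz0] := cinterp_finP hX xoo.
pose r := solution_radius / 2; have r0 : 0 < r by rewrite divr_gt0.
have r1 : r <= 1.
  have mt : m <= theta by rewrite /m ge_min lexx.
  by case/andP: htheta => ? ?; have := rhom; rewrite /r => ?; lra.
pose S : C := Complex sg 0.
have S1 : cabs S = 1 by rewrite cabs_real; case: hsg => ->; rewrite ?normrN normr1.
pose MD := 4 * cI * A + expR `|ln s| * KX 1 x.
have MD0 : 0 <= MD.
  apply: addr_ge0; last by apply: mulr_ge0; [exact: expR_ge0|exact: (sn_ge0 p1)].
  by apply: mulr_ge0; [rewrite mulr_ge0// ltW|exact: ltW].
pose MM := Num.max MD (cI * A).
have MM0 : 0 <= MM by rewrite le_max MD0.
pose zs := z0 + S * Complex (r / 2) 0.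
have zsE : zs - z0 = Complex (sg * (r / 2)) 0.
  by rewrite /zs addrAC subrr add0r; congr Complex; rewrite /= ?mulr0 ?mul0r ?subr0 ?addr0.
have zsRe : cRe zs = theta + sg * (r / 2).
  by rewrite /zs cReD cReM /= mulr0 subr0.
have zsr : cabs (zs - z0) <= solution_radius.
  rewrite zsE cabs_real normrM (_ : `|sg| = 1); last by case: hsg => ->; rewrite ?normrN normr1.
  rewrite mul1r gtr0_norm ?divr_gt0// /r; have := rho0 => ?; lra.
have approx n : exists P, KX t P <= expR (ln t * cRe zs) * (4 * cI * A) /\
    KX 1 (P - ex zs *: x) <= MM * expR (- (n%:R * (r ^+ 2 / 4))).
  have [P [gn [dP [agn bgn] TP KP FP]]] := local_solution n ag bg A0.
  exists (P zs); split; first by apply: KP.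
  pose D z := P z - ex z *: x.
  have dD z : ostrip z -> vdiff (KX 1) D z.
    move=> zS; apply: (vdiffB p1 (dP _ zS)).
    exact: (vdiffZ p1 (f := fun=> x) (dex z) (vdiff_cst p1 _ _)).
  (* The variable [w] is given by [z = z0 + S w], so that one weight serves both sides of the
     line. *)
  pose ph (w : C) := cexp (Complex n%:R 0 * (Complex r 0 - w) ^+ 2).
  have phE w : cabs (ph w) = expR (n%:R * ((r - cRe w) ^+ 2 - cIm w ^+ 2)).
    by rewrite cabs_cexp !expr2 !cReM !cReB !cImB /=; congr expR; ring.
  have dph w : cdiff ph w.
    apply: (vdiff_comp hc (f := cexp : C -> C^o) (g := fun w => Complex n%:R 0 * (Complex r 0 - w) ^+ 2)).
      apply: cdiffM; first exact: cdiff_cst.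
      by apply: cdiffX; exact: (vdiffB hc (cdiff_cst _ w) (cdiff_id w)).
    exact: cdiff_cexp.
  have Qr w : inrect 0 r (- r) r w -> cabs (z0 + S * w - z0) <= solution_radius.
    move=> [/andP[w1 w2] /andP[w3 w4]].
    rewrite (_ : z0 + S * w - z0 = S * w); last by ring.
    rewrite cabsM S1 mul1r; apply: le_trans (cabs_le_ReIm _) _.
    apply: le_trans (_ : r + r <= _); last by rewrite /r; lra.
    by apply: lerD; rewrite ler_norml; apply/andP; split; lra.
  have dE w : inrect 0 r (- r) r w -> vdiff (KX 1) (fun w => ph w *: D (z0 + S * w)) w.
    move=> wQ; apply: (vdiffZ p1); first exact: dph.
    apply: (vdiff_comp p1 (g := fun w => z0 + S * w)).
      apply: (vdiffD hc); first exact: cdiff_cst.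
      by apply: cdiffM; [exact: cdiff_cst|exact: cdiff_id].
    by apply: dD; apply: disc_ostrip; exact: Qr.
  have DMD w : inrect 0 r (- r) r w -> KX 1 (D (z0 + S * w)) <= MD.
    move=> wQ; apply: le_trans (snB p1 _ _) _; apply: lerD.
      have := KP _ 1 (Qr w wQ) ltr01; rewrite ln1 mul0r expR0 mul1r; apply.
    rewrite (snZ p1) ler_wpM2r ?(sn_ge0 p1)// cabs_cexp ler_expR.
    rewrite (_ : z0 + S * w - z0 = S * w); last by ring.
    rewrite cReM /= mul0r subr0; apply: le_trans (ler_norm _) _.
    rewrite normrM ler_piMr//; apply: le_trans (Re_le_cabs _) _.
    rewrite cabsM S1 mul1r; have := Qr w wQ.
    rewrite (_ : z0 + S * w - z0 = S * w); last by ring.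
    rewrite cabsM S1 mul1r => /le_trans; apply.
    have mt : m <= theta by rewrite /m ge_min lexx.
    by case/andP: htheta => ? ?; have := rhom => ?; lra.
  (* On the line, [T] maps the difference to [- (i tau)^n gn (z0 + i tau)], of size
     [(|tau| error_growth)^n A], and [inverse_estimate] brings this back to the domain. *)
  have left w : cRe w = 0 -> inrect 0 r (- r) r w ->
      KX 1 (D (z0 + S * w)) <= cI * A * expR (- n%:R).
    move=> w0 wQ; pose tau := sg * cIm w.
    have zE : z0 + S * w = z0 + Complex 0 tau.
      by rewrite [w]complex_eta w0; congr (_ + _); congr Complex; rewrite /= ?mulr0 ?mul0r ?subr0 ?addr0.
    have tr : `|tau| <= solution_radius.
      by have := Qr w wQ; rewrite zE addrAC subrr add0r cabs_imag.
    have zt : z0 + Complex 0 tau - z0 = Complex 0 tau by rewrite addrAC subrr add0r.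
    have [F aF Fz0] := FP tau.
    have aD : adm N0 N1 (fun z => F z - ex (z0 + Complex 0 tau) *: Fx z).
      by apply: (adm_sub hX) => //; exact: (adm_scale hX).
    pose c : C := - Complex 0 tau ^+ n.
    have agt : adm M0 M1 (fun z => c *: gn (z + Complex 0 tau)).
      by apply: (adm_scale hY); exact: adm_shift.
    have bgt : Fbound M0 M1 (fun z => c *: gn (z + Complex 0 tau)) (cabs c * (error_growth ^+ n * A)).
      by apply: (Fbound_mul hY (a := fun=> c)) => //; exact: Fbound_shift.
    have := inverse_estimate aD agt bgt _ ltr01.
    rewrite Fz0 Fxz0 -zE -/(D (z0 + S * w)) ln1 mul0r expR0 mul1r.
    move=> /(_ _)/le_trans -> //.
      rewrite linearB linearZ/= TP Tx zE /g zt /c.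
      by lincomb_goal (R[i]) W; ring.
    rewrite -mulrA; apply: ler_wpM2l; first exact: ltW.
    rewrite cabsN cabsX cabs_imag mulrA -exprMn mulrC; apply: ler_wpM2l; first exact: ltW.
    have -> : expR (- n%:R) = expR (-1) ^+ n :> R.
      by rewrite -expRM_natl mulrN1.
    apply: lerXn2r; rewrite ?nnegrE ?expR_ge0 ?mulr_ge0 ?(ltW B0)//.
    by apply: le_trans rhoB; rewrite ler_wpM2r ?(ltW B0).
  have hw : intrect 0 r (- r) r (Complex (r / 2) 0).
    by split; apply/andP; split => /=; lra.
  have := max_principle p1 (E := [::]) (f := fun w => ph w *: D (z0 + S * w)) (A := MM) hw.
  move=> /(_ isT) H.
  have {}H : KX 1 (ph (Complex (r / 2) 0) *: D (z0 + S * Complex (r / 2) 0)) <= MM.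
    apply: H => //.
    - by move=> w wI _; apply: dE; exact: intrect_sub.
    - by move=> w wQ _; apply: (vdiff_cont p1); exact: dE.
    move=> w [wQ wb]; rewrite (snZ p1) phE.
    have small : (r - cRe w) ^+ 2 - cIm w ^+ 2 <= 0 ->
        expR (n%:R * ((r - cRe w) ^+ 2 - cIm w ^+ 2)) * KX 1 (D (z0 + S * w)) <= MM.
      move=> le0; apply: le_trans (_ : 1 * MD <= _); last by rewrite mul1r /MM le_max lexx.
      apply: ler_pM; rewrite ?expR_ge0 ?(sn_ge0 p1)//; last exact: DMD.
      by rewrite -expR0 ler_expR mulr_ge0_le0.
    have [/andP[w1 w2] /andP[w3 w4]] := wQ.
    have sq : (r - cRe w) ^+ 2 <= r ^+ 2.
      by rewrite ler_pXn2r ?nnegrE ?subr_ge0 ?(ltW r0)// lerBlDr lerDl.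
    case: wb => [w0|[wr|[wr|wr]]].
    - have L := left w w0 wQ; rewrite w0 subr0.
      apply: le_trans (_ : expR n%:R * (cI * A * expR (- n%:R)) <= _); last first.
        rewrite mulrCA -expRD subrr expR0 mulr1 /MM le_max lexx orbT//.
      apply: ler_pM; rewrite ?expR_ge0 ?(sn_ge0 p1)//.
      rewrite ler_expR ler_piMr//; apply: le_trans (_ : r ^+ 2 <= _).
        by rewrite lerBlDr lerDl sqr_ge0.
      by apply: exprn_ile1 => //; exact: ltW.
    - by apply: small; rewrite wr subrr expr0n/= sub0r oppr_le0 sqr_ge0.
    - by apply: small; rewrite wr sqrrN subr_le0.
    - by apply: small; rewrite wr subr_le0.
  move: H; rewrite (snZ p1) phE /= expr0n/= subr0 -/zs -/(D zs).
  rewrite (_ : (r - r / 2) ^+ 2 = r ^+ 2 / 4); last by field.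
  by rewrite expRN -ler_pdivlMl ?expR_gt0// mulrC.
(* The error is known in [K(1, .)] only; passing to [K(t, .)] costs [max 1 t], which is harmless as
   [n] tends to infinity. *)
have lim : expR (ln s * (sg * (r / 2))) * KX t x <= expR (ln t * cRe zs) * (4 * cI * A).
  apply/ler_addgt0Pr => e e0.
  have c0 : 0 < r ^+ 2 / 4 by rewrite divr_gt0 ?exprn_gt0.
  have [n Hn] := expR_small (Num.max 1 t * MM) c0 e0.
  have [P [P1 P2]] := approx n.
  have -> : expR (ln s * (sg * (r / 2))) = cabs (ex zs).
    by rewrite cabs_cexp zsE cReM /= mul0r subr0.
  rewrite -(snZ pt); have -> : ex zs *: x = P - (P - ex zs *: x).
    by rewrite opprB addrC subrK.
  apply: le_trans (snB pt _ _) _; apply: lerD => //.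
  apply: le_trans (kf_max1 hX _ t0) _; apply: le_trans Hn; rewrite -mulrA.
  by rewrite ler_wpM2l// le_max ler01.
move: lim; rewrite -ler_pdivlMl ?expR_gt0// => /le_trans; apply.
rewrite zsRe /A /r -expRN; apply: eq_ler.
have -> : (ln t - ln s) * (theta + sg * (solution_radius / 4)) =
  - (ln s * (sg * (solution_radius / 2 / 2))) + (ln t * (theta + sg * (solution_radius / 2 / 2)) - ln s * theta).
  by field.
by rewrite !expRD; ring.
Qed.

End Bounded.
End Core.

(** * Inversion on elements of power growth *)

(** Uniform in the centre [a]. Removing the first term is the shift [a -> a - 1], so a supersolution
    absorbs the sum by induction; for [a < 0] the one chosen is the exact value of the infinite
    series. *)
Lemma sum_expR_dist (R : realType) (dl : R) : 0 < dl -> exists2 L : R, 0 <= L &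
  forall (a : R) (m : nat), \sum_(i < m) expR (- (dl * `|a - i%:R|)) <= L.
Proof.
move=> dl0; pose q := expR (- dl).
have q1 : q < 1 by rewrite -expR0 ltr_expR oppr_lt0.
pose c := (1 - q)^-1; have c0 : 0 < c by rewrite invr_gt0 subr_gt0.
have cE : c = 1 + q * c by rewrite /c; field; rewrite subr_eq0 gt_eqF.
(* [H] is a bounded supersolution: [H a >= e^(- dl |a|) + H (a - 1)]. *)
pose H (a : R) := if a < 0 then c * expR (dl * a) else 1 + 2 * c - c * expR (- (dl * a)).
have H0 a : 0 <= H a.
  rewrite /H; case: ltP => a0; first by rewrite mulr_ge0 ?expR_ge0 ?ltW.
  have : c * expR (- (dl * a)) <= c.
    by apply: ler_piMr; [exact: ltW|rewrite -[leRHS]expR0 ler_expR oppr_le0 mulr_ge0// ltW].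
  by move=> ?; lra.
have step a : expR (- (dl * `|a|)) + H (a - 1) <= H a.
  have em1 : expR (dl * (a - 1)) = q * expR (dl * a).
    by rewrite -expRD; congr expR; ring.
  have em2 : expR (- (dl * a)) = q * expR (- (dl * (a - 1))).
    by rewrite -expRD; congr expR; ring.
  rewrite /H; case: (ltP a 0) => a0.
    have -> : a - 1 < 0 by lra.
    rewrite ltr0_norm// em1 mulrN opprK [in leRHS]cE.
    by apply: eq_ler; ring.
  rewrite ger0_norm//; case: ltP => a1.
    have e1 : expR (dl * (a - 1)) <= 1 by rewrite -[leRHS]expR0 ler_expR; apply: mulr_ge0_le0; exact: ltW.
    have e2 : expR (- (dl * a)) <= 1 by rewrite -[leRHS]expR0 ler_expR oppr_le0 mulr_ge0// ltW.
    have e3 : c * expR (dl * (a - 1)) <= c by rewrite ler_piMr// ltW.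
    have : (1 + c) * expR (- (dl * a)) <= 1 + c by rewrite ler_piMr// addr_ge0// ltW.
    by move=> e4; lra.
  rewrite em2; set E := expR _; have E0 : 0 <= E by exact: expR_ge0.
  have -> : c * (q * E) = (c - 1) * E by rewrite [in RHS]cE; ring.
  have : q * E <= E by rewrite ler_piMl// ltW.
  by move=> ?; lra.
exists (1 + 2 * c); first by rewrite addr_ge0// mulr_ge0// ltW.
move=> a m; apply: le_trans (_ : H a <= _); last first.
  rewrite /H; case: ltP => a0.
    have : c * expR (dl * a) <= c.
      by apply: ler_piMr; [exact: ltW|rewrite -[leRHS]expR0 ler_expR pmulr_rle0// ltW].
    by move=> ?; lra.
  by rewrite gerBl mulr_ge0 ?expR_ge0 ?ltW.
elim: m a => [|m IH] a; first by rewrite big_ord0.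
rewrite big_ord_recl /= subr0; apply: le_trans (step a); rewrite lerD2l.
apply: le_trans (IH (a - 1)); apply: ler_sum => i _.
by rewrite /bump leq0n /= natrD opprD addrA.
Qed.

Section Inversion.
Context {R : realType} {V W : lmodType R[i]}.
Local Notation C := R[i].
Context (N0 N1 : V -> \bar R) (M0 M1 : W -> \bar R).
Context (hX : is_couple N0 N1) (hY : is_couple M0 M1).
Context (T : {linear V -> W}).
Context (hT0 : bounded_between N0 M0 T) (hT1 : bounded_between N1 M1 T).
Context (theta : R) (htheta : 0 < theta < 1).
Context (hinv : invertible_between (cinterp N0 N1 theta) (cinterp M0 M1 theta) T).
Local Notation KX := (kf N0 N1).
Local Notation KY := (kf M0 M1).
Local Notation cX := (cinterp N0 N1 theta).
Local Notation cY := (cinterp M0 M1 theta).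
Local Notation z0 := (Complex theta 0 : C).

Lemma couple_operator_bound : exists2 cT : R, 0 < cT & [/\
  forall x r, (N0 x <= r%:E)%E -> (M0 (T x) <= (cT * r)%:E)%E,
  forall x r, (N1 x <= r%:E)%E -> (M1 (T x) <= (cT * r)%:E)%E &
  forall t v, 0 < t -> KY t (T v) <= cT * KX t v].
Proof.
have [cT cT1 hT] := operator_bound hX hT0 hT1; have cT0 := lt_le_trans ltr01 cT1.
exists cT => //; split.
- exact: (@hT false).
- exact: (@hT true).
- by move=> t v t0; exact: (kf_operator hX hY cT1 hT).
Qed.

Lemma cinterp_lower_bound : exists2 cI : R, 1 <= cI &
  forall u, (cX u < +oo)%E -> (cX u <= cI%:E * cY (T u))%E.
Proof.
have h0 : is_enorm M0 by case: hY => -[].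
have [_ _ _ [c hlow]] := hinv; exists (Num.max 1 c); first by rewrite le_max lexx.
move=> u uoo; apply: le_trans (hlow u uoo) _; apply: lee_wpmul2r.
  apply: le_ereal_inf_tmp => _ [g _ <-]; rewrite /Fnorm le_max; apply/orP; left.
  apply: le_trans (en_ge0 h0 (g (Complex 0 0))) _.
  by apply: ereal_sup_ubound; exists 0.
by rewrite lee_fin le_max lexx orbT.
Qed.

Lemma cinterp_inj x x' : (cX x < +oo)%E -> (cX x' < +oo)%E -> T x = T x' -> x = x'.
Proof.
move=> xoo x'oo Txx.
have [f af fx] := cinterp_finP hX xoo; have [f' af' fx'] := cinterp_finP hX x'oo.
have h0 : is_enorm M0 by case: hY => -[].
have h1 : is_enorm M1 by case: hY => -[].
have [cI cI1 hlow] := cinterp_lower_bound.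
have a0 : adm M0 M1 (fun=> 0) by apply: (adm_cst hY); rewrite ?(en0 h0) ?(en0 h1) ltry.
have b0 : Fbound M0 M1 (fun=> 0) 0 by case=> t; rewrite /= ?(en0 h0) ?(en0 h1).
have := inverse_estimate hX hY htheta cI1 hlow (adm_sub hX af af') a0 b0 _ ltr01.
rewrite fx fx' linearB Txx subrr ln1 mul0r expR0 mul1r mulr0 => /(_ erefl) H.
apply/eqP; rewrite -subr_eq0; apply/eqP; apply: (kf1_eq0 hX).
by apply/eqP; rewrite eq_le kf_ge0// andbT.
Qed.

Lemma core_two_sided : exists Cc dl : R, [/\ 0 < Cc, 0 < dl &
  forall y s J, 0 < s -> 0 < J -> (M0 y <= J%:E)%E -> (M1 y <= (J / s)%:E)%E ->
  exists x, [/\ (cX x < +oo)%E, T x = y & forall t, 0 < t ->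
    KX t x <= Cc * J * expR ((ln t - ln s) * theta) * expR (- (dl * `|ln t - ln s|))]].
Proof.
have [cT cT1 hT] := operator_bound hX hT0 hT1.
have [_ _ hsurj _] := hinv; have [cI cI1 hlow] := cinterp_lower_bound.
have core := core_one_sided hX hY cT1 hT htheta cI1 hsurj hlow.
set rad := solution_radius cT theta cI in core.
have rad0 : 0 < rad.
  rewrite lt_min; apply/andP; split.
    by rewrite divr_gt0// lt_min subr_gt0.
  by rewrite divr_gt0 ?expR_gt0// lt_max ltr01.
exists (4 * cI), (rad / 4); split.
- by rewrite mulr_gt0//; exact: lt_le_trans cI1.
- by rewrite divr_gt0.
move=> y s J s0 J0 y0 y1.
have ay : (cY y < +oo)%E.
  apply: (cinterp_fin hY (f := fun=> y)) => //; apply: (adm_cst hY).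
    exact: le_lt_trans y0 (ltry _).
  exact: le_lt_trans y1 (ltry _).
have [x [xoo Tx]] := hsurj y ay; exists x; split => // t t0.
(* The exponent is lowered for [t >= s] and raised for [t < s], which gives decay on both sides. *)
have [l0|l0] := leP 0 (ln t - ln s).
  apply: le_trans (core (-1) s J x y t _ s0 J0 y0 y1 xoo Tx t0) _; first by right.
  rewrite -[leRHS]mulrA -expRD (ger0_norm l0); apply: eq_ler; congr (_ * expR _); ring.
apply: le_trans (core 1 s J x y t _ s0 J0 y0 y1 xoo Tx t0) _; first by left.
rewrite -[leRHS]mulrA -expRD (ltr0_norm l0); apply: eq_ler; congr (_ * expR _); ring.
Qed.

Lemma expR_vanish (c K e : R) : 0 < c -> 0 <= K -> 0 < e -> exists n0 : nat,
  forall n, (n0 <= n)%N -> K * expR (- (n%:R * c)) <= e.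
Proof.
move=> c0 K0 /(expR_small K c0)[n0 H]; exists n0 => n n0n; apply: le_trans H.
by rewrite ler_wpM2l// ler_expR lerN2 ler_wpM2r ?(ltW c0)// ler_nat.
Qed.

(** The norm in the real space with [q = oo] is at most [A]. Every real space with parameter [theta]
    embeds in it ([rinterp_power_bounded]). *)
Definition power_bounded (U : lmodType C) (P0 P1 : U -> \bar R) (x : U) (A : R) : Prop :=
  forall t, 0 < t -> kf P0 P1 t x <= A * expR (ln t * theta).

(** [x] need not lie in the complex space, where injectivity is known. For [x = u + v] nearly
    optimal at [s], [T u = - T v] lies in both [Y0] and [Y1] and has a preimage [w] in the complex
    space, small away from [s]. For [s = e^(-n)] and [s = e^n], [u1 - u2] lies in both [X0] and
    [X1], hence equals [w1 - w2]; so [x = u1 - w1 + w2 + v2], where all four terms tend to [0]. *)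
Lemma real_injective x A : T x = 0 -> power_bounded N0 N1 x A -> x = 0.
Proof.
move=> Tx0 xA.
have h0 : is_enorm N0 by case: hX => -[].
have h1 : is_enorm N1 by case: hX => -[].
have k1 : is_enorm M1 by case: hY => -[].
have p1 := kf_seminorm hX ltr01.
have [cT cT0 [hb0 hb1 _]] := couple_operator_bound.
have [Cc [dl [Cc0 dl0 core]]] := core_two_sided.
have A0 : 0 <= A.
  have := xA 1 ltr01; rewrite ln1 mul0r expR0 mulr1; apply: le_trans.
  exact: (kf_ge0 hX).
have dec s : 0 < s -> exists u v w, [/\ u + v = x,
    (N0 u <= ((A + 1) * expR (ln s * theta))%:E)%E,
    (N1 v <= ((A + 1) * expR (ln s * theta) / s)%:E)%E,
    (cX w < +oo)%E /\ T w = T u &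
    KX 1 w <= Cc * (cT * (A + 1)) * expR (- (dl * `|ln s|))].
  move=> s0; have e0 : 0 < expR (ln s * theta) by exact: expR_gt0.
  have [|u [v [r0 [r1 [uv E0 E1 [r00 r10] L1]]]]] :=
      @kf_decomp _ _ _ _ hX s x ((A + 1) * expR (ln s * theta)) s0.
    by apply: le_lt_trans (xA s s0) _; rewrite ltr_pM2r// ltrDl.
  have u0 : (N0 u <= ((A + 1) * expR (ln s * theta))%:E)%E.
    rewrite E0 lee_fin; apply: le_trans (ltW L1); rewrite lerDl mulr_ge0// ltW//.
  have v1 : (N1 v <= ((A + 1) * expR (ln s * theta) / s)%:E)%E.
    by rewrite E1 lee_fin ler_pdivlMr// mulrC; apply: le_trans (ltW L1); rewrite lerDr.
  have Tu : T u = - T v by apply/eqP; rewrite -addr_eq0 -linearD uv Tx0.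
  have J0 : 0 < cT * ((A + 1) * expR (ln s * theta)).
    by rewrite mulr_gt0// mulr_gt0// ltr_wpDl.
  have [|w [woo Tw Kw]] := core (T u) s _ s0 J0 (hb0 _ _ u0).
    by rewrite Tu (enN k1) -mulrA; exact: hb1.
  exists u, v, w; split => //; apply: le_trans (Kw 1 ltr01) _.
  rewrite ln1 sub0r normrN mulNr (expRN (ln s * theta)); apply: eq_ler.
  by move: e0; set E := expR _; set F := expR _ => e0; field; rewrite gt_eqF.
(* The decay rates of [u1], of [v2] and of the two [w]. *)
pose c := Num.min (Num.min theta (1 - theta)) dl.
have c0 : 0 < c by case/andP: htheta => ? ?; rewrite !lt_min subr_gt0; apply/andP; split => //; apply/andP.
have [c1 c2 c3] : [/\ c <= theta, c <= 1 - theta & c <= dl].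
  by rewrite /c !ge_min !lexx !orbT.
pose D := Cc * (cT * (A + 1)).
have D0 : 0 <= D by rewrite !mulr_ge0 ?(ltW Cc0) ?(ltW cT0)// addr_ge0.
apply: (kf1_le_eps hX) => e e0.
have [n Hn] := expR_small (2 * (A + 1) + 2 * D) c0 e0.
have [u1 [v1 [w1 [E1 U1 V1 [F1 TW1] W1]]]] := dec _ (expR_gt0 (- n%:R)).
have [u2 [v2 [w2 [E2 U2 V2 [F2 TW2] W2]]]] := dec _ (expR_gt0 n%:R).
have uw : u1 - u2 = w1 - w2.
  have dE : u1 - u2 = v2 - v1.
    by apply/eqP; rewrite subr_eq addrAC eq_sym subr_eq E1 addrC E2.
  apply: cinterp_inj.
  - have d0 : (N0 (u1 - u2) < +oo)%E by apply: le_lt_trans (enB h0 U1 U2) (ltry _).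
    have d1 : (N1 (u1 - u2) < +oo)%E by rewrite dE; apply: le_lt_trans (enB h1 V2 V1) (ltry _).
    exact: (cinterp_fin hX (f := fun=> u1 - u2) (adm_cst hX d0 d1)).
  - have [f1 a1 e1] := cinterp_finP hX F1; have [f2 a2 e2] := cinterp_finP hX F2.
    by apply: (cinterp_fin hX (adm_sub hX a1 a2)); rewrite e1 e2.
  - by rewrite !linearB TW1 TW2.
have xE : x = u1 - w1 + (w2 + v2).
  rewrite -E2; have -> : u2 = u1 - w1 + w2.
    by rewrite -[u2](subKr u1) uw; lincomb_goal (R[i]) V; ring.
  by rewrite addrA.
rewrite xE; apply: le_trans (snD p1 _ _) _.
apply: le_trans (lerD (snB p1 _ _) (snD p1 _ _)) _.
have b1 : KX 1 u1 <= (A + 1) * expR (- (n%:R * c)).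
  apply: le_trans (kf_le0 hX ltr01 U1) _; rewrite expRK ler_wpM2l ?addr_ge0//.
  by rewrite ler_expR mulNr lerN2 ler_wpM2l.
have b2 : KX 1 v2 <= (A + 1) * expR (- (n%:R * c)).
  apply: le_trans (kf_le1 hX ltr01 V2) _; rewrite mul1r expRK -mulrA -expRN -expRD.
  by rewrite ler_wpM2l ?addr_ge0// ler_expR -{2}[n%:R]mulr1 -mulrBr -mulrN ler_wpM2l//; lra.
have bw w s : `|ln s| = n%:R -> KX 1 w <= D * expR (- (dl * `|ln s|)) -> KX 1 w <= D * expR (- (n%:R * c)).
  move=> -> /le_trans; apply; rewrite ler_wpM2l// ler_expR lerN2 mulrC.
  by rewrite ler_wpM2r.
have b3 := bw w1 _ _ W1; have b4 := bw w2 _ _ W2.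
have {}b3 := b3 ltac:(by rewrite expRK normrN ger0_norm).
have {}b4 := b4 ltac:(by rewrite expRK ger0_norm).
apply: le_trans (lerD (lerD b1 b3) (lerD b4 b2)) _; apply: le_trans Hn.
by apply: eq_ler; ring.
Qed.

(** The function [t^(- theta) K(t, x)] in the variable [s = ln t], in which dilations by powers of
    [e] are integer translations. *)
Local Notation bX := (fun (x : V) (s : R) => KX (expR s) x * expR (- (s * theta))).
Local Notation bY := (fun (y : W) (s : R) => KY (expR s) y * expR (- (s * theta))).

Lemma power_bounded_ge0 (U : lmodType C) (P0 P1 : U -> \bar R) (hU : is_couple P0 P1) x A :
  power_bounded P0 P1 x A -> 0 <= A.
Proof.
move=> /(_ 1 ltr01); rewrite ln1 mul0r expR0 mulr1; apply: le_trans.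
exact: (kf_ge0 hU).
Qed.

Lemma kf_gt0 (U : lmodType C) (P0 P1 : U -> \bar R) (hU : is_couple P0 P1) t x :
  0 < t -> x != 0 -> 0 < kf P0 P1 t x.
Proof.
move=> t0 x0; rewrite lt_def (kf_ge0 hU)// andbT; apply: contraNneq x0 => K0.
apply/eqP; apply: (kf1_eq0 hU); apply/eqP; rewrite eq_le (kf_ge0 hU)// andbT.
by apply: le_trans (kf1_max hU _ t0) _; rewrite K0 mulr0.
Qed.

(** The preimage is assembled on the grid of integer translates of [s0], hence may depend on [s0].
    [Bd] stands for the damped supremum of [bY y] over that grid. *)
Lemma real_inverse_at : exists Cr ep : R, [/\ 0 < Cr, 0 < ep &
  forall y A s0, power_bounded M0 M1 y A ->
  exists x A', [/\ T x = y, power_bounded N0 N1 x A' &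
    forall Bd, (forall n : nat, bY y (s0 + n%:R) * expR (- (ep * n%:R)) <= Bd) ->
      (forall n : nat, bY y (s0 - n%:R) * expR (- (ep * n%:R)) <= Bd) ->
      bX x s0 <= Cr * Bd]].
Proof.
have h0 : is_enorm M0 by case: hY => -[].
have h1 : is_enorm M1 by case: hY => -[].
have q1 := kf_seminorm hY ltr01.
have [cT cT0 [hb0 hb1 hbK]] := couple_operator_bound.
have [Cc [dl [Cc0 dl0 core]]] := core_two_sided.
(* Half of the decay pays for the growth that [Bd] allows, the other half makes the sums
   converge. *)
pose ep := dl / 2; have ep0 : 0 < ep by rewrite divr_gt0.
have [L L0 HL] := sum_expR_dist dl0; have [L' L'0 HL'] := sum_expR_dist ep0.
pose E : R := expR 1; have E1 : 1 <= E by rewrite -[leLHS]expR0 ler_expR.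
have E0 : 0 < E by exact: expR_gt0.
(* A piece is a difference of two parts of size [2 K], at neighbouring grid points, between which
   [K] grows by at most [E]. *)
pose C1 := Cc * (4 * E); have C10 : 0 < C1 by rewrite !mulr_gt0.
exists (C1 * (2 * L' + 1)), ep; split => //.
  by rewrite mulr_gt0// ltr_wpDl// mulr_ge0.
move=> y A s0 yA; have A0 := power_bounded_ge0 hY yA.
(* For [y != 0] every [K] is positive, so decompositions of cost below [2 K] exist. *)
have [->|y0] := eqVneq y 0.
  exists 0, 0; split; first by rewrite linear0.
    by move=> t t0; rewrite (sn0 (kf_seminorm hX t0)) mul0r.
  move=> Bd /(_ 0%N) HB _.
  rewrite (sn0 (kf_seminorm hX (expR_gt0 _))) mul0r mulr_ge0//.
    by rewrite mulr_ge0 ?(ltW C10)// addr_ge0// mulr_ge0.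
  by apply: le_trans HB; rewrite (sn0 (kf_seminorm hY (expR_gt0 _))) !mul0r.
have Kp s : 0 < KY (expR s) y by apply: (kf_gt0 hY) => //; exact: expR_gt0.
have bA s : bY y s <= A.
  have := yA _ (expR_gt0 s); rewrite expRK => H.
  by rewrite expRN ler_pdivrMr ?expR_gt0.
have KA s : KY (expR s) y <= A * expR (s * theta).
  by have := yA _ (expR_gt0 s); rewrite expRK.
have b0 s : 0 <= bY y s by rewrite mulr_ge0 ?expR_ge0// ltW.
have KE s : KY (expR s) y = bY y s * expR (s * theta).
  by rewrite -mulrA -expRD addNr expR0 mulr1.
have dec s : exists uv : W * W, [/\ uv.1 + uv.2 = y,
    (M0 uv.1 <= (2 * KY (expR s) y)%:E)%E & (M1 uv.2 <= (2 * KY (expR s) y / expR s)%:E)%E].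
  have [|u [v [r0 [r1 [uv F0 F1 [r00 r10] L1]]]]] :=
      @kf_decomp _ _ _ _ hY (expR s) y (2 * KY (expR s) y) (expR_gt0 s).
    by rewrite ltr_pMl// ltr1n.
  exists (u, v); split => //=.
    by rewrite F0 lee_fin; apply: le_trans (ltW L1); rewrite lerDl mulr_ge0 ?expR_ge0.
  by rewrite F1 lee_fin ler_pdivlMr ?expR_gt0// mulrC; apply: le_trans (ltW L1); rewrite lerDr.
have [UV HUV] := choice dec.
pose piece s := (UV (s + 1)).1 - (UV s).1.
have K1 s : KY (expR (s + 1)) y <= E * KY (expR s) y.
  have := @kf_ratio _ _ _ _ hY (expR s) (expR (s + 1)) y (expR_gt0 s).
  rewrite ler_expR lerDl ler01 => /(_ isT)/le_trans; apply.
  by rewrite expRD (mulrC (expR s)) mulfK// gt_eqF// expR_gt0.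
have pieces s : exists x, T x = piece s /\ forall t, 0 < t ->
    KX t x <= C1 * bY y s * expR (ln t * theta) * expR (- (dl * `|ln t - s|)).
  have [e1 m1 n1] := HUV s; have [e2 m2 n2] := HUV (s + 1).
  have J0 : 0 < 4 * E * KY (expR s) y by rewrite !mulr_gt0.
  have Kge := Kp s; have K1s := K1 s.
  have EK : KY (expR s) y <= E * KY (expR s) y by rewrite ler_peMl// ltW.
  have b_0 : (M0 (piece s) <= (4 * E * KY (expR s) y)%:E)%E.
    by apply: le_trans (enB h0 m2 m1) _; rewrite lee_fin; lra.
  have b_1 : (M1 (piece s) <= (4 * E * KY (expR s) y / expR s)%:E)%E.
    (* Both decompositions sum to [y], so the piece is also a difference of second parts and lies in
       [Y1]. *)
    have -> : piece s = (UV s).2 - (UV (s + 1)).2.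
      have a1 : (UV (s + 1)).1 = y - (UV (s + 1)).2 by rewrite -[in RHS]e2 addrK.
      have a2 : (UV s).1 = y - (UV s).2 by rewrite -[in RHS]e1 addrK.
      by rewrite /piece a1 a2; lincomb_goal (R[i]) W; ring.
    apply: le_trans (enB h1 n1 n2) _; rewrite lee_fin.
    have : 2 * KY (expR (s + 1)) y / expR (s + 1) <= 2 * KY (expR s) y / expR s.
      rewrite [X in _ / X <= _]expRD invfM -/E (mulrC (expR s)^-1) mulrA ler_wpM2r ?invr_ge0 ?expR_ge0//.
      by rewrite ler_pdivrMr// -mulrA ler_wpM2l// mulrC.
    have : KY (expR s) y / expR s <= E * KY (expR s) y / expR s.
      by rewrite ler_wpM2r ?invr_ge0 ?expR_ge0.
    by lra.
  have [x [_ Tx Kx]] := core _ _ _ (expR_gt0 s) J0 b_0 b_1.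
  exists x; split => // t t0; apply: le_trans (Kx t t0) _; rewrite expRK; apply: eq_ler.
  by rewrite KE mulrBl expRD expRN /C1; field; rewrite gt_eqF ?expR_gt0.
have [X HX] := choice pieces.
(* The index [i.+1] on the left makes the pieces adjacent, so that [T (S m)] telescopes between
   [s0 - m] and [s0 + m]. *)
pose S m := \sum_(i < m) (X (s0 + i%:R) + X (s0 - i.+1%:R)).
pose et : R := expR s0.
have et0 : 0 < et by exact: expR_gt0.
have dist1 t i : expR (- (dl * `|ln t - (s0 + i%:R)|)) = expR (- (dl * `|ln t - s0 - i%:R|)).
  by congr expR; congr (- (dl * `| _ |)); ring.
have dist2 t (i : nat) : expR (- (dl * `|ln t - (s0 - i.+1%:R)|)) =
    expR (- (dl * `|(s0 - ln t - 1) - i%:R|)).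
  by congr expR; rewrite distrC; congr (- (dl * `| _ |)); rewrite -natr1; ring.
have Sbound t m : 0 < t -> KX t (S m) <= C1 * A * expR (ln t * theta) * (2 * L).
  move=> t0; have pt := kf_seminorm hX t0.
  set F := C1 * A * _.
  have F0 : 0 <= F by apply: mulr_ge0; [apply: mulr_ge0 => //; exact: ltW|exact: expR_ge0].
  have one s : KX t (X s) <= F * expR (- (dl * `|ln t - s|)).
    apply: le_trans ((HX s).2 t t0) _; rewrite ler_wpM2r ?expR_ge0//.
    by rewrite ler_wpM2r ?expR_ge0// ler_wpM2l ?(ltW C10)// bA.
  apply: le_trans (_ : F * \sum_(i < m) expR (- (dl * `|ln t - s0 - i%:R|)) +
     F * \sum_(i < m) expR (- (dl * `|(s0 - ln t - 1) - i%:R|)) <= _); last first.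
    rewrite -mulrDr ler_wpM2l//; have := HL (ln t - s0) m; have := HL (s0 - ln t - 1) m.
    by move=> ? ?; lra.
  rewrite /S; elim: m => [|m IH]; first by rewrite !big_ord0 (sn0 pt) mulr0 addr0.
  rewrite !big_ord_recr /= !mulrDr; apply: le_trans (snD pt _ _) _.
  have := one (s0 + m%:R); have := one (s0 - m.+1%:R); rewrite dist1 dist2.
  by have := snD pt (X (s0 + m%:R)) (X (s0 - m.+1%:R)) => *; lra.
have q01 : 0 < expR (- dl) < 1 by rewrite expR_gt0 -[ltRHS]expR0 ltr_expR oppr_lt0.
pose F := C1 * A * expR (s0 * theta).
have F0 : 0 <= F by apply: mulr_ge0; [apply: mulr_ge0 => //; exact: ltW|exact: expR_ge0].
have powE (n : nat) : expR (- dl) ^+ n = expR (- (dl * n%:R)).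
  by rewrite -expRM_natl; congr expR; ring.
(* Increments are estimated at [et = e^s0], from which the [n]-th two pieces are at logarithmic
   distance at least [n]; [max 1 et^-1] carries the bound to [K(1, .)]. *)
have [||x Hx] := @couple_complete _ _ _ _ hX S (Num.max 1 et^-1 * (2 * F)) _ q01.
- by apply: mulr_ge0; [rewrite le_max ler01|exact: mulr_ge0].
- move=> n; rewrite /S big_ord_recr /= addrAC subrr add0r -mulrA.
  apply: le_trans (kf1_max hX _ et0) _.
  rewrite ler_wpM2l ?le_max ?ler01//.
  apply: le_trans (snD (kf_seminorm hX et0) _ _) _.
  have one s : KX et (X s) <= F * expR (- (dl * `|s0 - s|)).
    apply: le_trans ((HX s).2 et et0) _; rewrite expRK ler_wpM2r ?expR_ge0//.
    by rewrite ler_wpM2r ?expR_ge0// ler_wpM2l ?(ltW C10)// bA.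
  have := one (s0 + n%:R); have := one (s0 - n.+1%:R).
  rewrite subKr opprD addrA subrr sub0r normrN !ger0_norm ?ler0n// powE.
  have : F * expR (- (dl * n.+1%:R)) <= F * expR (- (dl * n%:R)).
    by rewrite ler_wpM2l// ler_expR lerN2 ler_wpM2l ?(ltW dl0)// ler_nat.
  by move=> *; lra.
have lim_le t c : 0 < t -> (forall m, KX t (S m) <= c) -> KX t x <= c.
  move=> t0 Hc; apply/ler_addgt0Pr => e e0.
  have m0 : 0 < Num.max 1 t by rewrite lt_max ltr01.
  have [M HM] := Hx _ (divr_gt0 e0 m0).
  have pt := kf_seminorm hX t0.
  have -> : x = S M - (S M - x) by rewrite subKr.
  apply: le_trans (snB pt _ _) _; apply: lerD => //.
  apply: le_trans (kf_max1 hX _ t0) _; rewrite -ler_pdivlMl// mulrC.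
  by apply: ltW; exact: HM.
exists x, (C1 * A * (2 * L)); split.
- apply/eqP; rewrite eq_sym -subr_eq0; apply/eqP; apply: (kf1_le_eps hY) => e e0.
  have TS m : T (S m) = (UV (s0 + m%:R)).1 - (UV (s0 - m%:R)).1.
    rewrite /S; elim: m => [|m IH]; first by rewrite big_ord0 linear0 addr0 subr0 subrr.
    rewrite big_ord_recr /= linearD IH linearD (HX _).1 (HX _).1 /piece.
    have -> : s0 + m%:R + 1 = s0 + m.+1%:R by rewrite -natr1 addrA.
    have -> : s0 - m.+1%:R + 1 = s0 - m%:R by rewrite -natr1; ring.
    by lincomb_goal (R[i]) W; ring.
  (* The error [y - T (S m)] is the first part of [y] at [s0 - m], which vanishes since [theta > 0],
     plus the second part at [s0 + m], which vanishes since [theta < 1]. *)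
  case/andP: htheta => th0 th1; have th1' : 0 < 1 - theta by rewrite subr_gt0.
  have e4 : 0 < e / 3 by rewrite divr_gt0.
  have a10 : 0 <= 2 * A * expR (- (s0 * (1 - theta))) by rewrite !mulr_ge0 ?expR_ge0.
  have a20 : 0 <= 2 * A * expR (s0 * theta) by rewrite !mulr_ge0 ?expR_ge0.
  have [n1 H1] := expR_vanish th1' a10 e4.
  have [n2 H2] := expR_vanish th0 a20 e4.
  have [n3 H3] := Hx _ (divr_gt0 e4 cT0).
  pose m := maxn n1 (maxn n2 n3).
  have {}H1 := H1 m (leq_maxl _ _).
  have {}H2 := H2 m (leq_trans (leq_maxl _ _) (leq_maxr _ _)).
  have {}H3 := H3 m (leq_trans (leq_maxr _ _) (leq_maxr _ _)).
  have -> : y - T x = (y - T (S m)) + T (S m - x) by rewrite linearB addrA subrK.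
  apply: le_trans (snD q1 _ _) _.
  have k3 : KY 1 (T (S m - x)) <= e / 3.
    apply: le_trans (hbK 1 _ ltr01) _; rewrite -ler_pdivlMl// mulrC; exact: ltW.
  have [g1 g2 g3] := HUV (s0 + m%:R); have [g4 g5 g6] := HUV (s0 - m%:R).
  have yE : y - T (S m) = (UV (s0 - m%:R)).1 + (UV (s0 + m%:R)).2.
    by rewrite TS -{1}g1; lincomb_goal (R[i]) W; ring.
  have k1 : KY 1 (UV (s0 - m%:R)).1 <= e / 3.
    apply: le_trans (kf_le0 hY ltr01 g5) _; apply: le_trans H2.
    apply: le_trans (_ : 2 * (A * expR ((s0 - m%:R) * theta)) <= _).
      by rewrite ler_wpM2l.
    rewrite -!mulrA -expRD; apply: eq_ler; congr (_ * (_ * expR _)); ring.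
  have k2 : KY 1 (UV (s0 + m%:R)).2 <= e / 3.
    apply: le_trans (kf_le1 hY ltr01 g3) _; apply: le_trans H1.
    rewrite mul1r -expRN.
    apply: le_trans (_ : 2 * (A * expR ((s0 + m%:R) * theta)) * expR (- (s0 + m%:R)) <= _).
      by rewrite ler_wpM2r ?expR_ge0// ler_wpM2l.
    rewrite -!mulrA -!expRD; apply: eq_ler; congr (_ * (_ * expR _)); ring.
  by rewrite yE; have := snD q1 (UV (s0 - m%:R)).1 (UV (s0 + m%:R)).2 => ?; lra.
- move=> t t0; apply: lim_le => // m; apply: le_trans (Sbound t m t0) _.
  by apply: eq_ler; ring.
move=> Bd Bp Bm.
have Bd0 : 0 <= Bd.
  by apply: le_trans (Bp 0%N); rewrite mulr_ge0 ?expR_ge0// b0.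
rewrite expRN ler_pdivrMr ?expR_gt0//.
have half n (z : R) : z = n%:R -> 0 <= n%:R :> R -> forall s,
    bY y s * expR (- (ep * n%:R)) <= Bd -> bY y s * expR (- (dl * z)) <= Bd * expR (- (ep * z)).
  move=> -> n0 s Hs; have -> : - (dl * n%:R) = - (ep * n%:R) + - (ep * n%:R).
    by rewrite /ep; field.
  by rewrite expRD mulrA ler_wpM2r ?expR_ge0.
apply: lim_le => // m; have pt := kf_seminorm hX et0.
apply: le_trans (_ : C1 * expR (s0 * theta) * (Bd * \sum_(i < m) expR (- (ep * `|0 - i%:R|)) +
     Bd * \sum_(i < m) expR (- (ep * `|-1 - i%:R|))) <= _); last first.
  have := HL' 0 m; have := HL' (-1) m.
  set Z1 := \sum_(i < m) _; set Z2 := \sum_(i < m) _ => z1 z2.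
  rewrite [leLHS](_ : _ = C1 * expR (s0 * theta) * Bd * (Z1 + Z2)); last by ring.
  rewrite [leRHS](_ : _ = C1 * expR (s0 * theta) * Bd * (2 * L' + 1)); last by ring.
  apply: ler_wpM2l; last by lra.
  by apply: mulr_ge0 => //; apply: mulr_ge0; [exact: ltW|exact: expR_ge0].
rewrite /S; elim: m => [|m IH]; first by rewrite !big_ord0 (sn0 pt) !mulr0 addr0 mulr0.
rewrite !big_ord_recr /= ; apply: le_trans (snD pt _ _) _.
have one s : KX et (X s) <= C1 * expR (s0 * theta) * (bY y s * expR (- (dl * `|s0 - s|))).
  apply: le_trans ((HX s).2 et et0) _; rewrite expRK; apply: eq_ler; ring.
have Ce0 : 0 <= C1 * expR (s0 * theta) by rewrite mulr_ge0 ?expR_ge0 ?ltW.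
have k1 : KX et (X (s0 + m%:R)) <= C1 * expR (s0 * theta) * (Bd * expR (- (ep * `|0 - m%:R|))).
  apply: le_trans (one _) _; rewrite ler_wpM2l// opprD addrA subrr.
  by apply: (half m) => //; rewrite sub0r normrN ger0_norm.
have k2 : KX et (X (s0 - m.+1%:R)) <= C1 * expR (s0 * theta) * (Bd * expR (- (ep * `|-1 - m%:R|))).
  apply: le_trans (one _) _; rewrite ler_wpM2l// subKr.
  rewrite (_ : `|-1 - m%:R| = `|m.+1%:R| :> R); last first.
    by rewrite -normrN -natr1; congr `| _ |; ring.
  by apply: (half m.+1) => //; rewrite ger0_norm.
have := snD pt (X (s0 + m%:R)) (X (s0 - m.+1%:R)).
move: IH k1 k2; rewrite !mulrDr => *; lra.
Qed.

(** By [real_injective] the preimages built for different [s0] coincide, so one [x] satisfies the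
    estimate at all [s0]. *)
Lemma real_inverse : exists Cr ep : R, [/\ 0 < Cr, 0 < ep,
  forall y A, power_bounded M0 M1 y A ->
    exists x A', T x = y /\ power_bounded N0 N1 x A' &
  forall x A s0 Bd, power_bounded N0 N1 x A ->
    (forall n : nat, bY (T x) (s0 + n%:R) * expR (- (ep * n%:R)) <= Bd) ->
    (forall n : nat, bY (T x) (s0 - n%:R) * expR (- (ep * n%:R)) <= Bd) ->
    bX x s0 <= Cr * Bd].
Proof.
have [Cr [ep [Cr0 ep0 H]]] := real_inverse_at.
have [cT cT0 [_ _ hbK]] := couple_operator_bound.
exists Cr, ep; split => //.
  by move=> y A yA; have [x [A' [Tx xA' _]]] := H y A 0 yA; exists x, A'.
move=> x A s0 Bd xA Bp Bm.
have TxA : power_bounded M0 M1 (T x) (cT * A).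
  move=> t t0; apply: le_trans (hbK _ _ t0) _.
  by rewrite -mulrA ler_wpM2l ?(ltW cT0)// xA.
have [x' [A' [Tx' x'A' Hx']]] := H _ _ s0 TxA.
suff -> : x = x' by exact: Hx'.
apply/eqP; rewrite -subr_eq0; apply/eqP.
apply: (real_injective (A := A + A')).
  by rewrite linearB Tx' subrr.
move=> t t0; apply: le_trans (snB (kf_seminorm hX t0) _ _) _.
by rewrite mulrDl; apply: lerD; [exact: xA|exact: x'A'].
Qed.

End Inversion.

(** * The real interpolation norms *)

Section Dilation.
Context {R : realType}.
Local Notation mu := (@lebesgue_measure R).
Local Notation D := (`]0, +oo[%classic : set R).

Lemma mulr_preimage_oc (l a b : R) : 0 < l ->
  ( *%R l) @^-1` `]a, b]%classic = `]a / l, b / l]%classic.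
Proof.
move=> l0; apply/seteqP; split => x /=; rewrite !in_itv/= => /andP[h1 h2].
  by rewrite ltr_pdivrMr// ler_pdivlMr// mulrC h1.
by rewrite mulrC -ltr_pdivrMr// -ler_pdivlMr// h1.
Qed.

(** The scaled image measure agrees with Lebesgue measure on half-open intervals, and uniqueness
    does the rest. *)
Lemma lebesgue_measure_dilation (l : R) (l0 : 0 < l) (A : set R) : measurable A ->
  (l%:E * mu (( *%R l) @^-1` A))%E = mu A.
Proof.
move=> mA.
have mphi : measurable_fun setT ( *%R l : measurableTypeR R -> measurableTypeR R).
  exact: mulrl_measurable.
pose phi : {mfun measurableTypeR R >-> measurableTypeR R} :=
  HB.pack ( *%R l : measurableTypeR R -> measurableTypeR R)
    (isMeasurableFun.Build _ _ _ _ _ mphi).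
pose ln : {nonneg R} := NngNum (ltW l0).
rewrite (@lebesgue_measure_unique R (mscale ln (pushforward mu phi)) _ A mA)//.
move=> _ [[a b]] _ <-.
transitivity (l%:E * mu (( *%R l) @^-1` `]a, b]%classic))%E => //.
rewrite mulr_preimage_oc//.
rewrite !lebesgue_measure_itv/= !lte_fin ltr_pM2r ?invr_gt0//.
case: ifP => _; last by rewrite mule0.
by rewrite -!EFinB -EFinM; congr EFin; field; rewrite gt_eqF.
Qed.

Lemma measurable_dilation (l : R) (g : R -> R) : 0 < l ->
  measurable_fun D (fun t => (g t / t)%:E) ->
  measurable_fun D (fun t => (g (l * t) / t)%:E).
Proof.
move=> l0 mg.
have sub : ( *%R l) @` D `<=` D.
  by move=> _ [x /= xD <-]; move: xD; rewrite !in_itv/= !andbT pmulr_rgt0.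
have := measurable_comp (measurable_itv _) sub mg (mulrl_measurable l).
move=> /(measurable_funeM l%:E); apply: eq_measurable_fun => t /set_mem.
rewrite /= in_itv/= andbT => t0.
by rewrite -EFinM; congr EFin; field; rewrite !gt_eqF.
Qed.

Lemma integral_dilation (l : R) (g : R -> R) : 0 < l ->
  (forall t, 0 < t -> 0 <= g t) -> measurable_fun D (fun t => (g t / t)%:E) ->
  (\int[mu]_(t in D) (g (l * t) / t)%:E = \int[mu]_(t in D) (g t / t)%:E)%E.
Proof.
move=> l0 g0 mg.
have mphi : measurable_fun setT ( *%R l : measurableTypeR R -> measurableTypeR R).
  exact: mulrl_measurable.
have li0 : 0 <= l^-1 by rewrite invr_ge0 ltW.
pose ln : {nonneg R} := NngNum li0.
pose h (t : R) := (g t / t)%:E.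
have h0 t : D t -> (0 <= h t)%E.
  by rewrite /= in_itv/= andbT => t0; rewrite lee_fin divr_ge0 ?g0 ?ltW.
have phiD : ( *%R l) @^-1` D = D.
  by apply/seteqP; split => x /=; rewrite !in_itv/= !andbT pmulr_rgt0.
have mhl : measurable_fun D (h \o *%R l).
  have sub : ( *%R l) @` D `<=` D.
    by move=> _ [x /= xD <-]; move: xD; rewrite !in_itv/= !andbT pmulr_rgt0.
  exact: (measurable_comp (measurable_itv _) sub mg (mulrl_measurable l)).
transitivity (l%:E * \int[mu]_(t in D) (h \o *%R l) t)%E.
  rewrite -ge0_integralZl_EFin//; last 2 first.
  - by move=> t; rewrite -{1}phiD => /h0.
  - exact: ltW.
  apply: eq_integral => t /set_mem; rewrite /= in_itv/= andbT => t0.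
  by rewrite /h /= -EFinM; congr EFin; field; rewrite !gt_eqF.
rewrite -{1}phiD -(ge0_integral_pushforward mphi)//; last first.
  by move=> y /set_mem; exact: h0.
rewrite (eq_measure_integral (mscale ln mu)); last first.
  move=> A mA _; transitivity (l^-1%:E * (l%:E * mu (( *%R l) @^-1` A)))%E.
    by rewrite muleA -EFinM mulVf ?gt_eqF// mul1e.
  by rewrite (lebesgue_measure_dilation l0 mA).
by rewrite ge0_integral_mscale//= muleA -EFinM divff ?gt_eqF// mul1e.
Qed.

Definition log_integral (g : R -> R) : \bar R := (\int[mu]_(t in D) (g t / t)%:E)%E.

Lemma log_integral_ge0 (g : R -> R) : (forall t, 0 < t -> 0 <= g t) ->
  (0 <= log_integral g)%E.
Proof.
move=> g0; apply: integral_ge0 => t; rewrite /= in_itv/= andbT => t0.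
by rewrite lee_fin divr_ge0 ?g0// ltW.
Qed.

Lemma log_integral_le (f g : R -> R) (c : R) : 0 <= c ->
  (forall t, 0 < t -> 0 <= f t) -> (forall t, 0 < t -> 0 <= g t) ->
  measurable_fun D (fun t => (f t / t)%:E) -> measurable_fun D (fun t => (g t / t)%:E) ->
  (forall t, 0 < t -> f t <= c * g t) -> (log_integral f <= c%:E * log_integral g)%E.
Proof.
move=> c0 f0 g0 mf mg fg.
have h0 t : D t -> (0 <= (g t / t)%:E)%E.
  by rewrite /= in_itv/= andbT => t0; rewrite lee_fin divr_ge0 ?g0// ltW.
rewrite /log_integral -ge0_integralZl_EFin//.
apply: ge0_le_integral => //.
- by move=> t; rewrite /= in_itv/= andbT => t0; rewrite lee_fin divr_ge0 ?f0// ltW.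
- exact: measurable_funeM.
- move=> t; rewrite /= in_itv/= andbT => t0.
  by rewrite -EFinM lee_fin mulrA ler_wpM2r ?invr_ge0 ?(ltW t0)// fg.
Qed.

Lemma geometric_eseries_le (rho : R) : 0 < rho < 1 ->
  (\sum_(n <oo) (rho ^+ n)%:E <= ((1 - rho)^-1)%:E)%E.
Proof.
move=> /andP[r0 r1].
apply: lime_le.
  by apply: is_cvg_nneseries => n _ _; rewrite lee_fin exprn_ge0// ltW.
near=> n; rewrite sumEFin lee_fin.
suff -> : \sum_(0 <= i < n) rho ^+ i = (1 - rho ^+ n) / (1 - rho).
  rewrite ler_pdivrMr ?subr_gt0// mulVf ?gt_eqF ?subr_gt0//.
  by rewrite gerBl exprn_ge0// ltW.
elim: (n) => [|k IH]; first by rewrite big_nil expr0 subrr mul0r.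
rewrite big_nat_recr//= IH exprS; field.
by rewrite gt_eqF// subr_gt0.
Unshelve. all: by end_near. Qed.

Lemma ge0_integral_scaled_sum (k : R) (f g : R -> \bar R) : 0 <= k ->
  (forall t, D t -> (0 <= f t)%E) -> (forall t, D t -> (0 <= g t)%E) ->
  measurable_fun D f -> measurable_fun D g ->
  (\int[mu]_(t in D) (k%:E * (f t + g t)) =
   k%:E * (\int[mu]_(t in D) f t + \int[mu]_(t in D) g t))%E.
Proof.
move=> k0 f0 g0 mf mg; rewrite ge0_integralZl_EFin//; last 2 first.
- by move=> t tD; apply: adde_ge0; [exact: f0|exact: g0].
- exact: emeasurable_funD.
by congr (_ * _)%E; rewrite ge0_integralD.
Qed.

(* A pointwise bound by a geometrically damped supremum over the dilations by
   powers of [e] is integrated after replacing the supremum by a sum. *)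
Lemma log_integral_damped (r Cr ep : R) : 0 < r -> 0 < Cr -> 0 < ep ->
  exists2 K, 0 < K & forall a b : R -> R,
  (forall t, 0 < t -> 0 <= a t) -> (forall t, 0 < t -> 0 <= b t) ->
  measurable_fun D (fun t => (a t `^ r / t)%:E) ->
  measurable_fun D (fun t => (b t `^ r / t)%:E) ->
  (forall t Bd, 0 < t ->
    (forall n : nat, b (expR n%:R * t) * expR (- (ep * n%:R)) <= Bd) ->
    (forall n : nat, b (expR (- n%:R) * t) * expR (- (ep * n%:R)) <= Bd) ->
    a t <= Cr * Bd) ->
  (log_integral (fun t => ((a t) `^ r)%R) <= K%:E * log_integral (fun t => ((b t) `^ r)%R))%E.
Proof.
move=> r0 Cr0 ep0.
(* The [r]-th power of the damping over one step; the sum of its powers, for upward and downward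
   dilations, gives the factor [2 / (1 - rho)]. *)
pose rho := expR (- (ep * r)).
have rho01 : 0 < rho < 1 by rewrite expR_gt0 -[ltRHS]expR0 ltr_expR oppr_lt0 mulr_gt0.
have /andP[rho0 rho1] := rho01.
exists (Cr `^ r * (2 / (1 - rho))).
  by rewrite mulr_gt0 ?powR_gt0// divr_gt0// subr_gt0.
move=> a b a0 b0 ma mb dom.
pose I := log_integral (fun t => ((b t) `^ r)%R).
have I0 : (0 <= I)%E by apply: log_integral_ge0 => t _; exact: powR_ge0.
pose up (n : nat) (t : R) : \bar R := ((b (expR n%:R * t)) `^ r / t)%:E.
pose dn (n : nat) (t : R) : \bar R := ((b (expR (- n%:R) * t)) `^ r / t)%:E.
pose u (n : nat) (t : R) : \bar R := ((rho ^+ n)%:E * (up n t + dn n t))%E.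
have mup n : measurable_fun D (up n).
  exact: (@measurable_dilation _ (fun t => ((b t) `^ r)%R) (expR_gt0 _) mb).
have mdn n : measurable_fun D (dn n).
  exact: (@measurable_dilation _ (fun t => ((b t) `^ r)%R) (expR_gt0 _) mb).
have rn0 n : 0 <= rho ^+ n by rewrite exprn_ge0// ltW.
have up0 n t : D t -> (0 <= up n t)%E.
  by rewrite /= in_itv/= andbT => t0; rewrite lee_fin divr_ge0 ?powR_ge0// ltW.
have dn0 n t : D t -> (0 <= dn n t)%E.
  by rewrite /= in_itv/= andbT => t0; rewrite lee_fin divr_ge0 ?powR_ge0// ltW.
have u0 n t : D t -> (0 <= u n t)%E.
  by move=> tD; apply: mule_ge0; [rewrite lee_fin|apply: adde_ge0; [exact: up0|exact: dn0]].
have mu_ n : measurable_fun D (u n).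
  by apply: measurable_funeM; exact: (emeasurable_funD (mup n) (mdn n)).
have Iup n : (\int[mu]_(t in D) up n t = I)%E.
  exact: (@integral_dilation _ (fun t => ((b t) `^ r)%R) (expR_gt0 _) (fun t _ => powR_ge0 _ _) mb).
have Idn n : (\int[mu]_(t in D) dn n t = I)%E.
  exact: (@integral_dilation _ (fun t => ((b t) `^ r)%R) (expR_gt0 _) (fun t _ => powR_ge0 _ _) mb).
have Iu n : (\int[mu]_(t in D) u n t = (rho ^+ n)%:E * (I + I))%E.
  rewrite -{1}(Iup n) -(Idn n).
  exact: ge0_integral_scaled_sum (rn0 n) (up0 n) (dn0 n) (mup n) (mdn n).
have Crr : 0 <= Cr `^ r by exact: powR_ge0.
have step1 : (log_integral (fun t => ((a t) `^ r)%R) <=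
    (Cr `^ r)%:E * \sum_(n <oo) ((rho ^+ n)%:E * (I + I)))%E.
  have -> : (\sum_(n <oo) ((rho ^+ n)%:E * (I + I)) = \sum_(n <oo) \int[mu]_(t in D) u n t)%E.
    by apply: eq_eseriesr => n _; rewrite Iu.
  rewrite -integral_nneseries//.
  have ms : measurable_fun D (fun t => \sum_(n <oo) u n t)%E.
    by apply: ge0_emeasurable_sum => // n t tD _; exact: u0.
  rewrite -ge0_integralZl_EFin//; last first.
    by move=> t tD; apply: nneseries_ge0 => n _ _; exact: u0.
  apply: ge0_le_integral => //.
  - by move=> t; rewrite /= in_itv/= andbT => t0; rewrite lee_fin divr_ge0 ?powR_ge0// ltW.
  - exact: measurable_funeM.
  move=> t tD; have t0 : 0 < t by move: tD; rewrite /= in_itv/= andbT.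
  have s0 : (0 <= \sum_(n <oo) u n t)%E by apply: nneseries_ge0 => n _ _; exact: u0.
  have le_s n : (u n t <= \sum_(n <oo) u n t)%E.
    rewrite (@nneseriesD1 _ _ n)//; last by move=> k _; exact: u0.
    by rewrite leeDl// nneseries_ge0// => k _ _; exact: u0.
  case E : (\sum_(n <oo) u n t)%E s0 le_s => [sg| |] s0 le_s //; last first.
    by rewrite gt0_muley ?leey// lte_fin powR_gt0.
  rewrite lee_fin in s0.
  (* Each term is at most the whole sum [sg], so [(t sg)^(1 / r)] can serve as [Bd]. *)
  have bnd n (x : R) : 0 <= x -> ((rho ^+ n * (x `^ r / t))%:E <= u n t)%E ->
      x * expR (- (ep * n%:R)) <= (t * sg) `^ r^-1.
    move=> x0 xu; have := le_trans xu (le_s n); rewrite lee_fin => H.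
    have {}H : x `^ r * rho ^+ n <= t * sg.
      by move: H; rewrite mulrA ler_pdivrMr// mulrC [leRHS]mulrC.
    have y0 : 0 <= x * expR (- (ep * n%:R)) by rewrite mulr_ge0 ?expR_ge0.
    have -> : x * expR (- (ep * n%:R)) = ((x * expR (- (ep * n%:R))) `^ r) `^ r^-1.
      by rewrite -powRrM divff ?gt_eqF// powRr1.
    apply: ge0_ler_powR; rewrite ?nnegrE ?powR_ge0 ?invr_ge0 ?(ltW r0) ?mulr_ge0 ?(ltW t0)//.
    apply: le_trans H; rewrite powRM ?expR_ge0//; apply: eq_ler; congr (_ * _).
    rewrite /rho -expRM_natl /powR gt_eqF ?expR_gt0// expRK.
    by congr expR; ring.
  have at_ : a t <= Cr * (t * sg) `^ r^-1.
    apply: dom => // n; apply: bnd; rewrite ?b0 ?mulr_gt0 ?expR_gt0//.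
      by rewrite EFinM; apply: lee_wpmul2l; [rewrite lee_fin|apply: leeDl; exact: dn0].
    by rewrite EFinM; apply: lee_wpmul2l; [rewrite lee_fin|apply: leeDr; exact: up0].
  rewrite -EFinM lee_fin ler_pdivrMr//.
  apply: le_trans (_ : (Cr * (t * sg) `^ r^-1) `^ r <= _).
    apply: ge0_ler_powR; rewrite ?nnegrE ?(ltW r0) ?a0// mulr_ge0 ?powR_ge0// ltW//.
  rewrite powRM ?powR_ge0 ?(ltW Cr0)// -powRrM mulVf ?gt_eqF// powRr1.
    by apply: eq_ler; ring.
  by rewrite mulr_ge0// ltW.
apply: le_trans step1 _; rewrite EFinM -muleA; apply: lee_wpmul2l; rewrite ?lee_fin//.
rewrite -/I; case: I I0 {Iu Iup Idn} => [j| |] // j0; last first.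
  by rewrite gt0_muley ?leey// lte_fin divr_gt0// subr_gt0.
rewrite lee_fin in j0.
have -> : (\sum_(n <oo) ((rho ^+ n)%:E * (j%:E + j%:E)) = (j + j)%:E * \sum_(n <oo) (rho ^+ n)%:E)%E.
  rewrite -nneseriesZl; last by move=> n _; rewrite lee_fin.
  by apply: eq_eseriesr => n _; rewrite -EFinD muleC.
apply: le_trans (lee_wpmul2l _ (geometric_eseries_le rho01)) _.
  by rewrite lee_fin addr_ge0.
by rewrite -!EFinM lee_fin; apply: eq_ler; ring.
Qed.

End Dilation.

(** * The real interpolation norms through the weighted K-functional *)

Section RealNorm.
Context {R : realType} {U : lmodType R[i]}.
Local Notation mu := (@lebesgue_measure R).
Local Notation D := (`]0, +oo[%classic : set R).
Context (P0 P1 : U -> \bar R) (hU : is_couple P0 P1) (theta : R) (htheta : 0 < theta < 1).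
Local Notation K := (kf P0 P1).

Definition weighted_kf (x : U) (t : R) : R := t `^ (- theta) * K t x.

Lemma weighted_kfE x t : 0 < t ->
  weighted_kf x t = K (expR (ln t)) x * expR (- (ln t * theta)).
Proof.
move=> t0; rewrite /weighted_kf /powR gt_eqF// lnK ?posrE// mulrC.
by congr (_ * expR _); ring.
Qed.

Lemma weighted_kf_ge0 x t : 0 < t -> 0 <= weighted_kf x t.
Proof. by move=> t0; rewrite mulr_ge0 ?powR_ge0 ?(kf_ge0 hU). Qed.

Lemma power_boundedP x A :
  power_bounded theta P0 P1 x A <-> forall t, 0 < t -> weighted_kf x t <= A.
Proof.
split=> H t t0; have := H t t0; rewrite weighted_kfE// lnK ?posrE//.
  by rewrite expRN ler_pdivrMr ?expR_gt0.
by rewrite expRN ler_pdivrMr ?expR_gt0.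
Qed.

Lemma rinterp_finE x (r : R) : rinterp P0 P1 theta r%:E x =
  poweR (log_integral (fun t => (weighted_kf x t) `^ r)) r^-1.
Proof.
rewrite /rinterp /log_integral; congr poweR; apply: eq_integral => t /set_mem.
by rewrite /= in_itv/= andbT => t0; rewrite (KfunE hU _ t0).
Qed.

Lemma rinterp_pinftyE x : rinterp P0 P1 theta +oo%E x =
  ereal_sup [set (weighted_kf x t)%:E | t in D].
Proof.
rewrite /rinterp; congr ereal_sup; apply/seteqP; split => _ [t tD <-]; exists t => //.
  by rewrite (KfunE hU)//; move: tD; rewrite /= in_itv/= andbT.
by rewrite (KfunE hU)//; move: tD; rewrite /= in_itv/= andbT.
Qed.

Lemma measurable_weighted_kf x (r : R) :
  measurable_fun D (fun t => ((weighted_kf x t) `^ r / t)%:E).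
Proof.
apply/measurable_EFinP.
(* Monotonicity of [K(., x)] holds for positive arguments; the value [0] elsewhere makes the
   function nondecreasing on the whole line. *)
pose k t := if t <= 0 then 0 else K t x.
have kE t : D t -> k t = K t x.
  by rewrite /= in_itv/= andbT /k => t0; rewrite leNgt t0.
have mk : measurable_fun D (fun t => K t x).
  apply: (@eq_measurable_fun _ _ _ _ D k) => [t /set_mem /kE //|].
  apply: nondecreasing_measurable => // s t st; rewrite /k.
  case: ifPn => s0; case: ifPn => t0 //.
  - by apply: (kf_ge0 hU); rewrite ltNge.
  - by rewrite (le_trans st t0) in s0.
  - by apply: (kf_mono hU) => //; rewrite ltNge.
have mp (q : R) : measurable_fun D (fun t : R => t `^ q).
  by apply: measurable_funTS; exact: measurable_powR.
have mi : measurable_fun D (fun t : R => t^-1).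
  apply: (@eq_measurable_fun _ _ _ _ D (fun t : R => t `^ (-1))) => // t /set_mem.
  by rewrite /= in_itv/= andbT => t0; rewrite powR_inv1// ltW.
apply: measurable_funM => //.
apply: (measurableT_comp (measurable_powR r)).
exact: measurable_funM.
Qed.

(* On [t, 2 t] the integrand is at least a fixed multiple of its value at [t],
   since [K(., x)] is nondecreasing. *)
Lemma rinterp_power_bounded x q : (1 <= q)%E -> (rinterp P0 P1 theta q x < +oo)%E ->
  exists A, power_bounded theta P0 P1 x A.
Proof.
have [th0 th1] := andP htheta.
case: q => [r| |] //; last first.
  move=> _; rewrite rinterp_pinftyE => H.
  have s0 : (0 <= ereal_sup [set (weighted_kf x t)%:E | t in D])%E.
    apply: (@le_trans _ _ (weighted_kf x 1)%:E); first by rewrite lee_fin weighted_kf_ge0.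
    by apply: ereal_sup_ubound; exists 1 => //=; rewrite in_itv/= ltr01.
  exists (fine (ereal_sup [set (weighted_kf x t)%:E | t in D])).
  apply/power_boundedP => t t0; rewrite -lee_fin fineK ?ge0_fin_numE//.
  by apply: ereal_sup_ubound; exists t => //=; rewrite in_itv/= t0.
rewrite lee_fin => r1; have r0 : 0 < r by exact: lt_le_trans r1.
rewrite rinterp_finE => /lty_poweRy H.
have {}H := H (lt0r_neq0 (eq_ind_r (fun z => is_true z) r0 (invr_gt0 r))).
set I := log_integral _ in H.
have I0 : (0 <= I)%E by apply: log_integral_ge0 => t _; exact: powR_ge0.
have IE : I = (fine I)%:E by rewrite fineK// ge0_fin_numE.
(* The least factor by which [s^(- theta)] drops between [t] and [2 t]. *)
pose c : R := 2 `^ (- theta); have c0 : 0 < c by rewrite powR_gt0.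
exists (((2 * fine I) `^ r^-1) / c); apply/power_boundedP => t t0.
have low s : t <= s <= 2 * t -> c * weighted_kf x t <= weighted_kf x s.
  move=> /andP[ts s2]; have s0 : 0 < s by exact: lt_le_trans ts.
  rewrite /weighted_kf mulrA /c -powRM ?(ltW t0)//; apply: ler_pM => //.
  - exact: powR_ge0.
  - exact: (kf_ge0 hU).
  - rewrite !powRN lef_pV2 ?posrE ?powR_gt0 ?mulr_gt0//.
    by apply: ge0_ler_powR; rewrite ?nnegrE ?mulr_ge0 ?(ltW th0) ?(ltW s0) ?(ltW t0).
  - exact: (kf_mono hU).
set G := c * weighted_kf x t.
have G0 : 0 <= G by rewrite mulr_ge0 ?weighted_kf_ge0// ltW.
(* On an interval of length [t], the integrand is at least [G^r] times [1 / s >= 1 / (2 t)]. *)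
have : (((G `^ r) / (2 * t))%:E * t%:E <= I)%E.
  apply: (@le_trans _ _ (\int[mu]_(s in `[t, (2 * t)%R]) ((weighted_kf x s `^ r / s)%R%:E))%E); last first.
    apply: ge0_subset_integral => //.
    - exact: measurable_weighted_kf.
    - by move=> s; rewrite /= in_itv/= andbT => s0; rewrite lee_fin divr_ge0 ?powR_ge0// ltW.
    - by move=> s /=; rewrite !in_itv/= andbT => /andP[ts _]; exact: lt_le_trans ts.
  have <- : (\int[mu]_(s in `[t, (2 * t)%R]) (cst ((G `^ r) / (2 * t))%:E) s =
      ((G `^ r) / (2 * t))%:E * t%:E)%E.
    rewrite integral_cst//; congr (_ * _)%E.
    transitivity (lebesgue_measure (`[t, (2 * t)%R]%classic : set R)) => //.
    rewrite lebesgue_measure_itv/= lte_fin ltr_pMl// ltr1n -EFinB.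
    by congr EFin; ring.
  apply: ge0_le_integral => //.
  - by move=> s _; rewrite lee_fin divr_ge0 ?powR_ge0// mulr_ge0// ltW.
  - apply: measurable_funS (measurable_weighted_kf x r) => //.
    by move=> s /=; rewrite !in_itv/= andbT => /andP[ts _]; exact: lt_le_trans ts.
  move=> s /=; rewrite in_itv/= => tss; have /andP[ts s2] := tss.
  have s0 : 0 < s by exact: lt_le_trans ts.
  rewrite lee_fin; apply: ler_pM; rewrite ?powR_ge0 ?invr_ge0 ?mulr_ge0 ?(ltW t0)//.
    by apply: ge0_ler_powR; rewrite ?nnegrE ?(ltW r0) ?weighted_kf_ge0// low.
  by rewrite lef_pV2 ?posrE ?mulr_gt0.
rewrite IE -EFinM lee_fin (_ : _ / _ * t = G `^ r / 2); last by field; rewrite gt_eqF.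
rewrite ler_pdivrMr// [leRHS]mulrC => Gr.
rewrite ler_pdivlMr// mulrC -/G.
have -> : G = (G `^ r) `^ r^-1 by rewrite -powRrM divff ?gt_eqF// powRr1.
have F0 : 0 <= 2 * fine I by rewrite mulr_ge0// fine_ge0.
by apply: ge0_ler_powR; rewrite ?nnegrE ?powR_ge0 ?invr_ge0 ?(ltW r0).
Qed.

Lemma rinterp_ge0 x q : (1 <= q)%E -> (0 <= rinterp P0 P1 theta q x)%E.
Proof.
case: q => [r| |] // _; first by rewrite rinterp_finE poweR_ge0.
rewrite rinterp_pinftyE; apply: (@le_trans _ _ (weighted_kf x 1)%:E).
  by rewrite lee_fin weighted_kf_ge0.
by apply: ereal_sup_ubound; exists 1 => //=; rewrite in_itv/= ltr01.
Qed.

End RealNorm.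

Section RealNormComparison.
Context {R : realType} {U1 U2 : lmodType R[i]}.
Context (P0 P1 : U1 -> \bar R) (Q0 Q1 : U2 -> \bar R).
Context (hP : is_couple P0 P1) (hQ : is_couple Q0 Q1).
Context (theta : R) (htheta : 0 < theta < 1).

Lemma poweR_le_scale (a b : \bar R) (k r : R) : 0 < r -> 0 <= k -> (0 <= a)%E -> (0 <= b)%E ->
  (a <= k%:E * b)%E -> (poweR a (r^-1)%R <= ((k `^ r^-1)%R)%:E * poweR b (r^-1)%R)%E.
Proof.
move=> r0 k0 a0 b0 ab; rewrite -poweR_EFin -poweRM ?lee_fin//.
apply: gt0_ler_poweR => //; rewrite ?invr_ge0 ?ltW// in_itv/= ?leey ?a0//.
by rewrite mule_ge0 ?lee_fin.
Qed.

Lemma rinterp_le (c : R) q : (1 <= q)%E -> 0 <= c ->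
  exists C, forall (x : U1) (y : U2),
  (forall t, 0 < t -> kf P0 P1 t x <= c * kf Q0 Q1 t y) ->
  (rinterp P0 P1 theta q x <= C%:E * rinterp Q0 Q1 theta q y)%E.
Proof.
case: q => [r| |] // r1 c0.
  rewrite lee_fin in r1; have r0 : 0 < r by exact: lt_le_trans r1.
  exists ((c `^ r) `^ r^-1) => x y xy; rewrite !rinterp_finE//.
  have W t : 0 < t -> weighted_kf P0 P1 theta x t <= c * weighted_kf Q0 Q1 theta y t.
    by move=> t0; rewrite /weighted_kf mulrCA ler_wpM2l ?powR_ge0// xy.
  apply: poweR_le_scale => //; rewrite ?powR_ge0//.
  - by apply: log_integral_ge0 => t _; exact: powR_ge0.
  - by apply: log_integral_ge0 => t _; exact: powR_ge0.
  apply: log_integral_le => //; rewrite ?powR_ge0//.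
  - by move=> t _; exact: powR_ge0.
  - by move=> t _; exact: powR_ge0.
  - exact: measurable_weighted_kf.
  - exact: measurable_weighted_kf.
  move=> t t0; rewrite -powRM ?weighted_kf_ge0//.
  have cK0 : 0 <= c * weighted_kf Q0 Q1 theta y t.
    by apply: mulr_ge0 => //; exact: weighted_kf_ge0.
  have xK0 : 0 <= weighted_kf P0 P1 theta x t by exact: weighted_kf_ge0.
  exact: ge0_ler_powR (ltW r0) _ _ xK0 cK0 (W t t0).
exists c => x y xy; rewrite !rinterp_pinftyE//.
apply: ge_ereal_sup => _ [t tD <-]; have t0 : 0 < t by move: tD; rewrite /= in_itv/= andbT.
apply: (@le_trans _ _ (c%:E * (weighted_kf Q0 Q1 theta y t)%:E)%E).
  by rewrite -EFinM lee_fin /weighted_kf mulrCA ler_wpM2l ?powR_ge0// xy.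
apply: lee_wpmul2l; first by rewrite lee_fin.
by apply: ereal_sup_ubound; exists t.
Qed.

Lemma rinterp_damped (Cr ep : R) q : (1 <= q)%E -> 0 < Cr -> 0 < ep ->
  exists C, forall (x : U1) (y : U2),
  (forall t Bd, 0 < t ->
    (forall n : nat, weighted_kf Q0 Q1 theta y (expR n%:R * t) * expR (- (ep * n%:R)) <= Bd) ->
    (forall n : nat, weighted_kf Q0 Q1 theta y (expR (- n%:R) * t) * expR (- (ep * n%:R)) <= Bd) ->
    weighted_kf P0 P1 theta x t <= Cr * Bd) ->
  (rinterp P0 P1 theta q x <= C%:E * rinterp Q0 Q1 theta q y)%E.
Proof.
move=> + Cr0 ep0; case: q => [r| |] // r1.
  rewrite lee_fin in r1; have r0 : 0 < r by exact: lt_le_trans r1.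
  have [K K0 HK] := log_integral_damped r0 Cr0 ep0.
  exists (K `^ r^-1) => x y dom; rewrite !rinterp_finE//.
  apply: poweR_le_scale; rewrite ?(ltW K0)//.
  - by apply: log_integral_ge0 => t _; exact: powR_ge0.
  - by apply: log_integral_ge0 => t _; exact: powR_ge0.
  apply: HK => //.
  - by move=> t; exact: weighted_kf_ge0.
  - by move=> t; exact: weighted_kf_ge0.
  - exact: measurable_weighted_kf.
  - exact: measurable_weighted_kf.
exists Cr => x y dom; rewrite !rinterp_pinftyE//.
(* For [q = oo] the supremum itself, if finite, serves as [Bd]. *)
set Sy := ereal_sup [set (weighted_kf Q0 Q1 theta y t)%:E | t in _].
have Sle t : 0 < t -> ((weighted_kf Q0 Q1 theta y t)%:E <= Sy)%E.
  by move=> t0; apply: ereal_sup_ubound; exists t => //=; rewrite in_itv/= t0.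
have S0 : (0 <= Sy)%E.
  by apply: le_trans (Sle 1 ltr01); rewrite lee_fin weighted_kf_ge0.
apply: ge_ereal_sup => _ [t tD <-]; have t0 : 0 < t by move: tD; rewrite /= in_itv/= andbT.
case E : Sy S0 Sle => [sy| |] // S0 Sle; last by rewrite gt0_muley ?leey// lte_fin.
rewrite -EFinM lee_fin; rewrite lee_fin in S0.
have le1 s (n : nat) : 0 < s -> weighted_kf Q0 Q1 theta y s * expR (- (ep * n%:R)) <= sy.
  move=> s0; have := Sle s s0; rewrite lee_fin; apply: le_trans.
  rewrite ler_piMr ?weighted_kf_ge0// -[leRHS]expR0 ler_expR oppr_le0 mulr_ge0//.
  exact: ltW.
by apply: dom => // n; apply: le1; rewrite mulr_gt0 ?expR_gt0.
Qed.

End RealNormComparison.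

Theorem theorem4p11 (R : realType) (V W : lmodType R[i])
    (N0 N1 : V -> \bar R) (M0 M1 : W -> \bar R)
    (hX : is_couple N0 N1) (hY : is_couple M0 M1)
    (T : {linear V -> W})
    (hT0 : bounded_between N0 M0 T) (hT1 : bounded_between N1 M1 T)
    (theta : R) (htheta : 0 < theta < 1)
    (hinv : invertible_between (cinterp N0 N1 theta) (cinterp M0 M1 theta) T) :
  forall q : \bar R, (1 <= q)%E ->
    invertible_between (rinterp N0 N1 theta q) (rinterp M0 M1 theta q) T.
Proof.
move=> q q1.
have [cT cT0 [_ _ hbK]] := couple_operator_bound hX hY hT0 hT1.
have [Cr [ep [Cr0 ep0 surj low]]] := real_inverse hX hY hT0 hT1 htheta hinv.
have [CT hCT] := rinterp_le hY hX theta q1 (ltW cT0).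
have bT x : (rinterp M0 M1 theta q (T x) <= CT%:E * rinterp N0 N1 theta q x)%E.
  by apply: hCT => t t0; exact: hbK.
have [CL hCL] := rinterp_damped hX hY theta q1 Cr0 ep0.
have lowX x A : power_bounded theta N0 N1 x A ->
    (rinterp N0 N1 theta q x <= CL%:E * rinterp M0 M1 theta q (T x))%E.
  move=> xA; apply: hCL => t Bd t0 B1 B2.
  rewrite weighted_kfE//; apply: (low _ _ _ _ xA) => n.
    have := B1 n; rewrite weighted_kfE ?mulr_gt0 ?expR_gt0//.
    by rewrite lnM ?posrE ?expR_gt0// expRK [n%:R + _]addrC.
  have := B2 n; rewrite weighted_kfE ?mulr_gt0 ?expR_gt0//.
  by rewrite lnM ?posrE ?expR_gt0// expRK [- n%:R + _]addrC.
have finM (c : R) (z : \bar R) : (0 <= z)%E -> (z < +oo)%E -> (c%:E * z < +oo)%E.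
  by move=> z0 zoo; rewrite -(fineK (x := z)) ?ge0_fin_numE// -EFinM ltry.
split.
- move=> x xoo; apply: le_lt_trans (bT x) _.
  by apply: finM xoo; exact: rinterp_ge0.
- by exists CT => x _; exact: bT.
(* The preimage is found in the space with [q = oo]; only [lowX] then places it in the space with
   the given [q]. *)
- move=> y yoo; have [A yA] := rinterp_power_bounded hY htheta q1 yoo.
  have [x [A' [Tx xA']]] := surj y A yA; exists x; split => //.
  apply: le_lt_trans (lowX x A' xA') _; rewrite Tx.
  by apply: finM yoo; exact: rinterp_ge0.
- exists CL => x xoo; have [A xA] := rinterp_power_bounded hX htheta q1 xoo.
  exact: lowX xA.
Qed.
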